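(* Let $p\in(0,2]$ and let $K\subset\mathbb{R}^d$ be a symmetric star body such that $(\mathbb{R}^d,\|\cdot\|_K)$ embeds isometrically in $L_p$. Then the function $$\Delta^{n-1}\ni(a_1,\ldots,a_n)\mapsto\left|B_p^n(K)\cap H_{\sqrt a}\right|$$ is log-convex on $\Delta^{n-1}$.
   Context: A set $K\subset\mathbb{R}^d$ is a star body if it is compact, $tx\in K$ for all $x\in K$, $t\in[0,1]$, and its Minkowski functional $\|x\|_K=\inf\{\lambda>0:x\in\lambda K\}$ is (finite and) continuous on $\mathbb{R}^d$; symmetric means $K=-K$. $(\mathbb{R}^d,\|\cdot\|_K)$ embeds isometrically in $L_p$ if there is a linear map $S:\mathbb{R}^d\to L_p([0,1])$ with $\|Sx\|_{L_p}=\|x\|_K$ for all $x$. $B_p^n(K)=\{x=(x_1,\ldots,x_n)\in(\mathbb{R}^d)^n:\sum_{i=1}^n\|x_i\|_K^p\le1\}$. $\Delta^{n-1}=\{a\in[0,1]^n:a_1+\cdots+a_n=1\}$. For $a\in\Delta^{n-1}$, $H_{\sqrt a}=\{x\in(\mathbb{R}^d)^n:\sqrt{a_1}x_1+\cdots+\sqrt{a_n}x_n=0\}$, and $|\cdot|$ of a subset of $H_{\sqrt a}$ is $(nd-d)$-dimensional volume (Hausdorff measure). A function $f:C\to[0,\infty)$ on a convex set $C$ is log-convex if $f(\lambda x+(1-\lambda)y)\le f(x)^\lambda f(y)^{1-\lambda}$ for all $x,y\in C$, $\lambda\in(0,1)$. *)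

(* Defs.v *)
(* Vectors of R^d are rows 'rV[R]_d, and a
   point x = (x_1, ..., x_n) of (R^d)^n is the n x d matrix with rows x_i. *)
From HB Require Import structures.
From mathcomp Require Import all_boot all_order all_algebra.
From mathcomp Require Import all_classical all_reals all_analysis.
Set Implicit Arguments.
Unset Strict Implicit.
Unset Printing Implicit Defensive.
Import Order.TTheory GRing.Theory Num.Theory.
Import numFieldNormedType.Exports.
Local Open Scope classical_set_scope.
Local Open Scope ring_scope.

Definition dilate (R : realType) (V : lmodType R) (l : R) (K : set V) : set V :=
  [set l *: y | y in K].

(* The real-valued [inf] is 0 on the empty set: finiteness of the functional
   is required separately in [star_body]. *)
Definition minkowski_functional (R : realType) (d : nat) (K : set 'rV[R]_d)
    (x : 'rV[R]_d) : R :=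
  inf [set l : R | 0 < l /\ dilate l K x].

Record star_body (R : realType) (d : nat) (K : set 'rV[R]_d) : Prop := StarBody {
  star_body_compact : compact K ;
  star_body_star : forall (x : 'rV[R]_d) (t : R), K x -> 0 <= t <= 1 -> K (t *: x) ;
  star_body_finite : forall x : 'rV[R]_d, exists2 l : R, 0 < l & dilate l K x ;
  star_body_continuous : continuous (minkowski_functional K)
}.

Definition symmetric_set (R : realType) (d : nat) (K : set 'rV[R]_d) : Prop :=
  K = [set - x | x in K].

Definition lebesgue01 (R : realType) : {measure set (measurableTypeR R) -> \bar R} :=
  mrestr lebesgue_measure (measurable_itv `[0 : R, 1]).

(* A linear map into L_p([0,1]) is given through representatives, so linearity
   holds almost everywhere; this also makes sense for p < 1, where the library
   has no vector space L_p.  The values S x are functions on the whole line, but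
   [lebesgue01] only sees their restriction to [0,1]. *)
Definition embeds_isometrically_in_Lp (R : realType) (d : nat) (p : R)
    (K : set 'rV[R]_d) : Prop :=
  exists S : 'rV[R]_d -> R -> R,
  [/\ forall x, S x \in Lfun (lebesgue01 R) p%:E,
      forall (c : R) (x y : 'rV[R]_d),
        {ae lebesgue01 R, forall t, S (c *: x + y) t = c * S x t + S y t} &
      forall x,
        ('N[lebesgue01 R]_(p%:E)[EFin \o S x])%E = (minkowski_functional K x)%:E].

Definition Bpn (R : realType) (n d : nat) (p : R) (K : set 'rV[R]_d) :
    set 'M[R]_(n, d) :=
  [set x | \sum_(i < n) minkowski_functional K (row i x) `^ p <= 1].

Definition std_simplex (R : realType) (n : nat) : set 'rV[R]_n :=
  [set a | (forall i, 0 <= a 0 i <= 1) /\ \sum_(i < n) a 0 i = 1].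

Definition Hsqrt (R : realType) (n d : nat) (a : 'rV[R]_n) : set 'M[R]_(n, d) :=
  [set x | \sum_(i < n) Num.sqrt (a 0 i) *: row i x = 0].

(* The norm `|x| of the library on matrices is the sup norm. *)
Definition euclidean_norm (R : realType) (n d : nat) (x : 'M[R]_(n, d)) : R :=
  Num.sqrt (\sum_(i < n) \sum_(j < d) x i j ^+ 2).

(* -oo on the empty set. *)
Definition diameter (R : realType) (n d : nat) (U : set 'M[R]_(n, d)) : \bar R :=
  ereal_sup [set (euclidean_norm (xy.1 - xy.2))%:E | xy in U `*` U].

(* diam(U)^m; for m = 0 it is 1 if U is nonempty and 0 otherwise. *)
Definition hausdorff_gauge (R : realType) (n d m : nat)
    (U : set 'M[R]_(n, d)) : \bar R :=
  if `[< U = set0 >] then 0%E else (diameter U ^+ m)%E.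

Definition hausdorff_content (R : realType) (n d m : nat) (delta : R)
    (A : set 'M[R]_(n, d)) : \bar R :=
  ereal_inf [set (\sum_(k <oo) hausdorff_gauge m (U k))%E | U in
    [set U : nat -> set 'M[R]_(n, d) |
      A `<=` \bigcup_k U k /\ forall k, (diameter (U k) <= delta%:E)%E]].

(* Volume pi^(m/2) / Gamma(m/2 + 1) of the Euclidean unit ball of R^m. *)
Fixpoint unit_ball_volume (R : realType) (m : nat) : R :=
  match m with
  | 0 => 1
  | 1 => 2
  | k.+2 => 2 * pi / k.+2%:R * unit_ball_volume R k
  end.

(* m-dimensional Hausdorff (outer) measure, normalized so as to agree with
   m-dimensional Lebesgue measure on m-dimensional subspaces. *)
Definition hausdorff_measure (R : realType) (n d m : nat)
    (A : set 'M[R]_(n, d)) : \bar R :=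
  ((unit_ball_volume R m / 2 ^+ m)%:E *
   ereal_sup [set hausdorff_content m delta A | delta in [set delta : R | (0 < delta)%R]])%E.

(* The first clause says that f takes its values in [0, oo) on C. *)
Definition log_convex_on (R : realType) (V : lmodType R) (C : set V)
    (f : V -> \bar R) : Prop :=
  (forall x, C x -> (0 <= f x < +oo)%E) /\
  (forall (x y : V) (l : R), C x -> C y -> 0 < l < 1 ->
    (f (l *: x + (1 - l) *: y)%R <= f x `^ l * f y `^ (1 - l))%E).

(* Main.v *)
Require Import Defs.
From HB Require Import structures.
From mathcomp Require Import all_boot all_order all_algebra all_fingroup.
From mathcomp Require Import all_classical all_reals all_analysis.
From mathcomp Require Import measurable_realfun ring lra.
Import Order.TTheory GRing.Theory Num.Theory.
Import numFieldNormedType.Exports.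
Local Open Scope classical_set_scope.
Local Open Scope ring_scope.
Set Implicit Arguments.
Unset Strict Implicit.
Unset Printing Implicit Defensive.

(** Write N(x) = |x_1|_K^p + ... + |x_n|_K^p, so that the ball is {N <= 1}.

    Since p <= 2 and K embeds in L_p, the function exp(-N) is a pointwise limit
    of sub-convex combinations of Gaussians exp(-sum_i x_i A_i x_i^T) with
    positive semidefinite A_i ([mixture_norms]).  Indeed |t|^p = (t^2)^(p/2); a
    power r^q with q < 1 is a limit of positive combinations of the functions
    1 - exp(-b r) ([plim_ratio]); and exp(-w (1 - g)) is the limit of
    (1 - w/k + (w/k) g)^k ([mixture_compound]).  An L_p norm to the power p is
    a limit of finite sums of terms |<x, u>|^p ([mixture_Lp]), and the class of
    these limits of Gaussians is stable under products.

    For one Gaussian with positive definite A_i, the integral over the subspace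
    sum_i sqrt(a_i) x_i = 0 is a constant divided by the square root of the
    determinant of the restricted form.  By Jacobi's identity for complementary
    minors this determinant is (prod_i det A_i) det(sum_i a_i A_i^-1)
    ([det_block_form]), in which a enters affinely; as the determinant is
    log-concave on positive definite matrices ([det_log_concave]), the integral
    is log-convex in a.  The two-term Hoelder inequality carries log-convexity
    over to combinations, and dominated convergence to limits
    ([damped_log_convex]).  A factor exp(-e |y|^2) makes all these integrals
    converge; it is removed at the end ([slice_integral_log_convex]).

    Finally N is homogeneous of degree p, so that the integral of exp(-N) over
    the subspace is the measure of the slice {N <= 1} up to a factor that does
    not depend on a.  It is enough to know this up to a factor exp(-h) with h
    arbitrarily small, which follows by replacing exp(-N) with a step function
    ([layer_cake_upper], [layer_cake_lower]).

    The measure is the Hausdorff measure itself, on the space of row vectors of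
    full dimension m: the subspace is parametrized isometrically by that space
    ([simplex_frame]), half-spaces are Caratheodory measurable, boxes have finite
    measure, and invariance under isometries and homogeneity determine the
    effect of a linear substitution on Gaussian integrals
    ([integral_gauss_form]) in terms of the mass E of exp(-|x|^2).  Its value is
    never needed, not even that it is nonzero: were E = 0, all bounded sets
    would be null ([gauss0_bounded]). *)

(** * The Hausdorff outer measure *)

Section EuclideanNorm.
Context {R : realType} {n d : nat}.
Implicit Types x y : 'M[R]_(n, d).

Lemma euclidean_norm_ge0 x : 0 <= euclidean_norm x.
Proof. exact: sqrtr_ge0. Qed.

Lemma sum_sqr_ge0 x : 0 <= \sum_(i < n) \sum_(j < d) x i j ^+ 2.
Proof. by apply: sumr_ge0 => i _; apply: sumr_ge0 => j _; exact: sqr_ge0. Qed.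

Lemma sqr_euclidean_norm x :
  euclidean_norm x ^+ 2 = \sum_(i < n) \sum_(j < d) x i j ^+ 2.
Proof. by rewrite sqr_sqrtr// sum_sqr_ge0. Qed.

Lemma euclidean_normZ (t : R) x : 0 <= t ->
  euclidean_norm (t *: x) = t * euclidean_norm x.
Proof.
move=> t0; rewrite /euclidean_norm -[in RHS](ger0_norm t0) -sqrtr_sqr.
rewrite -sqrtrM ?sqr_ge0//; congr Num.sqrt.
rewrite mulr_sumr; apply: eq_bigr => i _; rewrite mulr_sumr.
by apply: eq_bigr => j _; rewrite mxE exprMn.
Qed.

Lemma entry_le_euclidean_norm x i j : `|x i j| <= euclidean_norm x.
Proof.
rewrite -sqrtr_sqr ler_sqrt ?sum_sqr_ge0//.
rewrite (bigD1 i)//= (bigD1 j)//= -addrA lerDl addr_ge0//.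
  by apply: sumr_ge0 => k _; exact: sqr_ge0.
by apply: sumr_ge0 => k _; apply: sumr_ge0 => l _; exact: sqr_ge0.
Qed.

End EuclideanNorm.

Section Diameter.
Context {R : realType} {n d : nat}.
Implicit Types (U V : set 'M[R]_(n, d)) (m : nat).

Lemma diameter_ub U x y : U x -> U y ->
  ((euclidean_norm (x - y))%:E <= diameter U)%E.
Proof. by move=> Ux Uy; apply: ereal_sup_ubound; exists (x, y). Qed.

Lemma diameter_le U (r : \bar R) :
  (forall x y, U x -> U y -> ((euclidean_norm (x - y))%:E <= r)%E) ->
  (diameter U <= r)%E.
Proof. by move=> H; apply: ge_ereal_sup => _ [[x y] [/= Ux Uy] <-]; exact: H. Qed.

Lemma diameter_ge0 U : U !=set0 -> (0 <= diameter U)%E.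
Proof.
by move=> [x Ux]; apply: le_trans (diameter_ub Ux Ux); rewrite lee_fin euclidean_norm_ge0.
Qed.

Lemma diameter0 : diameter (set0 : set 'M[R]_(n, d)) = -oo%E.
Proof. by rewrite /diameter setX0 image_set0 ereal_sup0. Qed.

Lemma gauge0 m : hausdorff_gauge m (set0 : set 'M[R]_(n, d)) = 0%E.
Proof. by rewrite /hausdorff_gauge asboolT. Qed.

Lemma gauge_neq0 m U : U !=set0 -> hausdorff_gauge m U = (diameter U ^+ m)%E.
Proof. by move=> /set0P/eqP U0; rewrite /hausdorff_gauge asboolF. Qed.

Lemma gauge_ge0 m U : (0 <= hausdorff_gauge m U)%E.
Proof.
have [->|/set0P U0] := eqVneq U set0; first by rewrite gauge0.
by rewrite gauge_neq0// expe_ge0// diameter_ge0.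
Qed.

Lemma diameter_fin U (r : R) : U !=set0 -> (diameter U <= r%:E)%E ->
  exists2 s, 0 <= s & diameter U = s%:E.
Proof.
move=> U0; have := diameter_ge0 U0.
by case: (diameter U) => [s||]//; rewrite lee_fin => s0 _; exists s.
Qed.

Lemma gauge_le m U (r : R) : 0 <= r -> (diameter U <= r%:E)%E ->
  (hausdorff_gauge m U <= (r ^+ m)%:E)%E.
Proof.
move=> r0 Ur; have [->|/set0P U0] := eqVneq U set0.
  by rewrite gauge0 lee_fin exprn_ge0.
rewrite gauge_neq0//; have [s s0 E] := diameter_fin U0 Ur.
by move: Ur; rewrite E -EFin_expe !lee_fin => sr; rewrite lerXn2r.
Qed.

End Diameter.

(** The set function whose countable covers define the Hausdorff content. *)
Definition small_gauge {R : realType} {n d : nat} (m : nat) (delta : R)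
    (U : set 'M[R]_(n, d)) : \bar R :=
  if (diameter U <= delta%:E)%E then hausdorff_gauge m U else +oo%E.

Section Content.
Context {R : realType} {n d : nat} (m : nat).
Implicit Types (A B : set 'M[R]_(n, d)) (delta : R).

Lemma small_gauge0 delta : small_gauge m delta (set0 : set 'M[R]_(n, d)) = 0%E.
Proof. by rewrite /small_gauge diameter0 leNye gauge0. Qed.

Lemma small_gauge_ge0 delta A : (0 <= small_gauge m delta A)%E.
Proof. by rewrite /small_gauge; case: ifP => // _; exact: gauge_ge0. Qed.

Lemma hausdorff_contentE delta A :
  hausdorff_content m delta A =
  mu_ext (T := g_sigma_algebraType [set: set 'M[R]_(n, d)])
    (small_gauge m delta) A.
Proof.
apply/eqP; rewrite eq_le; apply/andP; split.
- apply: le_ereal_inf_tmp => _ [U [_ AU] <-].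
  have [H|] := pselect (forall k, (diameter (U k) <= delta%:E)%E).
    apply: ereal_inf_lbound; exists U => //; apply: eq_eseriesr => k _.
    by rewrite /small_gauge H.
  move=> /existsNP[k /negP Hk].
  rewrite (@nneseries_pinfty _ _ xpredT k) ?leey// => *.
    exact: small_gauge_ge0.
  by rewrite /small_gauge (negbTE Hk).
- apply: le_ereal_inf_tmp => _ [U [AU H] <-].
  apply: ereal_inf_lbound; exists U; first split => //.
    by move=> i; exact: sub_sigma_algebra.
  by apply: eq_eseriesr => k _; rewrite /small_gauge H.
Qed.

Lemma content_ge0 delta A : (0 <= hausdorff_content m delta A)%E.
Proof. by rewrite hausdorff_contentE mu_ext_ge0//; exact: small_gauge_ge0. Qed.

Lemma content0 delta : hausdorff_content m delta (set0 : set 'M[R]_(n, d)) = 0%E.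
Proof.
by rewrite hausdorff_contentE mu_ext0//; [exact: small_gauge0|exact: small_gauge_ge0].
Qed.

Lemma le_content delta A B : A `<=` B ->
  (hausdorff_content m delta A <= hausdorff_content m delta B)%E.
Proof. by move=> AB; rewrite !hausdorff_contentE; exact: le_mu_ext. Qed.

Lemma content_sigma_subadditive delta :
  sigma_subadditive (@hausdorff_content R n d m delta).
Proof.
move=> F; rewrite hausdorff_contentE.
have := @mu_ext_sigma_subadditive _ (g_sigma_algebraType [set: set 'M[R]_(n, d)])
  R _ (@small_gauge_ge0 delta) F.
by under eq_eseriesr do rewrite -hausdorff_contentE.
Qed.

HB.instance Definition _ delta := isOuterMeasure.Build R 'M[R]_(n, d)
  (hausdorff_content m delta) (content0 delta) (content_ge0 delta)
  (@le_content delta) (@content_sigma_subadditive delta).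

Lemma content_single delta A : (diameter A <= delta%:E)%E ->
  (hausdorff_content m delta A <= hausdorff_gauge m A)%E.
Proof.
move=> Ad; apply: ereal_inf_lbound.
exists (fun k => if k is 0 then A else set0).
  split; first by move=> x Ax; exists 0%N.
  by case=> [//|k]; rewrite diameter0 leNye.
rewrite nneseries_recl//; last by move=> k _; exact: gauge_ge0.
rewrite eseries_cond/= eseries0 ?adde0// => -[|k]//= _ _.
by rewrite gauge0.
Qed.

Lemma content_anti delta1 delta2 A : delta1 <= delta2 ->
  (hausdorff_content m delta2 A <= hausdorff_content m delta1 A)%E.
Proof.
move=> d12; apply: ereal_inf_le_tmp => _ [U [AU H] <-]; exists U => //; split => // k.
by apply: le_trans (H k) _; rewrite lee_fin.
Qed.

End Content.

(** The Hausdorff outer measure before normalization. *)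
Definition hausdorff_pre {R : realType} {n d : nat} (m : nat)
    (A : set 'M[R]_(n, d)) : \bar R :=
  ereal_sup [set hausdorff_content m delta A | delta in [set delta : R | 0 < delta]].

Section HausdorffOuter.
Context {R : realType} {n d : nat} (m : nat).
Implicit Types (A B : set 'M[R]_(n, d)) (delta : R).
Local Notation H := (@hausdorff_pre R n d m).

Lemma content_le_hausdorff_pre delta A : 0 < delta ->
  (hausdorff_content m delta A <= H A)%E.
Proof. by move=> d0; apply: ereal_sup_ubound; exists delta. Qed.

Lemma hausdorff_pre_leP A (r : \bar R) :
  (forall delta, 0 < delta -> (hausdorff_content m delta A <= r)%E) -> (H A <= r)%E.
Proof. by move=> K; apply: ge_ereal_sup => _ [delta /= d0 <-]; exact: K. Qed.

Lemma hausdorff_pre_ge0 A : (0 <= H A)%E.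
Proof. exact: le_trans (content_ge0 _ _ _) (content_le_hausdorff_pre _ ltr01). Qed.

Lemma hausdorff_pre0 : H set0 = 0%E.
Proof.
apply/eqP; rewrite eq_le hausdorff_pre_ge0 andbT.
by apply: hausdorff_pre_leP => delta _; rewrite content0.
Qed.

Lemma le_hausdorff_pre A B : A `<=` B -> (H A <= H B)%E.
Proof.
move=> AB; apply: hausdorff_pre_leP => delta d0.
exact: le_trans (le_content _ _ AB) (content_le_hausdorff_pre _ d0).
Qed.

Lemma hausdorff_pre_sigma_subadditive : sigma_subadditive H.
Proof.
move=> F; apply: hausdorff_pre_leP => delta d0.
apply: le_trans (content_sigma_subadditive _ _ _) _.
apply: lee_nneseries => k _ ; first by rewrite content_ge0.
exact: content_le_hausdorff_pre.
Qed.

HB.instance Definition _ := isOuterMeasure.Build R 'M[R]_(n, d) H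
  hausdorff_pre0 hausdorff_pre_ge0 le_hausdorff_pre hausdorff_pre_sigma_subadditive.

(** Sets lying on two sides of a slab are far apart, so that a cover by small
    sets splits into covers of each of them. *)
Lemma content_slab (g : 'M[R]_(n, d) -> R) (u v delta : R) A B :
  (forall x y, `|g x - g y| <= euclidean_norm (x - y)) ->
  (forall x, A x -> g x <= u) -> (forall x, B x -> v <= g x) -> delta < v - u ->
  (hausdorff_content m delta A + hausdorff_content m delta B
    <= hausdorff_content m delta (A `|` B))%E.
Proof.
move=> gL gA gB duv; apply: le_ereal_inf_tmp => _ [U [ABU UD] <-].
have dI (C : set 'M[R]_(n, d)) k : (diameter (U k `&` C) <= delta%:E)%E.
  apply: le_trans (UD k); apply: diameter_le => x y [Ux _] [Uy _].
  exact: diameter_ub.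
apply: (@le_trans _ _ (\sum_(k <oo) hausdorff_gauge m (U k `&` A) +
   \sum_(k <oo) hausdorff_gauge m (U k `&` B))%E).
  apply: leeD; apply: ereal_inf_lbound.
    exists (fun k => U k `&` A) => //; split => // x Ax.
    by have [|k _ Ukx] := ABU x; [left|exists k].
  exists (fun k => U k `&` B) => //; split => // x Bx.
  by have [|k _ Ukx] := ABU x; [right|exists k].
rewrite -nneseriesD; [|by move=> *; exact: gauge_ge0..].
apply: lee_nneseries => k _; first by rewrite adde_ge0// gauge_ge0.
have mono C : (hausdorff_gauge m (U k `&` C) <= hausdorff_gauge m (U k))%E.
  have [->|/set0P UC0] := eqVneq (U k `&` C) set0.
    by rewrite gauge0 gauge_ge0.
  have U0 : U k !=set0 by case: UC0 => x [Ux _]; exists x.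
  rewrite [leRHS]gauge_neq0//; have [s s0 E] := diameter_fin U0 (UD k).
  rewrite E -EFin_expe; apply: gauge_le => //; rewrite -E.
  by apply: diameter_le => x y [Ux _] [Uy _]; exact: diameter_ub.
have [->|/set0P[x [Ux Ax]]] := eqVneq (U k `&` A) set0.
  by rewrite gauge0 add0e.
have [->|/set0P[y [Uy By]]] := eqVneq (U k `&` B) set0.
  by rewrite gauge0 adde0.
(* a set of the cover that meets both A and B has diameter at least v - u *)
exfalso; have := le_trans (diameter_ub Ux Uy) (UD k); rewrite lee_fin.
move=> /(le_trans (gL _ _)); rewrite distrC => /(le_trans (ler_norm _)) gyx.
have := gA _ Ax; have := gB _ By; lra.
Qed.

(** Additivity on sets separated by a slab. *)
Lemma hausdorff_pre_slab (g : 'M[R]_(n, d) -> R) (u v : R) A B :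
  (forall x y, `|g x - g y| <= euclidean_norm (x - y)) ->
  (forall x, A x -> g x <= u) -> (forall x, B x -> v <= g x) -> u < v ->
  (H A + H B <= H (A `|` B))%E.
Proof.
move=> gL gA gB uv.
have [->|ABoo] := eqVneq (H (A `|` B)) +oo%E; first by rewrite leey.
have fin C : C `<=` A `|` B -> H C \is a fin_num.
  move=> CAB; rewrite ge0_fin_numE ?hausdorff_pre_ge0//.
  by apply: le_lt_trans (le_hausdorff_pre CAB) _; rewrite ltey.
have fA := fin A (@subsetUl _ A B).
have fB := fin B (@subsetUr _ A B).
have fcB delta : 0 < delta -> hausdorff_content m delta B \is a fin_num.
  move=> d0; rewrite ge0_fin_numE ?content_ge0//.
  by apply: le_lt_trans (content_le_hausdorff_pre _ d0) _; rewrite ltey_eq fB.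
rewrite addeC -leeBrDr//; apply: hausdorff_pre_leP => d2 d20.
rewrite leeBrDr// addeC -leeBrDr ?fcB//; apply: hausdorff_pre_leP => d1 d10.
rewrite leeBrDr ?fcB//.
pose delta := Num.min (Num.min d1 d2) ((v - u) / 2).
have d0 : 0 < delta by rewrite !lt_min d10 d20/= divr_gt0// subr_gt0.
apply: (@le_trans _ _ (hausdorff_content m delta A + hausdorff_content m delta B)%E).
  by apply: leeD; apply: content_anti; rewrite !ge_min lexx ?orbT.
apply: le_trans (content_le_hausdorff_pre _ d0); apply: (content_slab gL gA gB).
rewrite !gt_min; apply/orP; right; rewrite ltr_pdivrMr// ltr_pMr ?subr_gt0//.
by rewrite ltr1n.
Qed.

End HausdorffOuter.

(** * Lipschitz maps and isometries *)

Section Lipschitz.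
Context {R : realType} {n d n' d' : nat} (m : nat).

(** A map multiplying distances by at most t multiplies the m-dimensional
    measure by at most t^m; isometries and homotheties are covered by applying
    this to the map and to its inverse. *)
Lemma hausdorff_pre_lipschitz (f : 'M[R]_(n, d) -> 'M[R]_(n', d')) (t : R)
    (A : set 'M[R]_(n, d)) : 0 < t ->
  (forall x y, euclidean_norm (f x - f y) <= t * euclidean_norm (x - y)) ->
  (hausdorff_pre m (f @` A) <= (t ^+ m)%:E * hausdorff_pre m A)%E.
Proof.
move=> t0 fL; apply: hausdorff_pre_leP => delta d0.
have tm0 : 0 < t ^+ m by rewrite exprn_gt0.
have d't : 0 < delta / t by rewrite divr_gt0.
apply: (@le_trans _ _ ((t ^+ m)%:E * hausdorff_content m (delta / t)%R A)%E);
  last by rewrite lee_pmul2l// content_le_hausdorff_pre.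
rewrite -lee_pdivrMl//; apply: le_ereal_inf_tmp => _ [U [AU UD] <-].
rewrite lee_pdivrMl// -nneseriesZl; last by move=> *; exact: gauge_ge0.
have fD k (r : R) : (diameter (U k) <= r%:E)%E ->
    (diameter (f @` (U k)) <= (t * r)%:E)%E.
  move=> Ur; apply: diameter_le => _ _ [x Ux <-] [y Uy <-]; rewrite lee_fin.
  apply: le_trans (fL _ _) _; rewrite ler_pM2l//.
  by have := le_trans (diameter_ub Ux Uy) Ur; rewrite lee_fin.
apply: (@le_trans _ _ (\sum_(k <oo) hausdorff_gauge m (f @` (U k)))%E).
  apply: ereal_inf_lbound; exists (fun k => f @` (U k)) => //; split.
    by move=> _ [x Ax <-]; have [k _ Ukx] := AU x Ax; exists k => //; exists x.
  by move=> k; have := fD k _ (UD k); rewrite mulrCA divff ?mulr1 ?gt_eqF.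
apply: lee_nneseries => k _; first by move=> _; exact: gauge_ge0.
have [->|/set0P U0] := eqVneq (U k) set0; first by rewrite image_set0 !gauge0 mule0.
have [s s0 E] := diameter_fin U0 (UD k).
rewrite (gauge_neq0 m U0) E -EFin_expe -EFinM -exprMn.
by apply: gauge_le; [rewrite mulr_ge0// ltW|apply: fD; rewrite E].
Qed.

Lemma hausdorff_pre_isometry (f : 'M[R]_(n, d) -> 'M[R]_(n', d'))
    (A : set 'M[R]_(n, d)) :
  (forall x y, euclidean_norm (f x - f y) = euclidean_norm (x - y)) ->
  hausdorff_pre m (f @` A) = hausdorff_pre m A.
Proof.
move=> fI; apply/eqP; rewrite eq_le; apply/andP; split.
  rewrite -[leRHS]mul1e -(expr1n R m); apply: hausdorff_pre_lipschitz => // x y.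
  by rewrite mul1r fI.
apply: hausdorff_pre_leP => delta d0.
apply: le_trans (content_le_hausdorff_pre _ _ d0).
apply: le_ereal_inf_tmp => _ [U [AU UD] <-].
have fD k (r : \bar R) : (diameter (U k) <= r)%E -> (diameter (f @^-1` (U k)) <= r)%E.
  move=> Ur; apply: le_trans Ur; apply: diameter_le => x y Ux Uy; rewrite -fI.
  exact: diameter_ub.
apply: (@le_trans _ _ (\sum_(k <oo) hausdorff_gauge m (f @^-1` (U k)))%E).
  apply: ereal_inf_lbound; exists (fun k => f @^-1` (U k)) => //; split.
    by move=> x Ax; have [|k _ Ukx] := AU (f x); [exists x|exists k].
  by move=> k; exact: fD.
apply: lee_nneseries => k _; first by move=> _; exact: gauge_ge0.
have [->|/set0P fU0] := eqVneq (f @^-1` (U k)) set0; first by rewrite gauge0 gauge_ge0.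
have U0 : U k !=set0 by case: fU0 => x Ux; exists (f x).
have [s s0 E] := diameter_fin U0 (UD k).
rewrite [leRHS]gauge_neq0// E -EFin_expe.
by apply: gauge_le => //; apply: fD; rewrite E.
Qed.

End Lipschitz.

Section Similarities.
Context {R : realType} {n d : nat} (m : nat).
Implicit Types (A : set 'M[R]_(n, d)).

Lemma hausdorff_preZ (t : R) A : 0 < t ->
  hausdorff_pre m [set t *: x | x in A] = ((t ^+ m)%:E * hausdorff_pre m A)%E.
Proof.
move=> t0; have lip s : 0 < s -> forall x y : 'M[R]_(n, d),
    euclidean_norm (s *: x - s *: y) <= s * euclidean_norm (x - y).
  by move=> s0 x y; rewrite -scalerBr euclidean_normZ// ltW.
apply/eqP; rewrite eq_le; apply/andP; split.
  by apply: hausdorff_pre_lipschitz => //; exact: lip.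
rewrite -lee_pdivlMl ?exprn_gt0// -exprVn.
rewrite -[X in (hausdorff_pre m X <= _)%E](_ : [set t^-1 *: x | x in [set t *: x | x in A]] = A).
  by apply: hausdorff_pre_lipschitz; [rewrite invr_gt0|apply: lip; rewrite invr_gt0].
apply/seteqP; split => [_ [_ [x Ax <-] <-]|x Ax].
  by rewrite scalerA mulVf ?gt_eqF// scale1r.
by exists (t *: x); [exists x|rewrite scalerA mulVf ?gt_eqF// scale1r].
Qed.

Lemma hausdorff_pre_translation (v : 'M[R]_(n, d)) A :
  hausdorff_pre m [set x + v | x in A] = hausdorff_pre m A.
Proof.
by apply: hausdorff_pre_isometry => x y; rewrite opprD addrACA subrr addr0.
Qed.

End Similarities.

(** * Half-spaces are Caratheodory measurable *)

Section Caratheodory.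
Context {R : realType} {n d : nat} (m : nat).
Local Notation H := (@hausdorff_pre R n d m).

(** Superadditivity over sets lying in mutually separated slabs. *)
Lemma sum_separated (g : 'M[R]_(n, d) -> R) (D : nat -> set 'M[R]_(n, d))
    (u v : nat -> R) (X : set 'M[R]_(n, d)) (N : nat) :
  (forall x y, `|g x - g y| <= euclidean_norm (x - y)) ->
  (forall j x, D j x -> v j <= g x <= u j) ->
  (forall j k, (j < k)%N -> u j < v k) ->
  (forall j, D j `<=` X) ->
  (\sum_(j < N) H (D j) <= H X)%E.
Proof.
move=> gL Dg uv DX.
apply: (@le_trans _ _ (H (\big[setU/set0]_(j < N) D j))); last first.
  by apply: le_hausdorff_pre; rewrite -bigcup_mkord; apply: bigcup_sub.
elim: N => [|N IH]; first by rewrite !big_ord0 hausdorff_pre0.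
rewrite !big_ord_recr/=; apply: le_trans (leeD IH (lexx _)) _.
case: N IH => [|N] IH; first by rewrite big_ord0 hausdorff_pre0 set0U add0e.
pose u' := \big[Num.max/u 0%N]_(j < N.+1) u j.
apply: (@hausdorff_pre_slab _ _ _ m g u' (v N.+1)) => //.
- move=> x; rewrite -bigcup_mkord => -[j /= jN Djx].
  apply: (@le_trans _ _ (u j)); first by have /andP[] := Dg _ _ Djx.
  exact: (@le_bigmax _ _ _ (u 0%N) (fun j : 'I_N.+1 => u j) (Ordinal jN)).
- by move=> x /Dg /andP[].
- by apply/bigmax_ltP; split=> [|j _]; apply: uv.
Qed.

(** Sublevel sets of 1-Lipschitz functions are measurable; the slices
    c - 1/(k+1) < g <= c - 1/(k+2) of even (resp. odd) index are mutually
    separated, hence their measures are summable. *)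
Lemma caratheodory_sublevel (g : 'M[R]_(n, d) -> R) (c : R) :
  (forall x y, `|g x - g y| <= euclidean_norm (x - y)) ->
  H.-caratheodory [set x | (g x < c)%R].
Proof.
move=> gL; apply: le_caratheodory_measurable => X.
suff : (H (X `&` [set x | (g x < c)%R]) + H (X `&` ~` [set x | (g x < c)%R]) <= H X)%E by [].
have [->|Xoo] := eqVneq (H X) +oo%E; first by rewrite leey.
have HXfin : H X \is a fin_num by rewrite ge0_fin_numE ?hausdorff_pre_ge0// ltey.
pose A k := X `&` [set x | g x <= c - k.+1%:R^-1].
pose D k := X `&` [set x | c - k.+1%:R^-1 < g x <= c - k.+2%:R^-1].
have cl (i j : nat) : (i < j)%N -> c - i.+1%:R^-1 < c - j.+1%:R^-1.
  by move=> ij; rewrite ltrD2l ltrN2 ltf_pV2 ?posrE// ltr_nat.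
have even_odd (e : nat) N : (\sum_(j < N) H (D (j.*2 + e)%N) <= H X)%E.
  apply: (@sum_separated g (fun j => D (j.*2 + e)%N)
    (fun j => c - (j.*2 + e).+2%:R^-1) (fun j => c - (j.*2 + e).+1%:R^-1)) => //.
  - by move=> j x [_ /= /andP[/ltW -> ->]].
  - by move=> j k jk; apply: cl; rewrite -!addSn leq_add2r -doubleS leq_double.
  - by move=> j x [].
have sumD N : (\sum_(j < N) H (D j) <= H X + H X)%E.
  apply: (@le_trans _ _ (\sum_(j < N.*2) H (D j))%E).
    rewrite -[leRHS](big_mkord xpredT (fun j => H (D j))) -addnn.
    rewrite (big_cat_nat _ (n := N)) ?leq_addr//= big_mkord leeDl//.
    by apply: sume_ge0 => *; exact: hausdorff_pre_ge0.
  have -> : (\sum_(j < N.*2) H (D j) =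
      \sum_(j < N) H (D (j.*2 + 0)%N) + \sum_(j < N) H (D (j.*2 + 1)%N))%E.
    elim: N => [|N IH]; first by rewrite !big_ord0 adde0.
    by rewrite doubleS !big_ord_recr/= IH addn0 addn1 -!addeA; congr (_ + _)%E;
      rewrite addeCA.
  by apply: leeD; exact: even_odd.
have Hser : (\sum_(j <oo) H (D j) < +oo)%E.
  apply: (@le_lt_trans _ _ (H X + H X)%E); last by rewrite lte_add_pinfty ?ltey.
  apply: lime_le; first by apply: is_cvg_nneseries => *; exact: hausdorff_pre_ge0.
  by apply: nearW => N; rewrite big_mkord.
have tail0 := nneseries_tail_cvg Hser (fun k _ => hausdorff_pre_ge0 m (D k)).
(* X cut by g < c is the part below c - 1/(N+1), separated from the part
   where c <= g, together with the slices of index at least N, whose measures tend to 0 *)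
have key N : (H (X `&` [set x | (g x < c)%R]) + H (X `&` ~` [set x | (g x < c)%R])
    <= H X + \sum_(N <= j <oo) H (D j))%E.
  have sub : X `&` [set x | (g x < c)%R] `<=` A N `|` \bigcup_(k in ~` `I_N) D k.
    move=> x [Xx /= gxc].
    have [gxN|gxN] := leP (g x) (c - N.+1%:R^-1); first by left.
    have ex : exists k : nat, g x <= c - k.+1%:R^-1.
      have cg : 0 < c - g x by rewrite subr_gt0.
      exists (Num.truncn (c - g x)^-1).
      rewrite lerBrDr -lerBrDl -[leRHS]invrK lef_pV2 ?posrE ?invr_gt0//.
      by apply/ltW; rewrite truncnS_gt.
    have [k gk min] := find_ex_minn ex.
    have Nk : (N < k)%N.
      rewrite ltnNge; apply/negP => kN; have := lt_le_trans gxN gk.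
      by rewrite ltrD2l ltrN2 ltf_pV2 ?posrE// ltr_nat ltnS ltnNge kN.
    case: k gk min Nk => [//|k] gk kmin Nk.
    right; exists k; first by apply/negP; rewrite -leqNgt.
    split => //=; rewrite gk andbT ltNge.
    by apply/negP => /kmin; rewrite ltnn.
  have HB : (H (A N) + H (X `&` ~` [set x | (g x < c)%R]) <= H X)%E.
    apply: le_trans (le_hausdorff_pre m _); first apply: (@hausdorff_pre_slab _ _ _ m g
      (c - N.+1%:R^-1) c) => //.
    - by move=> x [].
    - by move=> x [_ /= /negP]; rewrite -leNgt.
    - by rewrite gtrBl invr_gt0 ltr0n.
    - by move=> x [[]|[]].
  apply: (@le_trans _ _ (H (A N) + \sum_(N <= j <oo) H (D j)
     + H (X `&` ~` [set x | (g x < c)%R]))%E); last first.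
    by rewrite -addeA (addeC (limn _)) addeA leeD.
  apply: leeD => //; apply: le_trans (le_hausdorff_pre m sub) _.
  apply: le_trans (outer_measureU2 _ _ _) _; apply: leeD => //.
  exact: outer_measure_sigma_subadditive_tail.
have lim : (H X + \sum_(N <= j <oo) H (D j))%E @[N --> \oo] --> (H X + 0)%E.
  by apply: cvgeD; [rewrite fin_num_adde_defr|exact: cvg_cst|exact: tail0].
rewrite adde0 in lim; rewrite -(cvg_lim _ lim)//.
by apply: lime_ge; [apply/cvg_ex; eexists; exact: lim|exact: nearW].
Qed.

End Caratheodory.

(** * The Hausdorff measure of full dimension on row vectors *)

Section Finiteness.
Context {R : realType} {m : nat}.

Lemma euclidean_norm_le_box (x : 'rV[R]_m) (s : R) : 0 <= s ->
  (forall i, `|x 0 i| <= s) -> euclidean_norm x <= m%:R * s.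
Proof.
move=> s0 xs; have ms0 : 0 <= m%:R * s by rewrite mulr_ge0.
rewrite -[leRHS](ger0_norm ms0) -sqrtr_sqr ler_sqrt ?sqr_ge0//.
rewrite big_ord1 exprMn; apply: (@le_trans _ _ (\sum_(j < m) s ^+ 2)).
  apply: ler_sum => j _; rewrite -real_normK ?num_real//.
  by rewrite lerXn2r// ?nnegrE.
rewrite sumr_const card_ord -[leLHS]mulr_natl ler_wpM2r ?sqr_ge0//.
by rewrite -natrX ler_nat; case: (m) => // k; rewrite leq_pmull.
Qed.

Lemma grid_cell (s y : R) (k : nat) : 0 <= s -> (0 < k)%N -> 0 <= y <= k%:R * s ->
  exists j : 'I_k, j%:R * s <= y <= j.+1%:R * s.
Proof.
move=> s0; elim: k => [//|k IH _ /andP[y0 yk]].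
have [yk'|yk'] := leP y (k%:R * s); last first.
  by exists ord_max => /=; rewrite yk ltW.
case: k IH yk yk' => [_|k IH] yk yk'.
  by exists ord0 => /=; rewrite mul0r y0.
have [|j Hj] := IH isT; first by rewrite y0 yk'.
by exists (widen_ord (leqnSn _) j).
Qed.

(** Cut the cube into k^m cubes of side 2r/k, with k large. *)
Lemma hausdorff_pre_box_lty (r : R) : 0 <= r ->
  (hausdorff_pre m [set x : 'rV[R]_m | forall i, `|x 0 i| <= r]%R < +oo)%E.
Proof.
move=> r0; apply: (@le_lt_trans _ _ ((m%:R * (2 * r)) ^+ m)%:E); last exact: ltry.
apply: hausdorff_pre_leP => delta d0.
have [k0 k0d] : exists k : nat, m%:R * (2 * r) <= delta * k.+1%:R.
  exists (Num.truncn (m%:R * (2 * r) / delta)).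
  by rewrite [leRHS]mulrC -ler_pdivrMr//; exact/ltW/truncnS_gt.
pose k := k0.+1; pose s := 2 * r / k%:R.
have s0 : 0 <= s by rewrite divr_ge0// mulr_ge0//.
have ks : k%:R * s = 2 * r by rewrite /s mulrC divfK// pnatr_eq0.
pose Q (f : {ffun 'I_m -> 'I_k}) : set 'rV[R]_m :=
  [set x | forall i, (f i)%:R * s <= x 0 i + r <= (f i).+1%:R * s].
have diamQ f : (diameter (Q f) <= (m%:R * s)%:E)%E.
  apply: diameter_le => x y Qx Qy; rewrite lee_fin.
  apply: euclidean_norm_le_box => // i; rewrite !mxE.
  have /andP[x1 x2] := Qx i; have /andP[y1 y2] := Qy i.
  move: x2 y2; rewrite -natr1 mulrDl mul1r => x2 y2.
  by rewrite ler_norml; apply/andP; split; lra.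
pose F (j : nat) := if insub j is Some j' then Q (enum_val (A := {ffun 'I_m -> 'I_k}) j') else set0.
pose N := #|{ffun 'I_m -> 'I_k}|.
apply: (@le_trans _ _ (hausdorff_content m delta (\big[setU/set0]_(j < N) F j))).
  apply: le_content => x xr; rewrite -bigcup_mkord.
  have cell i : exists j : 'I_k, j%:R * s <= x 0 i + r <= j.+1%:R * s.
    apply: grid_cell => //; rewrite ks.
    by have := xr i; rewrite ler_norml => /andP[]; lra.
  have [f fP] := choice cell.
  exists (enum_rank [ffun i => f i]) => /=; first exact: ltn_ord.
  by rewrite /F valK enum_rankK => i; rewrite ffunE.
apply: le_trans (outer_measure_subadditive _ _ _) _.
apply: (@le_trans _ _ (\sum_(j < N) ((m%:R * s) ^+ m)%:E)%E).
  apply: lee_sum => j _; rewrite /F valK.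
  apply: le_trans (content_single _ _) (gauge_le _ _ _) => //.
  - apply: le_trans (diamQ _) _; rewrite lee_fin /s mulrA ler_pdivrMr//.
  - by rewrite mulr_ge0.
rewrite sumEFin lee_fin sumr_const card_ord /N card_ffun !card_ord.
by rewrite -[leLHS]mulr_natl natrX -exprMn mulrCA ks.
Qed.

End Finiteness.

Section BorelRows.
Context {R : realType} {m : nat}.

(** The half-spaces bounded by coordinate hyperplanes, which generate the
    sigma-algebra put on row vectors. *)
Definition coordinate_halfspaces : set (set 'rV[R]_m) :=
  [set A | exists (i : 'I_m) (c : R), A = [set x : 'rV[R]_m | x 0 i < c]].

Definition rV_display : measure_display. Proof. exact: default_measure_display. Qed.

End BorelRows.

HB.instance Definition _ (R : realType) (m : nat) :=
  @isMeasurable.Build rV_display 'rV[R]_m <<s @coordinate_halfspaces R m >>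
  (@sigma_algebra0 _ setT _) (@sigma_algebraC _ _) (@sigma_algebra_bigcup _ setT _).

Section RowMeasurability.
Context {R : realType} {m : nat}.

Lemma measurable_coordinate (i : 'I_m) :
  measurable_fun [set: 'rV[R]_m] (fun x : 'rV[R]_m => x 0 i).
Proof.
apply: (measurability (@measurable_realfun.RGenCInfty.G R)) => //.
  exact: measurable_realfun.RGenCInfty.measurableE.
move=> _ [_ [c ->] <-]; rewrite setTI.
rewrite [X in measurable X](_ : _ = ~` [set x : 'rV[R]_m | x 0 i < c]); last first.
  by apply/seteqP; split => x /=; rewrite in_itv/= andbT leNgt => /negP.
by apply: measurableC; apply: sub_sigma_algebra; exists i, c.
Qed.

Lemma measurable_row d (T : measurableType d) (f : T -> 'rV[R]_m) :
  (forall i, measurable_fun setT (fun x => f x 0 i)) -> measurable_fun setT f.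
Proof.
move=> mf; apply: (measurability (@coordinate_halfspaces R m)) => //.
move=> _ [_ [i [c ->]] <-]; rewrite setTI.
have := mf i measurableT `]-oo, c[%classic (measurable_itv _).
by rewrite setTI; congr measurable; apply/seteqP; split => x /=; rewrite in_itv.
Qed.

End RowMeasurability.

(** The Hausdorff measure of full dimension, as a measure on row vectors. *)
Definition hmu {R : realType} (m : nat) (A : set 'rV[R]_m) : \bar R :=
  hausdorff_pre m A.

Section RowMeasure.
Context {R : realType} {m : nat}.
Local Notation mu := (@hmu R m).

Lemma measurable_caratheodory (A : set 'rV[R]_m) : measurable A ->
  (@hausdorff_pre R 1 m m).-caratheodory A.
Proof.
move=> mA; have : (@hausdorff_pre R 1 m m).-cara.-measurable A; last by [].
move: A mA; apply: smallest_sub; first exact: sigma_algebra_measurable.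
move=> _ [i [c ->]]; apply: caratheodory_sublevel => x y.
by have := entry_le_euclidean_norm (x - y) 0 i; rewrite !mxE.
Qed.

Lemma hmu0 : mu set0 = 0%E. Proof. exact: hausdorff_pre0. Qed.
Lemma hmu_ge0 A : (0 <= mu A)%E. Proof. exact: hausdorff_pre_ge0. Qed.
Lemma hmu_sigma_additive : semi_sigma_additive mu.
Proof.
move=> F mF tF mUF.
apply: (@caratheodory_measure_sigma_additive _ _ (@hausdorff_pre R 1 m m) F) => //.
  by move=> i; exact: measurable_caratheodory.
exact: measurable_caratheodory.
Qed.

HB.instance Definition _ := isMeasure.Build _ _ _ mu hmu0 hmu_ge0 hmu_sigma_additive.

Lemma hmu_bounded (A : set 'rV[R]_m) (r : R) :
  (forall x, A x -> forall i, `|x 0 i| <= r) -> (mu A < +oo)%E.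
Proof.
move=> Ar; apply: (@le_lt_trans _ _
  (hausdorff_pre m [set x : 'rV[R]_m | forall i, `|x 0 i| <= `|r|]%R)).
  apply: le_hausdorff_pre => x Ax /= i; apply: le_trans (Ar _ Ax i) _.
  exact: ler_norm.
exact: hausdorff_pre_box_lty.
Qed.

Lemma measurable_box (r : R) :
  measurable [set x : 'rV[R]_m | forall i, `|x 0 i| <= r]%R.
Proof.
rewrite (_ : [set _ | _] = \bigcap_(i in [set: 'I_m]) [set x : 'rV[R]_m | `|x 0 i| <= r]%R).
  apply: fin_bigcap_measurable => // i _.
  have /(_ measurableT `]-oo, r]%classic (measurable_itv _)) :
      measurable_fun setT (fun x : 'rV[R]_m => `|x 0 i|).
    by apply: measurableT_comp (measurable_coordinate i); exact: measurable_realfun.normr_measurable.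
  by rewrite setTI; congr measurable; apply/seteqP; split => x /=; rewrite in_itv.
by apply/seteqP; split=> x /= xr i => [_|]; exact: xr.
Qed.

Lemma hmu_sigma_finite : sigma_finite setT mu.
Proof.
exists (fun k => [set x : 'rV[R]_m | forall i, `|x 0 i| <= k%:R]%R).
  apply/seteqP; split => // x _; exists (Num.truncn (\sum_i `|x 0 i|)).+1 => //= i.
  apply: (@le_trans _ _ (\sum_i `|x 0 i|)); last exact/ltW/truncnS_gt.
  by rewrite (bigD1 i)//= lerDl sumr_ge0.
by move=> k; split; [exact: measurable_box|exact: hausdorff_pre_box_lty].
Qed.

HB.instance Definition _ := Measure_isSigmaFinite.Build _ _ _ mu hmu_sigma_finite.

End RowMeasure.

(** * Linear changes of variables *)

Section ChangeOfVariables.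
Context {R : realType} {m : nat}.
Local Notation mu := (@hmu R m).
Local Notation V := 'rV[R]_m.

Lemma measurable_mulmxr k (T : 'M[R]_(k, m)) :
  measurable_fun setT (fun x : 'rV[R]_k => x *m T).
Proof.
apply: measurable_row => i.
rewrite (_ : (fun x : 'rV[R]_k => _) = fun x => \sum_j x 0 j * T j i); last first.
  by apply/funext => x; rewrite mxE.
apply: measurable_sum => j; apply: measurable_funM => //.
exact: measurable_coordinate.
Qed.

Lemma measurable_row_add d (X : measurableType d) (f g : X -> V) :
  measurable_fun setT f -> measurable_fun setT g ->
  measurable_fun setT (fun x => f x + g x).
Proof.
move=> mf mg; apply: measurable_row => i.
rewrite (_ : (fun x => _) = fun x => f x 0 i + g x 0 i); last first.
  by apply/funext => x; rewrite mxE.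
by apply: measurable_funD; apply: (measurableT_comp (measurable_coordinate i)).
Qed.

Lemma integral_hmu_comp (phi : V -> V) (c : R) (g : V -> \bar R) : 0 <= c ->
  measurable_fun setT phi ->
  (forall A, mu (phi @^-1` A) = c%:E * mu A)%E ->
  (forall x, 0 <= g x)%E -> measurable_fun setT g ->
  (\int[mu]_x g (phi x) = c%:E * \int[mu]_x g x)%E.
Proof.
move=> c0 mphi muphi g0 mg.
have := ge0_integral_pushforward mphi mu measurableT mg (fun x _ => g0 x).
rewrite preimage_setT => <-.
rewrite (_ : pushforward mu phi = mscale (NngNum c0) mu); last first.
  by apply/funext => A; rewrite /pushforward muphi.
exact: ge0_integral_mscale.
Qed.

Lemma integral_hmu_translation (v : V) (g : V -> \bar R) :
  (forall x, 0 <= g x)%E -> measurable_fun setT g ->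
  (\int[mu]_x g (x + v)%R = \int[mu]_x g x)%E.
Proof.
move=> g0 mg; rewrite -[RHS]mul1e; apply: (integral_hmu_comp (phi := fun x => x + v)) => //.
  by apply: measurable_row_add.
move=> A; rewrite mul1e -[RHS](hausdorff_pre_translation m (- v)).
congr (mu _); apply/seteqP; split => [x Ax|_ [y Ay <-]] /=; last by rewrite subrK.
by exists (x + v); rewrite ?addrK.
Qed.

Lemma integral_hmu_scale (t : R) (g : V -> \bar R) : 0 < t ->
  (forall x, 0 <= g x)%E -> measurable_fun setT g ->
  (\int[mu]_x g (t *: x)%R = (t ^- m)%:E * \int[mu]_x g x)%E.
Proof.
move=> t0 g0 mg; apply: (integral_hmu_comp (phi := fun x => t *: x)) => //.
- by rewrite invr_ge0 exprn_ge0// ltW.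
- have := @measurable_mulmxr m t%:M.
  by congr measurable_fun; apply/funext => x; rewrite mul_mx_scalar.
move=> A; rewrite -exprVn -[RHS](hausdorff_preZ m)// ?invr_gt0//.
congr (mu _); apply/seteqP; split => [x Ax|_ [y Ay <-]] /=.
  by exists (t *: x) => //; rewrite scalerA mulVf ?gt_eqF// scale1r.
by rewrite scalerA mulfV ?gt_eqF// scale1r.
Qed.

(** The square of the Euclidean norm of a row vector. *)
Definition sqnorm (x : V) : R := \sum_j x 0 j ^+ 2.

Lemma sqr_euclidean_row (x : V) : euclidean_norm x ^+ 2 = sqnorm x.
Proof. by rewrite sqr_euclidean_norm big_ord1. Qed.

Lemma integral_hmu_orthogonal (U : 'M[R]_m) (g : V -> \bar R) : U *m U^T = 1%:M ->
  (forall x, 0 <= g x)%E -> measurable_fun setT g ->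
  (\int[mu]_x g (x *m U)%R = \int[mu]_x g x)%E.
Proof.
move=> UU g0 mg; rewrite -[RHS]mul1e; apply: (integral_hmu_comp (phi := fun x => x *m U)) => //.
  exact: measurable_mulmxr.
have UU' : U^T *m U = 1%:M by apply: mulmx1C.
have normU (x : V) : euclidean_norm (x *m U^T) = euclidean_norm x.
  have sq (y : V) : sqnorm y = (y *m y^T) 0 0.
    by rewrite mxE; apply: eq_bigr => j _; rewrite mxE expr2.
  apply: (@pexpIrn _ 2) => //; rewrite ?nnegrE ?euclidean_norm_ge0//.
  by rewrite !sqr_euclidean_row !sq trmx_mul trmxK mulmxA -(mulmxA x) UU' mulmx1.
move=> A; rewrite mul1e -[RHS](hausdorff_pre_isometry m (f := fun x => x *m U^T)); last first.
  by move=> x y; rewrite -mulmxBl normU.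
congr (mu _); apply/seteqP; split => [x Ax|_ [y Ay <-]] /=.
  by exists (x *m U) => //; rewrite -mulmxA UU mulmx1.
by rewrite -mulmxA UU' mulmx1.
Qed.

End ChangeOfVariables.

(** A nonnegative factor of a finite positive product is finite and positive. *)
Lemma mule_factor_lty {R : realType} (a b : \bar R) :
  (0 <= a -> 0 <= b -> 0 < a * b < +oo -> 0 < a < +oo)%E.
Proof.
case: a => [r||]//; case: b => [s||]//.
- rewrite !lee_fin => r0 s0; rewrite -EFinM !lte_fin => /andP[rs _]; rewrite ltry andbT.
  by rewrite lt_neqAle r0 andbT; apply: contraTneq rs => <-; rewrite mul0r ltxx.
- rewrite lee_fin le_eqVlt => /orP[/eqP<- _|r0 _]; first by rewrite mul0e ltxx.
  by rewrite ltry lte_fin r0.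
- move=> _; rewrite lee_fin le_eqVlt => /orP[/eqP<-|s0]; first by rewrite mule0 ltxx.
  by rewrite gt0_mulye ?lte_fin// ltxx andbF.
Qed.

Section Jacobian.
Context {R : realType} {m : nat}.
Local Notation mu := (@hmu R m).
Local Notation V := 'rV[R]_m.

Lemma measurable_sqnorm : measurable_fun setT (@sqnorm R m).
Proof.
apply: measurable_sum => j; rewrite /=.
under eq_fun do rewrite expr2.
by apply: measurable_funM; exact: measurable_coordinate.
Qed.

(** The standard Gaussian, not normalized. *)
Definition gauss (x : V) : \bar R := (expR (- sqnorm x))%:E.

Lemma gauss_ge0 x : (0 <= gauss x)%E. Proof. by rewrite lee_fin expR_ge0. Qed.

Lemma measurable_gauss : measurable_fun setT gauss.
Proof.
apply/measurable_EFinP; apply: measurableT_comp; first exact: measurable_expR.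
by apply: measurableT_comp measurable_sqnorm; exact: oppr_measurable.
Qed.

(** The argument for the uniqueness of Haar measure: both sides are the double
    integral of gauss (y T - x) g x, by Fubini and translations. *)
Lemma haar (T : 'M[R]_m) (g : V -> \bar R) : T \in unitmx ->
  (forall x, 0 <= g x)%E -> measurable_fun setT g ->
  ((\int[mu]_x g (x *m T)%R) * (\int[mu]_x gauss x) =
   (\int[mu]_x gauss (x *m T)%R) * (\int[mu]_x g x))%E.
Proof.
move=> uT g0 mg.
have mgT : measurable_fun setT (fun x : V => g (x *m T)).
  by apply: measurableT_comp mg _; exact: measurable_mulmxr.
have mGT : measurable_fun setT (fun x : V => gauss (x *m T)).
  by apply: measurableT_comp measurable_gauss _; exact: measurable_mulmxr.
have mm (h : V -> \bar R) (phi : V * V -> V) : measurable_fun setT h ->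
    measurable_fun setT phi -> measurable_fun setT (fun p => h (phi p)).
  by move=> mh mphi; apply: measurableT_comp mphi.
have mfstT : measurable_fun setT (fun p : V * V => p.1 *m T).
  exact: (measurableT_comp (measurable_mulmxr _) measurable_fst).
have msndT : measurable_fun setT (fun p : V * V => p.2 *m T).
  exact: (measurableT_comp (measurable_mulmxr _) measurable_snd).
transitivity (\int[mu]_x \int[mu]_y (gauss x * g (y *m T + x)%R))%E.
  rewrite -ge0_integralZl//; last 3 first.
  - exact: measurable_gauss.
  - by move=> x _; exact: gauss_ge0.
  - by apply: integral_ge0 => x _.
  apply: eq_integral => x _; rewrite muleC -ge0_integralZl//; last exact: gauss_ge0.
  rewrite -(@integral_hmu_translation _ _ (x *m invmx T) (fun y => gauss x * g (y *m T))%E).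
  - by apply: eq_integral => y _; rewrite mulmxDl mulmxKV.
  - by move=> y; rewrite mule_ge0 ?gauss_ge0.
  - exact: measurable_funeM.
have mF : measurable_fun setT (fun p : V * V => (gauss p.1 * g (p.2 *m T + p.1)%R)%E).
  apply: emeasurable_funM.
    by apply: mm measurable_gauss _; exact: measurable_fst.
  by apply: mm => //; apply: measurable_row_add.
rewrite (fubini_tonelli _ mF) => [|p]; last by rewrite mule_ge0 ?gauss_ge0.
transitivity (\int[mu]_y \int[mu]_x (gauss (y *m T - x)%R * g x))%E.
  apply: eq_integral => y _.
  rewrite -(@integral_hmu_translation _ _ (y *m T) (fun x => gauss (y *m T - x)%R * g x)%E).
  - apply: eq_integral => x _ /=; rewrite addrC; congr (_ * g _)%E.
    rewrite opprD addrCA subrr addr0 /gauss /sqnorm.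
    by congr (expR (- _))%:E; apply: eq_bigr => j _; rewrite mxE sqrrN.
  - by move=> x; rewrite mule_ge0 ?gauss_ge0.
  - apply: emeasurable_funM => //; apply: measurableT_comp measurable_gauss _.
    apply: measurable_row_add => //; have := @measurable_mulmxr R m m (- 1%:M).
    by congr measurable_fun; apply/funext => x; rewrite mulmxN mulmx1.
have mnegsnd : measurable_fun setT (fun p : V * V => - p.2).
  have : measurable_fun setT (fun p : V * V => p.2 *m (- 1%:M)).
    exact: (measurableT_comp (measurable_mulmxr _) measurable_snd).
  by congr measurable_fun; apply/funext => x; rewrite mulmxN mulmx1.
have mG : measurable_fun setT (fun p : V * V => (gauss (p.1 *m T - p.2)%R * g p.2)%E).
  apply: emeasurable_funM; last by apply: mm => //; exact: measurable_snd.
  by apply: mm measurable_gauss _; exact: measurable_row_add.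
rewrite (fubini_tonelli _ mG) => [|p]; last by rewrite mule_ge0 ?gauss_ge0.
rewrite -ge0_integralZl//; last by apply: integral_ge0 => x _; exact: gauss_ge0.
apply: eq_integral => x _ /=.
have E1 := @ge0_integralZl _ _ _ mu setT measurableT _ mGT (g x)
  (fun y _ => gauss_ge0 (y *m T)) (g0 x).
rewrite [RHS]muleC -E1.
have E2 := @integral_hmu_translation _ _ (- (x *m invmx T)) (fun y => g x * gauss (y *m T))%E.
rewrite -E2.
- by apply: eq_integral => y _; rewrite muleC mulmxBl mulmxKV.
- by move=> y; rewrite mule_ge0 ?gauss_ge0.
- exact: measurable_funeM.
Qed.

Variable E : R.
Hypothesis E_gt0 : 0 < E.
Hypothesis gaussE : (\int[mu]_x gauss x = E%:E)%E.

(** The factor by which the substitution of x T for x changes integrals; it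
    is in fact 1/|det T|. *)
Definition jac (T : 'M[R]_m) : R := fine (\int[mu]_x gauss (x *m T)) / E.

Let measurable_gaussT (T : 'M[R]_m) : measurable_fun setT (fun x : V => gauss (x *m T)).
Proof. by apply: measurableT_comp measurable_gauss _; exact: measurable_mulmxr. Qed.

Lemma gauss_jac T : T \in unitmx ->
  0 < jac T /\ (\int[mu]_x gauss (x *m T)%R = (jac T * E)%:E)%E.
Proof.
move=> uT; have := haar (g := fun x => gauss (x *m invmx T)) uT (fun=> gauss_ge0 _) (measurable_gaussT _).
under eq_integral do rewrite mulmxK//.
have I0 S : (0 <= \int[mu]_x gauss (x *m S)%R)%E by apply: integral_ge0 => x _; exact: gauss_ge0.
rewrite gaussE => eq; rewrite /jac; move: eq (I0 T) (I0 (invmx T)).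
move: (\int[mu]_x gauss (x *m T)%R)%E (\int[mu]_x gauss (x *m invmx T)%R)%E => I J eq I_ge0 J_ge0.
have /andP[I1 I2] : (0 < I < +oo)%E.
  apply: (mule_factor_lty I_ge0 J_ge0).
  by rewrite -eq -EFinM lte_fin ltry mulr_gt0.
split; first by rewrite divr_gt0// fine_gt0// I1.
by rewrite divfK ?gt_eqF// fineK// ge0_fin_numE.
Qed.

Lemma jac_gt0 T : T \in unitmx -> 0 < jac T.
Proof. by move=> /gauss_jac[]. Qed.

Lemma integral_jac T (g : V -> \bar R) : T \in unitmx ->
  (forall x, 0 <= g x)%E -> measurable_fun setT g ->
  (\int[mu]_x g (x *m T)%R = (jac T)%:E * \int[mu]_x g x)%E.
Proof.
move=> uT g0 mg; have := haar uT g0 mg.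
have [_ ->] := gauss_jac uT; rewrite gaussE.
move: (\int[mu]_x g (x *m T)%R)%E (\int[mu]_x g x)%E => I J.
move=> /(congr1 (fun z => z * E^-1%:E)%E).
rewrite -muleA -EFinM divff ?gt_eqF// mule1 => ->.
by rewrite muleAC -EFinM mulfK// gt_eqF.
Qed.

Lemma jacM S T : S \in unitmx -> T \in unitmx -> jac (S *m T) = jac S * jac T.
Proof.
move=> uS uT.
have := integral_jac (g := fun x => gauss (x *m T)) uS (fun=> gauss_ge0 _) (measurable_gaussT _).
under eq_integral do rewrite -mulmxA.
have [_ ->] := gauss_jac uT.
have [|_ ->] := @gauss_jac (S *m T); first by rewrite unitmx_mul uS.
move: (jac (S *m T)) (jac S) (jac T) => a b c.
by rewrite -EFinM mulrA => -[] /(mulIf (lt0r_neq0 E_gt0)).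
Qed.

Lemma jac_orthogonal (U : 'M[R]_m) : U *m U^T = 1%:M -> jac U = 1.
Proof.
move=> UU; rewrite /jac (integral_hmu_orthogonal UU gauss_ge0 measurable_gauss).
by rewrite gaussE/= divff// gt_eqF.
Qed.

Lemma jac_scalar (t : R) : 0 < t -> jac t%:M = t ^- m.
Proof.
move=> t0; rewrite /jac.
under eq_integral do rewrite mul_mx_scalar.
rewrite (integral_hmu_scale t0 gauss_ge0 measurable_gauss) gaussE -EFinM/=.
by rewrite mulfK// gt_eqF.
Qed.

End Jacobian.

Lemma transvection_unit {R : realType} n (k : 'I_n) (v : 'cV[R]_n) : v k 0 = 0 ->
  1%:M + v *m delta_mx 0 k \in unitmx.
Proof.
move=> vk; set N := v *m _.
have NN : N *m N = 0.
  rewrite /N mulmxA -(mulmxA v) [delta_mx 0 k *m v](_ : _ = 0) ?mulmx0 ?mul0mx//.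
  by apply/matrixP => i j; rewrite (ord1 i) (ord1 j) -rowE !mxE vk.
have : (1%:M + N) *m (1%:M - N) = 1%:M.
  by rewrite mulmxDl mul1mx mulmxBr mulmx1 NN subr0 subrK.
by case/mulmx1_unit.
Qed.

(** A positive multiplicative function on invertible matrices, trivial on
    orthogonal matrices and of the right value on homotheties, agrees with
    1/|det| on transvections and on positive diagonal matrices. *)
Section MultiplicativeFunction.
Context {R : realType} {m : nat}.
Variable c : 'M[R]_m -> R.
Hypothesis c_gt0 : forall T, T \in unitmx -> 0 < c T.
Hypothesis cM : forall S T, S \in unitmx -> T \in unitmx -> c (S *m T) = c S * c T.
Hypothesis c_orthogonal : forall U, U *m U^T = 1%:M -> c U = 1.
Hypothesis c_scalar : forall t, 0 < t -> c t%:M = t ^- m.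

(** Conjugating by a diagonal matrix turns the transvection 1 + N into its
    square 1 + 2N, so that the value c of the function satisfies c^2 = c. *)
Lemma multf_transvection (k : 'I_m) (v : 'cV[R]_m) : v k 0 = 0 ->
  c (1%:M + v *m delta_mx 0 k) = 1.
Proof.
move=> vk; pose N := v *m delta_mx 0 k : 'M[R]_m.
have NN : N *m N = 0.
  rewrite /N mulmxA -(mulmxA v) [delta_mx 0 k *m v](_ : _ = 0) ?mulmx0 ?mul0mx//.
  by apply/matrixP => i j; rewrite (ord1 i) (ord1 j) -rowE !mxE vk.
pose D := diag_mx (\row_i (if i == k then 2 else 1)) : 'M[R]_m.
pose D' := diag_mx (\row_i (if i == k then 2^-1 else 1)) : 'M[R]_m.
have DD' : D' *m D = 1%:M.
  rewrite mulmx_diag -diag_const_mx; congr diag_mx; apply/rowP => i.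
  by rewrite !mxE; case: ifP => _; rewrite ?mulr1// mulVf.
have [uD' uD] := mulmx1_unit DD'.
have conj : D' *m (1%:M + N) *m D = (1%:M + N) *m (1%:M + N).
  rewrite mulmxDr mulmx1 mulmxDl DD' mulmxDl mul1mx mulmxDr mulmx1 NN addr0.
  rewrite -addrA; congr (_ + _); rewrite /N mulmxA -mulmxA.
  have -> : D' *m v = v.
    by apply/colP => i; rewrite mul_diag_mx !mxE; case: eqP => [->|_]; rewrite ?vk ?mulr0 ?mul1r.
  have -> : delta_mx 0 k *m D = 2 *: delta_mx (0 : 'I_1) k.
    apply/rowP => i; rewrite mul_mx_diag !mxE !eqxx/=.
    by case: eqP => _; rewrite ?mulr0 ?mul0r ?mul1r ?mulr1.
  by rewrite -scalemxAr scaler_nat mulr2n.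
have u1N : 1%:M + N \in unitmx by exact: transvection_unit.
have := congr1 c conj; rewrite !cM ?unitmx_mul ?uD' ?uD ?u1N//.
have -> : c D' * c (1%:M + N) * c D = c (1%:M + N).
  rewrite mulrAC -cM// DD' c_orthogonal ?mul1r//.
  by rewrite trmx1 mulmx1.
rewrite -[LHS]mulr1 => /(mulfI (lt0r_neq0 (c_gt0 u1N))) <-//.
Qed.

(** Diagonal matrices with a single nontrivial entry are conjugate under
    permutations, and their product is scalar. *)
Lemma multf_diag1 (k : 'I_m) (s : R) : 0 < s ->
  c (diag_mx (\row_i (if i == k then s else 1))) = s^-1.
Proof.
move=> s0; pose D l := diag_mx (\row_i (if i == l then s else 1)) : 'M[R]_m.
have uD l : D l \in unitmx.
  rewrite unitmxE det_diag unitfE; apply/prodf_neq0 => i _; rewrite mxE.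
  by case: ifP => _; rewrite ?oner_neq0 ?gt_eqF.
have Dl l : c (D l) = c (D k).
  pose P := tperm_mx l k : 'M[R]_m.
  have PP : P *m P = 1%:M by rewrite -perm_mxM tperm2 perm_mx1.
  have PT : P^T = P by rewrite tr_perm_mx tpermV.
  have jP : c P = 1 by apply: c_orthogonal; rewrite PT.
  have [uP _] := mulmx1_unit PP.
  have -> : D l = P *m D k *m P.
    have -> : P *m D k *m P = col_perm (tperm l k) (row_perm (tperm l k) (D k)).
      by rewrite col_permE row_permE tpermV.
    apply/matrixP => i j; rewrite !mxE (inj_eq perm_inj).
    have tk u : (tperm l k u == k) = (u == l).
      by rewrite -{2}(tpermL l k) (inj_eq perm_inj).
    by rewrite tk.
  by rewrite !cM ?unitmx_mul ?uP ?uD// jP mul1r mulr1.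
have prod (s' : seq 'I_m) : uniq s' ->
    c (diag_mx (\row_i (if i \in s' then s else 1))) = c (D k) ^+ size s'.
  elim: s' => [_|l s' IH /= /andP[ls' us']].
    rewrite (_ : diag_mx _ = 1%:M); first by rewrite c_orthogonal// trmx1 mulmx1.
    by rewrite -diag_const_mx; congr diag_mx; apply/rowP => i; rewrite !mxE.
  rewrite exprS -IH// -(Dl l) -cM//.
  - congr c; rewrite mulmx_diag; congr diag_mx; apply/rowP => i; rewrite !mxE in_cons.
    by case: eqP => [->|_]/=; rewrite ?(negbTE ls') ?mulr1 ?mul1r.
  - rewrite unitmxE det_diag unitfE; apply/prodf_neq0 => i _; rewrite mxE.
    by case: ifP => _; rewrite ?oner_neq0 ?gt_eqF.
have := prod (enum 'I_m) (enum_uniq _).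
rewrite size_enum_ord (_ : diag_mx _ = s%:M); last first.
  by rewrite -diag_const_mx; congr diag_mx; apply/rowP => i; rewrite !mxE mem_enum.
rewrite c_scalar// -exprVn => /esym/eqP; rewrite eqrXn2 ?invr_ge0 ?(ltW s0)//.
- by move/eqP.
- exact: leq_ltn_trans (leq0n k) (ltn_ord k).
- by rewrite ltW// c_gt0.
Qed.

Lemma multf_diag (w : 'rV[R]_m) : (forall i, 0 < w 0 i) -> c (diag_mx w) = (\prod_i w 0 i)^-1.
Proof.
move=> w0.
have unitw (w' : 'rV[R]_m) : (forall i, 0 < w' 0 i) -> diag_mx w' \in unitmx.
  move=> w'0; rewrite unitmxE det_diag unitfE; apply/prodf_neq0 => i _.
  by rewrite gt_eqF.
have prod (s' : seq 'I_m) : uniq s' ->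
    c (diag_mx (\row_i (if i \in s' then w 0 i else 1))) = \prod_(i <- s') (w 0 i)^-1.
  elim: s' => [_|l s' IH /= /andP[ls' us']].
    rewrite big_nil (_ : diag_mx _ = 1%:M); first by rewrite c_orthogonal// trmx1 mulmx1.
    by rewrite -diag_const_mx; congr diag_mx; apply/rowP => i; rewrite !mxE.
  rewrite big_cons -IH// -(multf_diag1 l)// -cM; last 2 first.
  - by apply: unitw => i; rewrite mxE; case: ifP.
  - by apply: unitw => i; rewrite mxE; case: ifP.
  congr c; rewrite mulmx_diag; congr diag_mx; apply/rowP => i; rewrite !mxE in_cons.
  by case: eqP => [->|_]/=; rewrite ?(negbTE ls') ?mulr1 ?mul1r.
have := prod (enum 'I_m) (enum_uniq _); rewrite big_enum/= prodfV => <-.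
congr c; congr diag_mx; apply/rowP => i; rewrite !mxE mem_enum//.
Qed.

End MultiplicativeFunction.

(** * Positive definite matrices *)

Section PositiveDefinite.
Context {R : realType}.

(** Symmetric positive definite matrices. *)
Definition pd n (M : 'M[R]_n) : Prop :=
  M^T = M /\ forall x : 'rV[R]_n, x != 0 -> 0 < (x *m M *m x^T) 0 0.

Lemma pd_congr n (M T : 'M[R]_n) : T \in unitmx -> pd M -> pd (T *m M *m T^T).
Proof.
move=> uT [MT M0]; split; first by rewrite !trmx_mul trmxK MT mulmxA.
move=> x x0; rewrite !mulmxA -mulmxA -trmx_mul; apply: M0.
by apply: contra_neq x0 => /(congr1 (mulmx^~ (invmx T))); rewrite mulmxK// mul0mx.
Qed.

Lemma pd_diag_gt0 n (M : 'M[R]_n) i : pd M -> 0 < M i i.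
Proof.
move=> [_ M0]; have := M0 (delta_mx 0 i).
rewrite -rowE trmx_delta -colE !mxE; apply.
by apply/eqP => /matrixP /(_ 0 i); rewrite !mxE !eqxx => /eqP; rewrite oner_eq0.
Qed.

Lemma pd_conv n (X Y : 'M[R]_n) (l : R) : pd X -> pd Y -> 0 < l < 1 ->
  pd (l *: X + (1 - l) *: Y).
Proof.
move=> [XT X0] [YT Y0] /andP[l0 l1]; split.
  by rewrite linearD/= !linearZ/= XT YT.
move=> x x0; rewrite mulmxDr mulmxDl -!scalemxAr -!scalemxAl !mxE.
by rewrite addr_gt0// mulr_gt0 ?subr_gt0//; [have := X0 _ x0|have := Y0 _ x0]; rewrite !mxE.
Qed.

(** Products of transvections with a single nontrivial column. *)
Inductive transvections n : 'M[R]_n -> Prop :=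
| transvections1 : transvections 1%:M
| transvectionsS (k : 'I_n) (v : 'cV[R]_n) S : v k 0 = 0 -> transvections S ->
    transvections ((1%:M + v *m delta_mx 0 k) *m S).

Lemma transvections_unit n (S : 'M[R]_n) : transvections S -> S \in unitmx.
Proof.
elim=> [|k v {}S vk _ IH]; first exact: unitmx1.
by rewrite unitmx_mul IH transvection_unit.
Qed.

Lemma multf_transvections n (c : 'M[R]_n -> R) (S : 'M[R]_n) :
  (forall T, T \in unitmx -> 0 < c T) ->
  (forall S T, S \in unitmx -> T \in unitmx -> c (S *m T) = c S * c T) ->
  (forall U, U *m U^T = 1%:M -> c U = 1) ->
  transvections S -> c S = 1.
Proof.
move=> c0 cM cU; elim=> [|k v {}S vk tS IH]; first by apply: cU; rewrite trmx1 mulmx1.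
rewrite cM ?transvection_unit ?transvections_unit// IH mulr1.
exact: multf_transvection.
Qed.

(** Only the square is needed; it comes from [multf_transvections] for |det|. *)
Lemma det_transvections n (S : 'M[R]_n) : transvections S -> \det S ^+ 2 = 1.
Proof.
move=> tS; rewrite -real_normK ?num_real//.
suff -> : `|\det S| = 1 by rewrite expr1n.
apply: (@multf_transvections _ (fun T => `|\det T|) _ _ _ _ tS) => [T|T U uT uU|U UU].
- by rewrite unitmxE unitfE normr_gt0.
- by rewrite det_mulmx normrM.
- have := congr1 determinant UU; rewrite det_mulmx det_tr det1 -expr2 => /eqP.
  by rewrite sqrf_eq1 => /orP[] /eqP ->; rewrite ?normrN normr1.
Qed.

Lemma mul_transvection n p (k : 'I_n) (v : 'cV[R]_n) (A : 'M[R]_(n, p)) i l :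
  ((1%:M + v *m delta_mx 0 k) *m A) i l = A i l + v i 0 * A k l.
Proof. by rewrite mulmxDl mul1mx -mulmxA -rowE !mxE big_ord1 !mxE. Qed.

Lemma mul_tr_transvection n p (k : 'I_n) (v : 'cV[R]_n) (A : 'M[R]_(p, n)) i l :
  (A *m (1%:M + v *m delta_mx 0 k)^T) i l = A i l + v l 0 * A i k.
Proof.
rewrite -[A *m _]trmxK trmx_mul trmxK [LHS]mxE mul_transvection.
by rewrite [A^T l i]mxE [A^T k i]mxE.
Qed.

(** Symmetric Gaussian elimination; as each step decreases the diagonal, the
    pivots are bounded by the diagonal entries. *)
Lemma pd_elimination n (M : 'M[R]_n) : pd M ->
  exists S w, [/\ transvections S, S *m M *m S^T = diag_mx w &
    forall i, 0 < w 0 i <= M i i].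
Proof.
move=> pM.
(* after j steps the first j rows and columns are those of a diagonal matrix *)
have step (j : nat) : (j <= n)%N -> exists S, [/\ transvections S,
    forall i, (S *m M *m S^T) i i <= M i i &
    forall i l : 'I_n, i != l -> (minn i l < j)%N -> (S *m M *m S^T) i l = 0].
  elim: j => [_|j IH jn].
    exists 1%:M; split=> [|i|//]; first exact: transvections1.
    by rewrite trmx1 mul1mx mulmx1.
  have [S [tS Sd S0]] := IH (ltnW jn); pose k := Ordinal jn.
  set M' := S *m M *m S^T in Sd S0.
  have pM' : pd M' by apply: pd_congr => //; exact: transvections_unit.
  have k0 := pd_diag_gt0 k pM'.
  have sym i l : M' i l = M' l i by rewrite -[in LHS]pM'.1 mxE.
  pose v : 'cV[R]_n := \col_i (if i == k then 0 else - M' i k / M' k k).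
  have vE i : v i 0 = if i == k then 0 else - M' i k / M' k k by rewrite mxE.
  have vk : v k 0 = 0 by rewrite vE eqxx.
  exists ((1%:M + v *m delta_mx 0 k) *m S).
  have entry i l : ((1%:M + v *m delta_mx 0 k) *m S *m M
      *m ((1%:M + v *m delta_mx 0 k) *m S)^T) i l =
      M' i l + v i 0 * M' k l + v l 0 * M' i k + v i 0 * v l 0 * M' k k.
    rewrite trmx_mul !mulmxA -(mulmxA _ S) -(mulmxA _ (S *m M)) -/M'.
    by rewrite mul_tr_transvection !mul_transvection; ring.
  split; first exact: transvectionsS.
  - move=> i; rewrite entry; apply: le_trans (Sd i).
    rewrite vE; case: eqP => [_|_]; first by rewrite !mul0r !addr0.
    rewrite [M' k i]sym -!addrA gerDl.
    rewrite [X in X <= 0](_ : _ = - (M' i k ^+ 2 / M' k k)); last first.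
      by field; rewrite gt_eqF.
    by rewrite oppr_le0 divr_ge0 ?sqr_ge0// ltW.
  - move=> i l il; rewrite ltnS => ilj; rewrite entry !vE.
    have [ik|ik] := eqVneq i k.
      rewrite ik in il *; rewrite eq_sym (negbTE il) [M' l k]sym.
      by field; rewrite gt_eqF.
    have [lk|lk] := eqVneq l k; first by rewrite lk; field; rewrite gt_eqF.
    have ilj' : (minn i l < j)%N.
      rewrite ltn_neqAle ilj andbT; apply/eqP => mj.
      move: ik lk; rewrite -!val_eqE/= -mj /minn; case: ifP; rewrite eqxx//.
    rewrite (S0 i l il ilj'); move: ilj'; rewrite gtn_min => /orP[ij|lj].
      have -> : M' i k = 0 by apply: S0 => //; rewrite gtn_min ij.
      by rewrite oppr0 !mul0r mulr0 !addr0.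
    have E : M' l k = 0 by apply: S0 => //; rewrite gtn_min lj.
    by rewrite [M' k l]sym E oppr0 !(mul0r, mulr0) !addr0.
have [S [tS Sd S0]] := step n (leqnn n).
have pM' : pd (S *m M *m S^T) by apply: pd_congr => //; exact: transvections_unit.
exists S, (\row_i (S *m M *m S^T) i i); split=> // [|i]; last first.
  by rewrite mxE pd_diag_gt0// Sd.
apply/matrixP => i l; rewrite [RHS]mxE [X in X *+ _]mxE; have [<-|il] := eqVneq i l; first by rewrite mulr1n.
by rewrite S0 ?mulr0n// gtn_min ltn_ord.
Qed.

Lemma det_congr_transvections n (M S : 'M[R]_n) : transvections S ->
  \det (S *m M *m S^T) = \det M.
Proof.
by move=> /det_transvections dS; rewrite !det_mulmx det_tr mulrAC -expr2 dS mul1r.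
Qed.

(** Hadamard's inequality. *)
Lemma pd_det n (M : 'M[R]_n) : pd M -> 0 < \det M <= \prod_i M i i.
Proof.
move=> /pd_elimination[S [w [tS SE w0]]].
rewrite -(det_congr_transvections M tS) SE det_diag; apply/andP; split.
  by apply: prodr_gt0 => i _; have /andP[] := w0 i.
by apply: ler_prod => i _; have /andP[/ltW -> ->] := w0 i.
Qed.

Lemma pd_det_gt0 n (M : 'M[R]_n) : pd M -> 0 < \det M.
Proof. by move/pd_det => /andP[]. Qed.

Lemma pd_unit n (M : 'M[R]_n) : pd M -> M \in unitmx.
Proof. by move/pd_det_gt0; rewrite unitmxE unitfE => /gt_eqF ->. Qed.

Lemma pd_det_le_trace n (M : 'M[R]_n) : pd M -> \det M <= expR (\tr M - n%:R).
Proof.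
move=> pM; have /andP[_ /le_trans] := pd_det pM; apply.
rewrite (_ : \tr M - n%:R = \sum_i (M i i - 1)); last first.
  by rewrite sumrB sumr_const card_ord.
rewrite expR_sum; apply: ler_prod => i _.
rewrite ltW ?pd_diag_gt0//=; have := expR_ge1Dx (M i i - 1).
by rewrite addrCA subrr addr0.
Qed.

(** A congruence that reduces Z to the identity. *)
Lemma pd_whiten n (Z : 'M[R]_n) : pd Z ->
  exists W, [/\ W \in unitmx, W *m Z *m W^T = 1%:M & W^T *m W = invmx Z].
Proof.
move=> pZ; have [S [w [tS SE w0]]] := pd_elimination pZ.
pose r : 'rV[R]_n := \row_i (Num.sqrt (w 0 i))^-1.
have w0' i : 0 < w 0 i by have /andP[] := w0 i.
have WZW : (diag_mx r *m S) *m Z *m (diag_mx r *m S)^T = 1%:M.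
  rewrite trmx_mul tr_diag_mx !mulmxA -(mulmxA _ S) -(mulmxA _ (S *m Z)) SE.
  rewrite !mulmx_diag -diag_const_mx; congr diag_mx; apply/rowP => i.
  by rewrite !mxE mulrAC -invfM -expr2 sqr_sqrtr ?ltW// mulVf ?gt_eqF.
have uW : diag_mx r *m S \in unitmx.
  by have [] := mulmx1_unit (etrans (mulmxA _ _ _) WZW).
exists (diag_mx r *m S); split=> //; set W := diag_mx r *m S in WZW uW *.
have uZ := pd_unit pZ.
have WWZ : W^T *m W *m Z = 1%:M by rewrite -mulmxA; exact: mulmx1C.
by rewrite -[LHS]mulmx1 -(mulmxV uZ) mulmxA WWZ mul1mx.
Qed.

(** The tangent inequality for log det at Z. *)
Lemma det_le_det_exp n (X Z : 'M[R]_n) : pd X -> pd Z ->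
  \det X <= \det Z * expR (\tr (X *m invmx Z) - n%:R).
Proof.
move=> pX pZ; have [W [uW WZ WW]] := pd_whiten pZ.
have := pd_det_le_trace (pd_congr uW pX).
rewrite mxtrace_mulC mulmxA -mxtrace_mulC.
have -> : \tr (X *m (W^T *m W)) = \tr (X *m invmx Z) by rewrite WW.
have dW : \det W * \det Z * \det W = 1.
  by have := congr1 determinant WZ; rewrite !det_mulmx det_tr det1.
rewrite !det_mulmx det_tr => H; have := ler_wpM2l (ltW (pd_det_gt0 pZ)) H.
by rewrite [X in X <= _](_ : _ = \det X)// -[RHS]mul1r -dW; ring.
Qed.

(** Concavity of log det. *)
Lemma det_log_concave n (X Y : 'M[R]_n) (l : R) : pd X -> pd Y -> 0 < l < 1 ->
  \det X `^ l * \det Y `^ (1 - l) <= \det (l *: X + (1 - l) *: Y).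
Proof.
move=> pX pY l01; have pZ := pd_conv pX pY l01; set Z := l *: X + _ in pZ *.
have /andP[l0 l1] := l01.
have Z0 := pd_det_gt0 pZ.
have := det_le_det_exp pX pZ; have := det_le_det_exp pY pZ.
set u := \tr _; set v := \tr _ => HY HX.
have uv : l * v + (1 - l) * u = n%:R.
  rewrite /u /v -!mxtraceZ -mxtraceD !scalemxAl -mulmxDl mulmxV ?pd_unit//.
  by rewrite mxtrace1.
have pw (A : 'M[R]_n) (s t : R) : pd A -> 0 < t -> \det A <= \det Z * expR s ->
    \det A `^ t <= \det Z `^ t * expR (s * t).
  move=> pA t0 H; rewrite expRM -powRM ?expR_ge0 ?(ltW Z0)//.
  apply: ge0_ler_powR => //; rewrite ?nnegrE; [exact: ltW|exact/ltW/pd_det_gt0|].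
  by rewrite mulr_ge0 ?expR_ge0// ltW.
have l1' : 0 < 1 - l by rewrite subr_gt0.
apply: le_trans (ler_pM _ _ (pw _ _ _ pX l0 HX) (pw _ _ _ pY l1' HY)) _;
  rewrite ?powR_ge0//.
have ZZ : \det Z `^ l * \det Z `^ (1 - l) = \det Z.
  rewrite -powRD; last by apply/implyP => _; rewrite gt_eqF.
  by rewrite (addrC l) subrK powRr1// ltW.
rewrite mulrACA ZZ.
rewrite -expRD [X in expR X](_ : _ = 0) ?expR0 ?mulr1//.
by rewrite -uv; ring.
Qed.

End PositiveDefinite.

(** * Determinants of compressed forms *)

Section Jacobi.
Context {R : realType}.

(** Jacobi's identity for complementary minors of an invertible matrix. *)
Lemma det_ulsubmx p q (B B' : 'M[R]_(p + q)) : B *m B' = 1%:M ->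
  \det (ulsubmx B) = \det B * \det (drsubmx B').
Proof.
move=> BB; pose C := block_mx 1%:M (ursubmx B') 0 (drsubmx B') : 'M[R]_(p + q).
have BC : B *m C = block_mx (ulsubmx B) 0 (dlsubmx B) 1%:M.
  move: BB; rewrite -{1}(submxK B) -{1}(submxK B') mulmx_block scalar_mx_block.
  case/eq_block_mx => _ H1 _ H2.
  by rewrite -{1}(submxK B) /C mulmx_block !mulmx1 !mulmx0 !addr0 H1 H2.
have := congr1 determinant BC.
by rewrite det_mulmx /C det_ublock det_lblock !det1 mul1r mulr1 => <-.
Qed.

Lemma det_conj p q (O : 'M[R]_(p, q)) (O' : 'M[R]_(q, p)) (A : 'M[R]_q) : p = q ->
  O *m O' = 1%:M -> \det (O *m A *m O') = \det A.
Proof.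
move=> pq; case: _ / pq O O' A => O O' A OO.
by rewrite !det_mulmx mulrAC -det_mulmx OO det1 mul1r.
Qed.

(** Jacobi's identity for the compressions of A and of its inverse to two
    complementary subspaces. *)
Lemma det_compression N p q (P : 'M[R]_(p, N)) (P' : 'M[R]_(N, p)) (Q : 'M[R]_(q, N))
    (Q' : 'M[R]_(N, q)) (A : 'M[R]_N) : (p + q)%N = N ->
  P *m P' = 1%:M -> P *m Q' = 0 -> Q *m P' = 0 -> Q *m Q' = 1%:M -> A \in unitmx ->
  \det (P *m A *m P') = \det A * \det (Q *m invmx A *m Q').
Proof.
move=> pqN PP PQ QP QQ uA.
pose O := col_mx P Q; pose O' := row_mx P' Q'.
have OO : O *m O' = 1%:M by rewrite mul_col_row PP PQ QP QQ scalar_mx_block.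
have OO' : O' *m O = 1%:M.
  by move: O O' OO; clear -pqN; case: _ / pqN => O O'; exact: mulmx1C.
have BB : (O *m A *m O') *m (O *m invmx A *m O') = 1%:M.
  by rewrite !mulmxA -(mulmxA _ O') OO' mulmx1 -(mulmxA O) mulmxV// mulmx1.
have := det_ulsubmx BB; rewrite det_conj//.
by rewrite (mul_col_mx _ _ A) (mul_col_mx _ _ (invmx A)) !mul_col_row block_mxKul block_mxKdr.
Qed.

End Jacobi.

Section LinearMaps.
Context {R : realType}.

Lemma mulmx_ext p q (A B : 'M[R]_(p, q)) :
  (forall u : 'rV_p, u *m A = u *m B) -> A = B.
Proof. by move=> AB; apply/row_matrixP => i; rewrite !rowE AB. Qed.

Lemma mxvec_dot p q (x y : 'M[R]_(p, q)) :
  (mxvec x *m (mxvec y)^T) 0 0 = \sum_i (row i x *m (row i y)^T) 0 0.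
Proof.
under eq_bigr do rewrite mxE.
rewrite pair_bigA mxE (reindex _ (curry_mxvec_bij _ _)) /=.
by apply: eq_bigr => -[i j] _; rewrite /= [X in _ * X = _]mxE !mxvecE !mxE.
Qed.

(** The action of the block diagonal matrix of the A_i on an n-tuple of rows. *)
Definition rowmul n d (A : 'I_n -> 'M[R]_d) (x : 'M[R]_(n, d)) : 'M[R]_(n, d) :=
  \matrix_i (row i x *m A i).

Lemma row_rowmul n d (A : 'I_n -> 'M[R]_d) x i : row i (rowmul A x) = row i x *m A i.
Proof. by rewrite rowK. Qed.

Lemma rowmul_linear n d (A : 'I_n -> 'M[R]_d) : linear (rowmul A).
Proof.
move=> a x y; apply/row_matrixP => i.
by rewrite linearD/= linearZ/= !row_rowmul linearD/= linearZ/= mulmxDl scalemxAl.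
Qed.

HB.instance Definition _ n d (A : 'I_n -> 'M[R]_d) :=
  GRing.isLinear.Build R 'M[R]_(n, d) 'M[R]_(n, d) _ (rowmul A) (rowmul_linear A).

(** The matrix of the quadratic form sum_i (V z)_i A_i (V z)_i^T in the k x d
    matrix z, which is flattened to a row vector. *)
Definition block_form n k d (V : 'M[R]_(n, k)) (A : 'I_n -> 'M[R]_d) : 'M[R]_(k * d) :=
  lin_mx (mulmx V) *m lin_mx (rowmul A) *m lin_mx (mulmx V^T).

Lemma mul_block_form n k d (V : 'M[R]_(n, k)) (A : 'I_n -> 'M[R]_d) (u : 'rV_(k * d)) :
  u *m block_form V A = mxvec (V^T *m rowmul A (V *m vec_mx u)).
Proof. by rewrite /block_form !mulmxA !mul_rV_lin !mxvecK. Qed.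

Lemma row_dotC d (w v : 'rV[R]_d) : (w *m v^T) 0 0 = (v *m w^T) 0 0.
Proof. by rewrite -[w *m v^T]trmxK trmx_mul trmxK [LHS]mxE. Qed.

Lemma sum_row_dot n d (x y : 'M[R]_(n, d)) :
  \sum_i (row i x *m (row i y)^T) 0 0 = \tr (x *m y^T).
Proof.
apply: eq_bigr => i _; rewrite !mxE; apply: eq_bigr => j _.
by rewrite !mxE.
Qed.

Lemma block_formE n k d (V : 'M[R]_(n, k)) (A : 'I_n -> 'M[R]_d) (u w : 'rV_(k * d)) :
  (u *m block_form V A *m w^T) 0 0 =
  \sum_i (row i (V *m vec_mx u) *m A i *m (row i (V *m vec_mx w))^T) 0 0.
Proof.
rewrite mul_block_form -{1}(vec_mxK w) mxvec_dot sum_row_dot.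
rewrite -mulmxA mxtrace_mulC -mulmxA -trmx_mul -sum_row_dot.
by apply: eq_bigr => i _; rewrite row_rowmul.
Qed.

Lemma pd_block_form n k d (V : 'M[R]_(n, k)) (A : 'I_n -> 'M[R]_d) :
  V^T *m V = 1%:M -> (forall i, pd (A i)) -> pd (block_form V A).
Proof.
move=> VV pA; split.
  apply/matrixP => i j.
  have E (B : 'M[R]_(k * d)) i' j' : B i' j' =
      ((delta_mx 0 i' : 'rV_(k * d)) *m B *m (delta_mx 0 j' : 'rV_(k * d))^T) 0 0.
    by rewrite -rowE trmx_delta -colE !mxE.
  rewrite [LHS]mxE [LHS]E [RHS]E !block_formE; apply: eq_bigr => l _.
  by rewrite row_dotC trmx_mul (pA l).1 mulmxA.
move=> u u0; rewrite block_formE.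
have q0 i : 0 <= (row i (V *m vec_mx u) *m A i *m (row i (V *m vec_mx u))^T) 0 0.
  have [->|r0] := eqVneq (row i (V *m vec_mx u)) 0; first by rewrite !mul0mx mxE.
  by rewrite ltW// (pA i).2.
rewrite lt_neqAle sumr_ge0 ?andbT// eq_sym; apply: contra_neq u0 => /eqP.
rewrite psumr_eq0// => /allP H.
suff Vu : V *m vec_mx u = 0.
  by rewrite -[u]vec_mxK -[vec_mx u]mul1mx -VV -mulmxA Vu mulmx0 linear0.
apply/row_matrixP => i; rewrite row0; apply/eqP; apply: contraT => r0.
by have := H i (mem_index_enum i); rewrite gt_eqF// (pA i).2.
Qed.

Lemma pd_inv d (A : 'M[R]_d) : pd A -> pd (invmx A).
Proof.
move=> pA; have uA := pd_unit pA.
have := pd_congr (T := invmx A) _ pA; rewrite unitmx_inv => /(_ uA).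
by rewrite mulVmx// mul1mx trmx_inv pA.1.
Qed.

Lemma pd_simplex_sum n d (a : 'rV[R]_n) (B : 'I_n -> 'M[R]_d) :
  std_simplex a -> (forall i, pd (B i)) -> pd (\sum_i a 0 i *: B i).
Proof.
move=> [a01 a1] pB; split.
  by rewrite linear_sum/=; apply: eq_bigr => i _; rewrite linearZ/= (pB i).1.
move=> x x0; rewrite mulmx_sumr mulmx_suml summxE.
have q0 i : 0 < (x *m B i *m x^T) 0 0 by rewrite (pB i).2.
have qE i : (x *m (a 0 i *: B i) *m x^T) 0 0 = a 0 i * (x *m B i *m x^T) 0 0.
  by rewrite -scalemxAr -scalemxAl mxE.
under eq_bigr do rewrite qE.
have t0 i : true -> 0 <= a 0 i * (x *m B i *m x^T) 0 0.
  by move=> _; rewrite mulr_ge0 ?(ltW (q0 _))//; have /andP[] := a01 i.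
rewrite lt_neqAle sumr_ge0 ?andbT// eq_sym; apply/negP.
rewrite psumr_eq0// => /allP H; have := oner_neq0 R; rewrite -a1 big1 ?eqxx// => i _.
by have := H i (mem_index_enum i); rewrite mulf_eq0 (gt_eqF (q0 i)) orbF => /eqP.
Qed.

(** The columns of V span the orthogonal complement of the unit vector b; for
    V = 1 the form is the block diagonal one, of determinant prod_i det A_i. *)
Lemma det_block_form n k d (V : 'M[R]_(n, k)) (b : 'cV[R]_n) (A : 'I_n -> 'M[R]_d) :
  n = k.+1 -> V^T *m V = 1%:M -> V^T *m b = 0 -> b^T *m b = 1%:M ->
  (forall i, pd (A i)) ->
  \det (block_form V A) =
    \det (block_form 1%:M A) * \det (\sum_i (b i 0) ^+ 2 *: invmx (A i)).
Proof.
move=> nk VV Vb bb pA; have bV : b^T *m V = 0.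
  by rewrite -[LHS]trmxK trmx_mul trmxK Vb trmx0.
have E1 : block_form 1%:M A = lin_mx (rowmul A).
  by apply: mulmx_ext => u; rewrite mul_block_form mul_rV_lin trmx1 !mul1mx.
have uA i : A i \in unitmx by exact: pd_unit.
pose Ai := fun i => invmx (A i).
have AAi : lin_mx (rowmul A) *m lin_mx (rowmul Ai) = 1%:M.
  apply: mulmx_ext => u; rewrite mulmxA !mul_rV_lin mxvecK mulmx1 -[RHS]vec_mxK.
  congr mxvec; apply/row_matrixP => i; rewrite !row_rowmul -mulmxA mulmxV// mulmx1//.
have [uL _] := mulmx1_unit AAi.
have invA : invmx (lin_mx (rowmul A)) = lin_mx (rowmul Ai).
  by rewrite -[RHS]mul1mx -(mulVmx uL) -mulmxA AAi mulmx1.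
pose Q : 'M[R]_(d, n * d) := lin1_mx (mxvec \o mulmx b).
pose Q' : 'M[R]_(n * d, d) := lin1_mx (mulmx b^T \o vec_mx).
have QE u : u *m Q = mxvec (b *m u) by rewrite mul_rV_lin1.
have Q'E u : u *m Q' = b^T *m vec_mx u by rewrite mul_rV_lin1.
rewrite E1 {1}/block_form (@det_compression _ _ _ _ _ _ Q Q')//.
- rewrite invA; congr (_ * \det _); apply: mulmx_ext => u.
  rewrite !mulmxA QE mul_rV_lin Q'E !mxvecK mulmx_sumr mulmx_sum_row.
  apply: eq_bigr => i _; rewrite row_rowmul -scalemxAr expr2 -scalerA mxE.
  by congr (_ *: _); rewrite row_mul [row i b]mx11_scalar mxE mul_scalar_mx -scalemxAl.
- by rewrite nk mulSn addnC.
- by apply: mulmx_ext => u; rewrite mulmxA !mul_rV_lin /= mxvecK mulmxA VV mul1mx vec_mxK mulmx1.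
- by apply: mulmx_ext => u; rewrite mulmxA mul_rV_lin Q'E /= mxvecK mulmxA bV mul0mx mulmx0.
- by apply: mulmx_ext => u; rewrite mulmxA QE mul_rV_lin /= mxvecK mulmxA Vb mul0mx linear0 mulmx0.
- by apply: mulmx_ext => u; rewrite mulmxA QE Q'E mxvecK mulmxA bb mul1mx mulmx1.
Qed.

(** A unit vector is the first column of an orthogonal matrix, namely of a
    Householder reflection. *)
Lemma orthogonal_completion k (b : 'cV[R]_k.+1) : b^T *m b = 1%:M ->
  exists V : 'M[R]_(k.+1, k),
    [/\ V^T *m V = 1%:M, V^T *m b = 0 & V *m V^T + b *m b^T = 1%:M].
Proof.
move=> bb.
suff [U [UU Ub]] : exists U : 'M[R]_(1 + k), U^T *m U = 1%:M /\ lsubmx U = b.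
  exists (rsubmx U).
  have UU' : U *m U^T = 1%:M by exact: mulmx1C.
  move: UU UU'; rewrite -{1 2 3 4}(hsubmxK U) Ub tr_row_mx mul_col_row mul_row_col scalar_mx_block.
  by case/eq_block_mx => _ _ Vb VV; rewrite addrC.
pose e : 'cV[R]_(1 + k) := delta_mx 0 0.
have lsub0 (U : 'M[R]_(1 + k)) : lsubmx U = U *m e.
  by apply/colP => i; rewrite /e -colE !mxE; congr (U i _); apply/val_inj.
have [->|be] := eqVneq b e.
  by exists 1%:M; rewrite lsub0 mul1mx trmx1 mulmx1.
pose w := b - e; pose s := (w^T *m w) 0 0.
have ee : e^T *m e = 1%:M.
  by rewrite /e trmx_delta mul_delta_mx; apply/matrixP => i j; rewrite !mxE !ord1.
have wE : w^T *m w = s%:M by rewrite [LHS]mx11_scalar.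
have [beta bE] : exists beta, b^T *m e = beta%:M.
  by exists ((b^T *m e) 0 0); exact: mx11_scalar.
have eb : e^T *m b = beta%:M by rewrite -[LHS]trmxK trmx_mul trmxK bE tr_scalar_mx.
have sE : s = 2 - 2 * beta.
  rewrite /s /w [(b - e)^T]linearB/= mulmxBl !mulmxBr bb ee bE eb !mxE/= !mulr1n; ring.
have s0 : s != 0.
  apply: contra_neq be; rewrite /s mxE => /eqP.
  rewrite psumr_eq0 => [/allP H|i _]; last by rewrite mxE -expr2 sqr_ge0.
  apply/colP => i; apply/eqP; rewrite -subr_eq0.
  by have := H i (mem_index_enum i); rewrite !mxE mulf_eq0 orbb.
have we : w^T *m e = (- s / 2)%:M.
  rewrite /w linearB/= mulmxBl bE ee -raddfB/= sE; congr _%:M; by field.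
pose N := w *m w^T; have NN : N *m N = s *: N.
  by rewrite /N mulmxA -(mulmxA w) wE mul_mx_scalar -scalemxAl.
have HT : (1%:M - (2 / s) *: N)^T = 1%:M - (2 / s) *: N.
  by rewrite linearB/= trmx1 linearZ/= trmx_mul trmxK.
exists (1%:M - (2 / s) *: N : 'M[R]_(1 + k)); split.
  rewrite HT.
  rewrite mulmxBl mul1mx mulmxBr mulmx1 -scalemxAl -scalemxAr NN !scalerA.
  rewrite -scalerBl -addrA -opprD -scalerDl [X in X *: N](_ : _ = 0) ?scale0r ?subr0//.
  by field.
rewrite lsub0 mulmxBl mul1mx -scalemxAl -mulmxA we mul_mx_scalar scalerA.
rewrite [X in X *: w](_ : _ = -1); last by field.
by rewrite scaleN1r opprK /w addrC subrK.
Qed.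

End LinearMaps.

(** * Gaussian integrals *)

Section GaussianIntegrals.
Context {R : realType}.

(** The substitution of x T for x, where T T^T = M, reduces the form to the
    squared norm. *)
Lemma integral_gauss_form m (E : R) (M : 'M[R]_m) : 0 < E ->
  (\int[hmu (m := m)]_x gauss x = E%:E)%E -> pd M ->
  (\int[hmu (m := m)]_x (expR (- (x *m M *m x^T) 0 0))%:E = (E / Num.sqrt (\det M))%:E)%E.
Proof.
move=> E0 gaussE pM; have [S [w [tS SE w0]]] := pd_elimination pM.
have w0' i : 0 < w 0 i by have /andP[] := w0 i.
pose r : 'rV[R]_m := \row_i Num.sqrt (w 0 i).
have r0 i : 0 < r 0 i by rewrite mxE sqrtr_gt0.
have uS := transvections_unit tS.
have [c [c0 cM cU cs gc]] : exists c : 'M[R]_m -> R, [/\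
    forall T, T \in unitmx -> 0 < c T,
    forall S T, S \in unitmx -> T \in unitmx -> c (S *m T) = c S * c T,
    forall U, U *m U^T = 1%:M -> c U = 1,
    forall t, 0 < t -> c t%:M = t ^- m &
    forall T, T \in unitmx -> (\int[hmu (m := m)]_x gauss (x *m T)%R = (c T * E)%:E)%E].
  exists (jac E); split=> [T|T U|U|t|T uT].
  - exact: (jac_gt0 E0 gaussE).
  - exact: (jacM E0 gaussE).
  - exact: (jac_orthogonal E0 gaussE).
  - exact: (jac_scalar E0 gaussE).
  - by have [_ ->] := gauss_jac E0 gaussE uT.
have cS := multf_transvections c0 cM cU tS.
have cr : c (diag_mx r) = (\prod_i r 0 i)^-1 by exact: multf_diag.
have ur : diag_mx r \in unitmx.
  by rewrite unitmxE det_diag unitfE; apply/prodf_neq0 => i _; rewrite gt_eqF.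
pose T := invmx S *m diag_mx r.
have TT : T *m T^T = M.
  rewrite /T trmx_mul tr_diag_mx mulmxA -(mulmxA (invmx S)) mulmx_diag.
  rewrite (_ : \row__ _ = w); last first.
    by apply/rowP => i; rewrite !mxE -expr2 sqr_sqrtr// ltW.
  rewrite -SE !mulmxA mulVmx// mul1mx -mulmxA -trmx_mul mulVmx// trmx1 mulmx1//.
have cT : c T = (Num.sqrt (\det M))^-1.
  rewrite /T cM ?unitmx_inv// cr.
  have -> : c (invmx S) = 1.
    by rewrite -[LHS]mul1r -cS -cM ?unitmx_inv// mulmxV// cU// trmx1 mulmx1.
  rewrite mul1r -(det_congr_transvections M tS) SE det_diag.
  congr _^-1; apply/eqP; rewrite -(@eqrXn2 _ 2)//.
  - rewrite sqr_sqrtr; last by rewrite prodr_ge0// => i _; exact: ltW.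
    rewrite -prodrXl; apply/eqP; apply: eq_bigr => i _.
    by rewrite mxE sqr_sqrtr// ltW.
  - by rewrite prodr_ge0// => i _; exact: ltW.
have uT : T \in unitmx by rewrite unitmx_mul unitmx_inv uS.
rewrite mulrC -cT -(gc T uT).
apply: eq_integral => x _; rewrite /gauss; congr (expR (- _))%:E.
rewrite -TT !mulmxA -mulmxA -trmx_mul mxE; apply: eq_bigr => j _.
by rewrite -(mulmxA x) -/T [(_^T) _ _]mxE expr2.
Qed.

Lemma inv_sqrt_det_log_convex n (X Y : 'M[R]_n) (l c : R) : 0 < c -> pd X -> pd Y ->
  0 < l < 1 ->
  (Num.sqrt (c * \det (l *: X + (1 - l) *: Y)))^-1 <=
  (Num.sqrt (c * \det X))^-1 `^ l * (Num.sqrt (c * \det Y))^-1 `^ (1 - l).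
Proof.
move=> c0 pX pY l01; have H := det_log_concave pX pY l01.
have [dX dY] := (pd_det_gt0 pX, pd_det_gt0 pY).
have dZ := pd_det_gt0 (pd_conv pX pY l01).
move: (\det X) (\det Y) (\det (l *: X + _)) dX dY dZ H => x y z x0 y0 z0 H.
have sq (u t : R) : 0 < u -> (Num.sqrt u)^-1 `^ t = (Num.sqrt (u `^ t))^-1.
  move=> u0; rewrite -[(Num.sqrt u)^-1]powR_inv1// -powRrM mulN1r powRN.
  rewrite -(powR12_sqrt (ltW u0)) -(powR12_sqrt (powR_ge0 u t)) -!powRrM.
  by rewrite mulrC.
rewrite !sq ?mulr_gt0// -invfM -sqrtrM ?powR_ge0//.
rewrite lef_pV2 ?posrE ?sqrtr_gt0 ?mulr_gt0 ?powR_gt0 ?mulr_gt0//.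
rewrite ler_sqrt; last by rewrite mulr_ge0// ltW.
rewrite !powRM ?(ltW c0) ?(ltW x0) ?(ltW y0)//.
have cc : c `^ l * c `^ (1 - l) = c.
  rewrite -powRD; last by apply/implyP => _; rewrite gt_eqF.
  by rewrite (addrC l) subrK powRr1// ltW.
by rewrite mulrACA cc ler_pM2l.
Qed.

End GaussianIntegrals.

(** * Mixtures of Gaussians *)

Section Mixtures.
Context {R : realType} {n d : nat}.
Implicit Types (f g : 'M[R]_(n, d) -> R).

(** Symmetric positive semidefinite matrices. *)
Definition psd (M : 'M[R]_d) : Prop :=
  M^T = M /\ forall x : 'rV[R]_d, 0 <= (x *m M *m x^T) 0 0.

(** The closure of the Gaussians exp(-sum_i x_i A_i x_i^T), with no cross terms
    between rows, under sub-convex combinations and pointwise limits of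
    sequences. *)
Inductive mixture : ('M[R]_(n, d) -> R) -> Prop :=
| mixture_gauss (A : 'I_n -> 'M[R]_d) : (forall i, psd (A i)) ->
    mixture (fun x => expR (- \sum_i (row i x *m A i *m (row i x)^T) 0 0))
| mixture_comb f g a b : 0 <= a -> 0 <= b -> a + b <= 1 ->
    mixture f -> mixture g -> mixture (fun x => a * f x + b * g x)
| mixture_lim (f : nat -> 'M[R]_(n, d) -> R) g : (forall k, mixture (f k)) ->
    (forall x, f k x @[k --> \oo] --> g x) -> mixture g.

Lemma mixture_ext f g : mixture f -> f =1 g -> mixture g.
Proof. by move=> mf /funext <-. Qed.

Lemma mixture_bounds f x : mixture f -> 0 <= f x <= 1.
Proof.
elim=> [A pA|{}f g a b a0 b0 ab _ /andP[f0 f1] _ /andP[g0 g1]|F g _ IH Fg].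
- rewrite expR_ge0/= -expR0 ler_expR oppr_le0 sumr_ge0// => i _.
  by have [_] := pA i.
- rewrite addr_ge0 ?mulr_ge0//=; apply: le_trans ab; apply: lerD.
    by rewrite ler_piMr.
  by rewrite ler_piMr.
- apply/andP; split.
  + rewrite -(cvg_lim _ (Fg x))//; apply: limr_ge; first by apply/cvg_ex; exists (g x); exact: Fg.
    by apply: nearW => k; have /andP[] := IH k.
  + rewrite -(cvg_lim _ (Fg x))//; apply: limr_le; first by apply/cvg_ex; exists (g x); exact: Fg.
    by apply: nearW => k; have /andP[] := IH k.
Qed.

Lemma psd0 : psd 0.
Proof. by split=> [|x]; rewrite ?trmx0// mulmx0 mul0mx mxE. Qed.

Lemma psdD M M' : psd M -> psd M' -> psd (M + M').
Proof.
move=> [MT M0] [MT' M0']; split; first by rewrite linearD/= MT MT'.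
by move=> x; rewrite mulmxDr mulmxDl mxE addr_ge0.
Qed.

Lemma mixture1 : mixture (fun=> 1).
Proof.
apply: (mixture_ext (mixture_gauss (fun=> psd0))) => x.
by rewrite big1 ?oppr0 ?expR0// => i _; rewrite mulmx0 mul0mx mxE.
Qed.

Lemma mixture_mul f g : mixture f -> mixture g -> mixture (fun x => f x * g x).
Proof.
move=> mf mg; elim: mf => [A pA|{}f f' a b a0 b0 ab _ If _ If'|F {}f mF IH Ff]; last first.
- by apply: (mixture_lim IH) => x; apply: cvgMr_tmp; exact: Ff.
- apply: (mixture_ext (mixture_comb a0 b0 ab If If')) => x.
  by rewrite mulrDl !mulrA.
elim: mg => [B pB|{}g g' a b a0 b0 ab _ Ig _ Ig'|G {}g mG IH Gg]; last first.
- by apply: (mixture_lim IH) => x; apply: cvgMl_tmp; exact: Gg.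
- apply: (mixture_ext (mixture_comb a0 b0 ab Ig Ig')) => x.
  by rewrite mulrDr (mulrCA a) (mulrCA b).
apply: (mixture_ext (mixture_gauss (fun i => psdD (pA i) (pB i)))) => x.
rewrite -expRD -opprD -big_split/=; congr (expR (- _)); apply: eq_bigr => i _.
by rewrite mulmxDr mulmxDl mxE.
Qed.

Lemma mixture_prod (I : Type) (s : seq I) (F : I -> 'M[R]_(n, d) -> R) :
  (forall i, mixture (F i)) -> mixture (fun x => \prod_(i <- s) F i x).
Proof.
move=> mF; elim: s => [|i s IH].
  by apply: (mixture_ext mixture1) => x; rewrite big_nil.
by apply: (mixture_ext (mixture_mul (mF i) IH)) => x; rewrite big_cons.
Qed.

Lemma mixture_exprn f k : mixture f -> mixture (fun x => f x ^+ k).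
Proof.
move=> mf; apply: (mixture_ext (mixture_prod (iota 0 k) (fun=> mf))) => x.
by rewrite big_const_seq count_predT size_iota iter_mulr_1.
Qed.

End Mixtures.

Section ExpLimit.
Context {R : realType}.

(** The lower half of the squeeze for [cvg_expR_pow]. *)
Lemma expR_ge_inv1D (s : R) : 0 <= s < 1 -> expR (- (s / (1 - s))) <= 1 - s.
Proof.
move=> /andP[s0 s1]; have s1' : 0 < 1 - s by rewrite subr_gt0.
rewrite expRN -[leRHS]invrK lef_pV2 ?posrE ?invr_gt0 ?expR_gt0//.
apply: le_trans (expR_ge1Dx _); rewrite le_eqVlt; apply/orP; left; apply/eqP.
by field; rewrite gt_eqF.
Qed.

Lemma cvg_expR_pow (t : R) : 0 <= t ->
  (1 - t / (k.+1)%:R) ^+ k.+1 @[k --> \oo] --> expR (- t).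
Proof.
move=> t0.
apply: (@squeeze_cvgr _ _ _ _ (fun k : nat => expR (- (t / (1 - t / k.+1%:R))))
  (fun=> expR (- t))); last 2 first.
- have h0 : t / k.+1%:R @[k --> \oo] --> t * 0.
    apply: cvgMl_tmp; exact: cvg_harmonic.
  rewrite mulr0 in h0.
  apply: (@continuous_cvg _ _ _ _ _ _ expR); first exact: continuous_expR.
  have h1 : 1 - t / k.+1%:R @[k --> \oo] --> (1 - 0 : R).
    by apply: cvgB => //; exact: cvg_cst.
  rewrite subr0 in h1.
  have h2 : (1 - t / k.+1%:R)^-1 @[k --> \oo] --> (1^-1 : R).
    by apply: cvgV; [exact: oner_neq0|exact: h1].
  by apply: cvgN; rewrite -[X in _ --> X](divr1 t); apply: cvgMl_tmp; exact: h2.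
- exact: cvg_cst.
near=> k.
have tk : t / k.+1%:R < 1.
  rewrite ltr_pdivrMr// mul1r; near: k.
  exists (Num.truncn t).+1 => // k /= tk; apply: lt_le_trans (truncnS_gt t) _.
  by rewrite ler_nat ltnW// ltnS ltnW.
have s0 : 0 <= t / k.+1%:R by rewrite divr_ge0.
apply/andP; split; last first.
  rewrite (_ : - t = - (t / k.+1%:R) * k.+1%:R); last by rewrite mulNr divfK.
  rewrite expRM_natr.
  rewrite lerXn2r ?nnegrE ?expR_ge0 ?subr_ge0 ?(ltW tk)//.
  exact: expR_ge1Dx.
rewrite (_ : - _ = (- (t / k.+1%:R / (1 - t / k.+1%:R))) * k.+1%:R); last first.
  by rewrite mulNr mulrAC divfK.
rewrite expRM_natr lerXn2r ?nnegrE ?expR_ge0 ?subr_ge0 ?(ltW tk)//.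
by apply: expR_ge_inv1D; rewrite s0.
Unshelve. all: by end_near.
Qed.

(** The limit of ((1 - w/N) 1 + (w/N) g)^N; the exponent is shifted by K so that
    w/N <= 1 from the start. *)
Lemma mixture_compound n d (g : 'M[R]_(n, d) -> R) (w : R) : 0 <= w -> mixture g ->
  mixture (fun x => expR (- (w * (1 - g x)))).
Proof.
move=> w0 mg; pose K := (Num.truncn w).
have wK k : w / (k + K).+1%:R <= 1.
  rewrite ler_pdivrMr// mul1r; apply/ltW; apply: lt_le_trans (truncnS_gt w) _.
  by rewrite ler_nat ltnS leq_addl.
apply: (@mixture_lim _ _ _ (fun k x => (1 - w * (1 - g x) / (k + K).+1%:R) ^+ (k + K).+1)).
  move=> k; apply: mixture_exprn; set N := (k + K).+1.
  have wN : 0 <= w / N%:R by rewrite divr_ge0.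
  have := @mixture_comb _ _ _ (fun=> 1) g (1 - w / N%:R) (w / N%:R) _ wN _ mixture1 mg.
  rewrite subr_ge0 subrK lexx => /(_ (wK k) isT) mc; apply: (mixture_ext mc) => x.
  by rewrite mulr1; field; rewrite pnatr_eq0.
move=> x; have /andP[g0 g1] := mixture_bounds x mg.
have t0 : 0 <= w * (1 - g x) by rewrite mulr_ge0// subr_ge0.
by have := cvg_expR_pow t0; rewrite -(cvg_shiftn K).
Qed.

End ExpLimit.

(** * Fractional powers *)

Lemma geometric_sum_le {R : realType} (r : R) J : 0 <= r < 1 ->
  \sum_(j < J) r ^+ j <= (1 - r)^-1.
Proof.
move=> /andP[r0 r1]; rewrite -[leRHS]mul1r ler_pdivlMr ?subr_gt0//.
rewrite (_ : _ * (1 - r) = 1 - r ^+ J); last by rewrite -[RHS]opprB subrX1; ring.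
by rewrite gerBl exprn_ge0.
Qed.

(** The power r^q as a limit of positive combinations of the functions
    1 - e^{-br}: the sum over the geometric progression b = e^{jh}, j in Z, of
    b^{-q} (1 - e^{-br}) has the scaling behaviour of r^q for the ratio e^h. *)
Section PowerSeries.
Context {R : realType}.
Variables (q h : R).
Hypothesis q01 : 0 < q < 1.
Hypothesis h0 : 0 < h.

(** The term e^{-zhq} (1 - exp(-e^{zh} r)), for z in R. *)
Definition pterm (r z : R) : R := expR (- (z * h * q)) * (1 - expR (- (expR (z * h) * r))).

(** The sum of the terms of index -J, ..., J. *)
Definition psum (r : R) (J : nat) : R :=
  \sum_(j < J.+1) pterm r j%:R + \sum_(j < J) pterm r (- j.+1%:R).

Lemma pterm_ge0 r z : 0 <= r -> 0 <= pterm r z.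
Proof.
move=> r0; rewrite mulr_ge0 ?expR_ge0// subr_ge0 -expR0 ler_expR oppr_le0.
by rewrite mulr_ge0// expR_ge0.
Qed.

Lemma pterm_gt0 r z : 0 < r -> 0 < pterm r z.
Proof.
move=> r0; rewrite mulr_gt0 ?expR_gt0// subr_gt0 -expR0 ltr_expR oppr_lt0.
by rewrite mulr_gt0// expR_gt0.
Qed.

Lemma pterm_mono r s z : r <= s -> pterm r z <= pterm s z.
Proof.
move=> rs; rewrite ler_wpM2l ?expR_ge0// lerD2l lerN2 ler_expR lerN2.
by rewrite ler_wpM2l ?expR_ge0.
Qed.

Lemma pterm_shift r z y : pterm (expR (y * h) * r) z = expR (y * h * q) * pterm r (z + y).
Proof.
rewrite /pterm mulrA -expRD mulrA -expRD -!mulrDl.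
by congr (expR _ * _); ring.
Qed.

(* ratio of geometric series that dominate both halves of the sum *)
Let rho := Num.max (expR (- (h * q))) (expR (- (h * (1 - q)))).

Let rho01 : 0 < rho < 1.
Proof.
have /andP[q0 q1] := q01.
have e1 (x : R) : 0 < x -> expR (- x) < 1 by move=> x0; rewrite expR_lt1 oppr_lt0.
by rewrite lt_max expR_gt0/= gt_max !e1// mulr_gt0// subr_gt0.
Qed.

Lemma pterm_le r (j : nat) : 0 <= r -> pterm r j%:R <= rho ^+ j.
Proof.
move=> r0; apply: (@le_trans _ _ (expR (- (j%:R * h * q)))).
  by rewrite ler_piMr ?expR_ge0// gerBl expR_ge0.
rewrite (_ : - _ = - (h * q) * j%:R); last by ring.
have /andP[rho0 _] := rho01.
by rewrite expRM_natr lerXn2r ?nnegrE ?expR_ge0 ?(ltW rho0)// le_max lexx.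
Qed.

Lemma pterm_leN r (j : nat) : 0 <= r -> pterm r (- j.+1%:R) <= r * rho ^+ j.
Proof.
move=> r0; have /andP[rho0 /ltW rho1] := rho01.
apply: (@le_trans _ _ (r * rho ^+ j.+1)); last first.
  by rewrite ler_wpM2l// exprS ler_piMl// exprn_ge0// ltW.
apply: (@le_trans _ _ (r * expR (- (h * (1 - q)) * j.+1%:R))); last first.
  rewrite ler_wpM2l// expRM_natr lerXn2r ?nnegrE ?expR_ge0 ?(ltW rho0)//.
  by rewrite le_max lexx orbT.
rewrite /pterm; apply: (@le_trans _ _ (expR (- (- j.+1%:R * h * q)) * (expR (- j.+1%:R * h) * r))).
  rewrite ler_wpM2l ?expR_ge0// lerBlDl -lerBlDr.
  by have := expR_ge1Dx (- (expR (- j.+1%:R * h) * r)); rewrite addrC.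
rewrite mulrA -expRD mulrC le_eqVlt; apply/orP; left; apply/eqP.
by congr (_ * expR _); ring.
Qed.

Lemma psum_le r J : 0 <= r -> psum r J <= (1 + r) / (1 - rho).
Proof.
have rho01' : 0 <= rho < 1 by have /andP[/ltW -> ->] := rho01.
move=> r0; rewrite mulrDl mul1r; apply: lerD.
  by apply: le_trans (geometric_sum_le J.+1 rho01'); apply: ler_sum => j _; exact: pterm_le.
apply: (@le_trans _ _ (\sum_(j < J) r * rho ^+ j)).
  by apply: ler_sum => j _; exact: pterm_leN.
by rewrite -mulr_sumr ler_wpM2l// geometric_sum_le.
Qed.

Lemma psum_nondecreasing r : 0 <= r -> nondecreasing_seq (psum r).
Proof.
move=> r0; apply/nondecreasing_seqP => J; rewrite /psum.
have mono (F : nat -> R) N : 0 <= F N -> \sum_(j < N) F j <= \sum_(j < N.+1) F j.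
  by move=> F0; rewrite [leRHS]big_ord_recr/= lerDl.
apply: lerD; first by apply: (mono (fun j => pterm r j%:R)); exact: pterm_ge0.
by apply: (mono (fun j => pterm r (- j.+1%:R))); exact: pterm_ge0.
Qed.

(** The sum over all integers. *)
Definition plim (r : R) : R := limn (psum r).

Lemma psum_cvg r : 0 <= r -> psum r @ \oo --> plim r.
Proof.
move=> r0; apply: nondecreasing_is_cvgn; first exact: psum_nondecreasing.
by exists ((1 + r) / (1 - rho)) => _ [J _ <-]; exact: psum_le.
Qed.

Lemma psum_le_plim r J : 0 <= r -> psum r J <= plim r.
Proof.
move=> r0; apply: nondecreasing_cvgn_le; first exact: psum_nondecreasing.
by apply/cvg_ex; exists (plim r); exact: psum_cvg.
Qed.

Lemma plim_le r (b : R) : 0 <= r -> (forall J, psum r J <= b) -> plim r <= b.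
Proof.
move=> r0 H; apply: limr_le; last exact: nearW.
by apply/cvg_ex; exists (plim r); exact: psum_cvg.
Qed.

Lemma plim_mono r s : 0 <= r -> r <= s -> plim r <= plim s.
Proof.
move=> r0 rs; apply: plim_le => // J.
apply: le_trans (psum_le_plim J (le_trans r0 rs)).
by apply: lerD; apply: ler_sum => j _; exact: pterm_mono.
Qed.

Lemma plim_gt0 r : 0 < r -> 0 < plim r.
Proof.
move=> r0; apply: lt_le_trans (psum_le_plim 0 (ltW r0)).
by rewrite /psum big_ord0 addr0 big_ord1 pterm_gt0.
Qed.

(* the scaling r -> e^h r shifts the index, up to the terms at both ends *)
Let plim_up r : 0 <= r -> plim (expR h * r) <= expR (h * q) * plim r.
Proof.
move=> r0; have r0' : 0 <= expR h * r by rewrite mulr_ge0 ?expR_ge0.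
apply: plim_le => // J.
apply: (@le_trans _ _ (expR (h * q) * psum r J.+1)); last first.
  by rewrite ler_wpM2l ?expR_ge0// psum_le_plim.
have E z : pterm (expR h * r) z = expR (h * q) * pterm r (z + 1).
  by have := pterm_shift r z 1; rewrite !mul1r.
rewrite /psum; under eq_bigr do rewrite E natr1.
under [X in _ + X <= _]eq_bigr do rewrite E.
rewrite -!mulr_sumr -mulrDr ler_wpM2l ?expR_ge0//.
rewrite [\sum_(j < J.+2) _]big_ord_recl/= addrAC addrC; apply: lerD => //.
have T0 z : 0 <= pterm r z by exact: pterm_ge0.
case: J => [|J]; first by rewrite big_ord0 addr_ge0// sumr_ge0.
rewrite big_ord_recl/= addNr; apply: lerD => //.
under eq_bigr do rewrite -natr1 opprD addrNK.
by rewrite !big_ord_recr/= -addrA lerDl addr_ge0.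
Qed.

Let plim_down r : 0 <= r -> plim (expR (- h) * r) <= expR (- (h * q)) * plim r.
Proof.
move=> r0; have r0' : 0 <= expR (- h) * r by rewrite mulr_ge0 ?expR_ge0.
apply: plim_le => // J.
apply: (@le_trans _ _ (expR (- (h * q)) * psum r J.+1)); last first.
  by rewrite ler_wpM2l ?expR_ge0// psum_le_plim.
have E z : pterm (expR (- h) * r) z = expR (- (h * q)) * pterm r (z - 1).
  by have := pterm_shift r z (-1); rewrite !mulN1r mulNr.
have T0 z : 0 <= pterm r z by exact: pterm_ge0.
rewrite /psum; under eq_bigr do rewrite E.
under [X in _ + X <= _]eq_bigr do rewrite E.
rewrite -!mulr_sumr -mulrDr ler_wpM2l ?expR_ge0//.
rewrite big_ord_recl/= [X in _ <= _ + X]big_ord_recl/= sub0r -addrA [leRHS]addrCA.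
rewrite lerD2l; apply: lerD; last first.
  by apply: ler_sum => j _; rewrite /bump/= -[j.+2%:R]natr1 opprD.
under eq_bigr do rewrite -natr1 addrK.
by rewrite !big_ord_recr/= -addrA lerDl addr_ge0.
Qed.

Lemma plim_scale r : 0 <= r -> plim (expR h * r) = expR (h * q) * plim r.
Proof.
move=> r0; apply/eqP; rewrite eq_le plim_up//=.
have := plim_down (r := expR h * r); rewrite mulr_ge0 ?expR_ge0// => /(_ isT).
rewrite mulrA -expRD addNr expR0 mul1r expRN => H.
by rewrite -ler_pdivlMl ?expR_gt0.
Qed.

Lemma plim_scale_int (z : int) r : 0 <= r ->
  plim (expR (z%:~R * h) * r) = expR (z%:~R * h * q) * plim r.
Proof.
have nat_case (k : nat) s : 0 <= s -> plim (expR (k%:R * h) * s) = expR (k%:R * h * q) * plim s.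
  move=> s0; elim: k => [|k IH]; first by rewrite !mul0r expR0 !mul1r.
  rewrite (_ : expR _ * s = expR h * (expR (k%:R * h) * s)); last first.
    by rewrite mulrA -expRD -natr1 mulrDl mul1r addrC.
  rewrite plim_scale ?IH ?mulr_ge0 ?expR_ge0// mulrA -expRD -natr1.
  by congr (expR _ * _); ring.
move=> r0; case: z => k; first by rewrite -!pmulrn nat_case.
rewrite NegzE intrN -!pmulrn.
have := nat_case k.+1 (expR (- k.+1%:R * h) * r).
rewrite mulr_ge0 ?expR_ge0// => /(_ isT); rewrite mulrA -expRD mulNr subrr expR0 mul1r.
move=> ->; rewrite mulrA -expRD mulNr addNr expR0 mul1r//.
Qed.

(** By monotonicity, comparing r with the powers e^{zh} <= r <= e^{(z+1)h}. *)
Lemma plim_ratio r : 0 < r ->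
  expR (- (h * q)) * r `^ q <= plim r / plim 1 <= expR (h * q) * r `^ q.
Proof.
move=> r0; have /andP[q0 _] := q01.
pose z := Num.floor (ln r / h).
have zl : z%:~R * h <= ln r by rewrite -ler_pdivlMr// floor_le.
have zu : ln r <= (z%:~R + 1) * h.
  by rewrite -ler_pdivrMr// -[1]/(1%:~R) -intrD ltW// floorD1_gt.
have rE : r `^ q = expR (ln r * q) by rewrite /powR gt_eqF// mulrC.
have p1 := plim_gt0 ltr01.
have lo : expR (z%:~R * h * q) * plim 1 <= plim r.
  rewrite -plim_scale_int// mulr1; apply: plim_mono; rewrite ?expR_ge0//.
  by rewrite -[leRHS]lnK// ler_expR.
have hi : plim r <= expR ((z%:~R + 1) * h * q) * plim 1.
  rewrite -[1 in X in _ <= X * _]/(1%:~R) -intrD -plim_scale_int// mulr1.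
  apply: plim_mono; rewrite ?(ltW r0)// intrD.
  by rewrite -[leLHS]lnK// ler_expR.
rewrite rE -!expRD; apply/andP; split.
- rewrite ler_pdivlMr//; apply: le_trans lo; rewrite ler_pM2r// ler_expR.
  by rewrite -mulNr -mulrDl ler_pM2r//; move: zu; rewrite mulrDl mul1r; lra.
- rewrite ler_pdivrMr//; apply: le_trans hi _; rewrite ler_pM2r// ler_expR.
  by rewrite -mulrDl ler_pM2r//; move: zl; rewrite mulrDl mul1r; lra.
Qed.

End PowerSeries.

Section StableMixtures.
Context {R : realType} {n d : nat}.

Lemma cvg_plim_ratio (q r : R) : 0 < q < 1 -> 0 <= r ->
  plim q k.+1%:R^-1 r / plim q k.+1%:R^-1 1 @[k --> \oo] --> r `^ q.
Proof.
move=> q01; have /andP[q0 q1] := q01.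
have h0 (k : nat) : 0 < k.+1%:R^-1 :> R by rewrite invr_gt0.
rewrite le_eqVlt => /orP[/eqP <-|r0].
  rewrite powR0 ?gt_eqF//.
  rewrite (_ : (fun k : nat => _) = fun=> 0); first exact: cvg_cst.
  apply/funext => k; rewrite (_ : plim _ _ 0 = 0) ?mul0r//.
  rewrite /plim (_ : psum _ _ 0 = fun=> 0) ?lim_cst//.
  apply/funext => J; rewrite /psum !big1 ?addr0// => j _;
    by rewrite /pterm mulr0 oppr0 expR0 subrr mulr0.
have hq : (k.+1%:R^-1 * q) @[k --> \oo] --> (0 * q : R).
  by apply: cvgMr_tmp; exact: cvg_harmonic.
rewrite mul0r in hq.
apply: (@squeeze_cvgr _ _ _ _
  (fun k : nat => expR (- (k.+1%:R^-1 * q)) * r `^ q)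
  (fun k : nat => expR (k.+1%:R^-1 * q) * r `^ q)).
- by apply: nearW => k; exact: plim_ratio.
- rewrite -[X in _ --> X]mul1r; apply: cvgMr_tmp.
  rewrite -[X in _ --> X]expR0 -[X in _ --> expR X]oppr0.
  apply: (@continuous_cvg _ _ _ _ _ _ expR); first exact: continuous_expR.
  exact: cvgN hq.
- rewrite -[X in _ --> X]mul1r; apply: cvgMr_tmp.
  rewrite -[X in _ --> X]expR0.
  by apply: (@continuous_cvg _ _ _ _ _ _ expR); first exact: continuous_expR.
Qed.

(** Subordination: along with all exp(-b r), the class contains exp(-r^q). *)
Lemma mixture_power (r : 'M[R]_(n, d) -> R) (q : R) : 0 < q <= 1 ->
  (forall x, 0 <= r x) ->
  (forall b, 0 <= b -> mixture (fun x => expR (- (b * r x)))) ->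
  mixture (fun x => expR (- (r x `^ q))).
Proof.
move=> /andP[q0]; rewrite le_eqVlt => /orP[/eqP->|q1] r0 mr.
  by apply: (mixture_ext (mr 1 ler01)) => x; rewrite mul1r powRr1.
have q01 : 0 < q < 1 by rewrite q0.
apply: (@mixture_lim _ _ _ (fun k x => expR (- (plim q k.+1%:R^-1 (r x) / plim q k.+1%:R^-1 1)))); last first.
  move=> x; apply: (@continuous_cvg _ _ _ _ _ _ expR); first exact: continuous_expR.
  by apply: cvgN; exact: cvg_plim_ratio.
move=> k; set h := k.+1%:R^-1.
have h0 : 0 < h :> R by rewrite invr_gt0.
set c := plim q h 1.
have c0 : 0 < c by exact: plim_gt0.
apply: (@mixture_lim _ _ _ (fun J x => expR (- (psum q h (r x) J / c)))); last first.
  move=> x; apply: (@continuous_cvg _ _ _ _ _ _ expR); first exact: continuous_expR.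
  by apply: cvgN; apply: cvgMr_tmp; exact: psum_cvg.
move=> J; have mt z : mixture (fun x => expR (- (pterm q h (r x) z / c))).
  have w0 : 0 <= expR (- (z * h * q)) / c by rewrite divr_ge0 ?expR_ge0// ltW.
  apply: (mixture_ext (mixture_compound w0 (mr _ (expR_ge0 (z * h))))) => x.
  by congr (expR (- _)); rewrite /pterm mulrAC.
apply: (mixture_ext (mixture_mul
  (mixture_prod (index_enum 'I_J.+1) (fun j : 'I_J.+1 => mt j%:R))
  (mixture_prod (index_enum 'I_J) (fun j : 'I_J => mt (- j.+1%:R))))) => x.
rewrite -!expR_sum -expRD; congr expR.
by rewrite !sumrN -opprD -!mulr_suml -mulrDl.
Qed.

Lemma rank1_form (x u : 'rV[R]_d) :
  (x *m (u^T *m u) *m x^T) 0 0 = (x *m u^T) 0 0 ^+ 2.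
Proof.
rewrite mulmxA -mulmxA -[u *m _]trmxK trmx_mul trmxK; move: (x *m u^T) => X.
by rewrite mxE big_ord1 [X^T _ _]mxE expr2.
Qed.

Lemma mixture_abs_power (i : 'I_n) (u : 'rV[R]_d) (p : R) : 0 < p <= 2 ->
  mixture (fun x : 'M[R]_(n, d) => expR (- `|(row i x *m u^T) 0 0| `^ p)).
Proof.
move=> /andP[p0 p2]; pose r (x : 'M[R]_(n, d)) := (row i x *m u^T) 0 0 ^+ 2.
have rE (x : 'M[R]_(n, d)) :
    \sum_l (row l x *m (if l == i then u^T *m u else 0) *m (row l x)^T) 0 0 = r x.
  rewrite (bigD1 i)//= eqxx big1 ?addr0; last first.
    by move=> l /negbTE ->; rewrite mulmx0 mul0mx mxE.
  exact: rank1_form.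
have psdu (b : R) : 0 <= b -> forall l, psd (b *: (if l == i then u^T *m u else 0)).
  move=> b0 l; case: eqP => _; last by rewrite scaler0; exact: psd0.
  split; first by rewrite linearZ/= trmx_mul trmxK.
  move=> x; rewrite -scalemxAr -scalemxAl mxE mulr_ge0//.
  by rewrite rank1_form sqr_ge0.
have := @mixture_power r (p / 2); rewrite divr_gt0//= ler_pdivrMr// mul1r => H.
apply: (mixture_ext (H p2 _ _)) => [x|b b0|x].
- exact: sqr_ge0.
- apply: (mixture_ext (mixture_gauss (psdu b b0))) => x.
  congr (expR (- _)); rewrite -rE mulr_sumr; apply: eq_bigr => l _.
  by rewrite -scalemxAr -scalemxAl mxE.
- rewrite /r; move: ((row i x *m u^T) 0 0) => y; congr (expR (- _)).
  rewrite -(real_normK (num_real y)) -(powR_mulrn 2 (normr_ge0 y)) -powRrM.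
  by rewrite mulrC divfK.
Qed.

End StableMixtures.

(** * Integrals of powers *)

Lemma cvg_sumr {R : realType} (I : Type) (r : seq I) (u : I -> nat -> R) (l : I -> R) :
  (forall i, u i k @[k --> \oo] --> l i) ->
  \sum_(i <- r) u i k @[k --> \oo] --> \sum_(i <- r) l i.
Proof.
move=> ul; elim: r => [|i r IH].
  rewrite big_nil (_ : (fun k => _) = fun=> 0); first exact: cvg_cst.
  by apply/funext => k; rewrite big_nil.
rewrite big_cons (_ : (fun k => _) = fun k => u i k + \sum_(j <- r) u j k).
  exact: cvgD.
by apply/funext => k; rewrite big_cons.
Qed.

Lemma cvg_powR {R : realType} (u : nat -> R) (l s : R) : 0 < s ->
  (forall k, 0 <= u k) -> u k @[k --> \oo] --> l ->
  u k `^ s @[k --> \oo] --> l `^ s.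
Proof.
move=> s0 u0 ul.
have : 0 <= l.
  rewrite -(cvg_lim _ ul)//; apply: limr_ge; last exact: nearW.
  by apply/cvg_ex; exists l.
rewrite le_eqVlt => /orP[/eqP l0|l0].
  rewrite -l0 powR0 ?gt_eqF//; rewrite -l0 in ul.
  apply/cvgr0Pnorm_lt => e e0.
  have /(cvgr0Pnorm_lt _) /(_ _ (powR_gt0 s^-1 e0)) := ul.
  apply: filterS => k; rewrite !ger0_norm ?powR_ge0// => uk.
  rewrite -[ltRHS]powRr1 ?(ltW e0)// -(mulVf (lt0r_neq0 s0)) powRrM.
  by apply: gt0_ltr_powR; rewrite ?nnegrE ?powR_ge0.
apply: (@continuous_cvg _ _ _ _ _ _ (fun x => x `^ s)) => //.
apply: differentiable_continuous; apply/derivable1_diffP.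
by apply: derivable_powR; rewrite in_itv/= l0.
Qed.

Section FiniteRange.
Context {R : realType} {d : nat} d1 (T : measurableType d1) (mu : {measure set T -> \bar R}).

Lemma finite_range_sum (I : Type) (r : seq I) (s : I -> T -> 'rV[R]_d) :
  (forall i, finite_set (range (s i))) ->
  finite_set (range (fun t => \sum_(i <- r) s i t)).
Proof.
move=> sf; elim: r => [|i r IH].
  apply: (@sub_finite_set _ _ [set 0]); last exact: finite_set1.
  by move=> _ [t _ <-]; rewrite big_nil.
apply: (@sub_finite_set _ _ [set z.1 + z.2 | z in
    range (s i) `*` range (fun t => \sum_(i <- r) s i t)]).
  move=> _ [t _ <-]; rewrite big_cons.
  by exists (s i t, \sum_(i <- r) s i t) => //; split; exists t.
by apply: finite_image; apply: finite_setX.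
Qed.

Lemma integral_finite_range (v : T -> 'rV[R]_d) (f : 'rV[R]_d -> R) (r : seq 'rV[R]_d) :
  (mu setT < +oo)%E -> uniq r -> (forall t, v t \in r) ->
  (forall u, measurable (v @^-1` [set u])) -> (forall u, 0 <= f u) ->
  (\int[mu]_t (f (v t))%:E =
    (\sum_(u <- r) f u * fine (mu (v @^-1` [set u])))%:E)%E.
Proof.
move=> muT ur vr mv f0.
have E t : (f (v t))%:E = (\sum_(u <- r) (f u)%:E * (\1_(v @^-1` [set u]) t)%:E)%E.
  rewrite (bigD1_seq (v t))//= indicE mem_set// mule1 big1 ?adde0// => u uv.
  by rewrite indicE memNset ?mule0//= => /esym/eqP; rewrite (negbTE uv).
under eq_integral do rewrite E.
rewrite ge0_integral_sum//; last 2 first.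
- move=> u; apply: measurable_funeM; apply/measurable_EFinP.
  exact: measurable_indic.
- by move=> u t _; rewrite mule_ge0// lee_fin.
rewrite -sumEFin; apply: eq_bigr => u _.
rewrite ge0_integralZl//; last 2 first.
- by apply/measurable_EFinP; exact: measurable_indic.
- by rewrite lee_fin.
rewrite integral_indic// setIT EFinM fineK// ge0_fin_numE//.
by apply: le_lt_trans muT; apply: le_measure; rewrite ?inE.
Qed.

End FiniteRange.

Section LpMixture.
Context {R : realType} {n d : nat} d1 (T : measurableType d1) (mu : {measure set T -> \bar R}).
Variables (p : R) (s : 'I_d -> T -> R).
Hypothesis p02 : 0 < p <= 2.
Hypothesis mu_lty : (mu setT < +oo)%E.
Hypothesis ms : forall j, measurable_fun setT (s j).
Hypothesis sLp : forall j, (\int[mu]_t (`|s j t| `^ p)%:E < +oo)%E.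

Let p0 : 0 < p. Proof. by have /andP[] := p02. Qed.

Let dot (x : 'rV[R]_d) (y : 'I_d -> R) : R := \sum_j x 0 j * y j.

Let dot_le x (y z : 'I_d -> R) : (forall j, `|y j| <= `|z j|) ->
  `|dot x y| `^ p <= (\sum_j `|x 0 j|) `^ p * \sum_j `|z j| `^ p.
Proof.
move=> yz; set B := \sum_j _.
have B0 : 0 <= B by apply: sumr_ge0 => j _; exact: powR_ge0.
have zB j : `|z j| <= B `^ p^-1.
  rewrite -[leLHS]powRr1// -[1](divff (lt0r_neq0 p0)) powRrM.
  apply: ge0_ler_powR; rewrite ?nnegrE ?powR_ge0 ?invr_ge0 ?(ltW p0)//.
  rewrite /B (bigD1 j)//= lerDl; apply: sumr_ge0 => k _; exact: powR_ge0.
apply: (@le_trans _ _ (((\sum_j `|x 0 j|) * B `^ p^-1) `^ p)).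
  apply: ge0_ler_powR; rewrite ?nnegrE ?mulr_ge0 ?sumr_ge0 ?powR_ge0 ?(ltW p0)//.
  apply: le_trans (ler_norm_sum _ _ _) _; rewrite mulr_suml.
  apply: ler_sum => j _; rewrite normrM ler_wpM2l//.
  exact: le_trans (yz j) (zB j).
rewrite powRM ?sumr_ge0 ?powR_ge0// -powRrM mulVf ?gt_eqF// powRr1//.
Qed.

Let mpos j : measurable_fun setT (EFin \o (s j)^\+).
Proof. by apply/measurable_EFinP; exact: measurable_funrpos. Qed.
Let mneg j : measurable_fun setT (EFin \o (s j)^\-).
Proof. by apply/measurable_EFinP; exact: measurable_funrneg. Qed.

Import HBNNSimple.

(* simple functions that approximate the positive and the negative part of s j *)
Let sp j k : {nnsfun T >-> R} := nnsfun_approx measurableT (mpos j) k.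
Let sn j k : {nnsfun T >-> R} := nnsfun_approx measurableT (mneg j) k.
Let sk k j t : R := sp j k t - sn j k t.

Let sk_cvg j t : sk k j t @[k --> \oo] --> s j t.
Proof.
rewrite -[X in _ --> X](_ : (s j)^\+ t - (s j)^\- t = _); last first.
  by rewrite -[in RHS](funrposBneg (s j)).
apply: cvgB.
- have /fine_cvg : (EFin \o (sp j ^~ t)) k @[k --> \oo] --> ((s j)^\+ t)%:E.
    apply: (cvg_nnsfun_approx measurableT (mpos j)) => // x _.
    by rewrite lee_fin funrpos_ge0.
  by [].
- have /fine_cvg : (EFin \o (sn j ^~ t)) k @[k --> \oo] --> ((s j)^\- t)%:E.
    apply: (cvg_nnsfun_approx measurableT (mneg j)) => // x _.
    by rewrite lee_fin funrneg_ge0.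
  by [].
Qed.

Let sk_le k j t : `|sk k j t| <= `|s j t|.
Proof.
have a1 : 0 <= sp j k t <= (s j)^\+ t.
  rewrite fun_ge0/= /sp nnsfun_approxE -lee_fin.
  by apply: (@le_approx _ _ _ setT (EFin \o (s j)^\+)) => // x _; rewrite lee_fin funrpos_ge0.
have a2 : 0 <= sn j k t <= (s j)^\- t.
  rewrite fun_ge0/= /sn nnsfun_approxE -lee_fin.
  by apply: (@le_approx _ _ _ setT (EFin \o (s j)^\-)) => // x _; rewrite lee_fin funrneg_ge0.
have <- : (s j)^\+ t + (s j)^\- t = `|s j t| by rewrite -[RHS](congr1 (@^~ t) (funrposDneg (s j))).
rewrite ler_norml /sk; move: a1 a2; move: (sp j k t) (sn j k t).
move: ((s j)^\+ t) ((s j)^\- t) => a b x y /andP[? ?] /andP[? ?].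
by apply/andP; split; lra.
Qed.

Let measurable_sk k j : measurable_fun setT (sk k j).
Proof. by apply: measurable_funB => //; exact: measurable_funP. Qed.

(* the approximations as one function with finitely many row vectors as values *)
Let skv k t : 'rV[R]_d := \sum_j sk k j t *: delta_mx 0 j.

Let skvE k t j : skv k t 0 j = sk k j t.
Proof.
rewrite /skv summxE (bigD1 j)//= !mxE !eqxx mulr1 big1 ?addr0// => l lj.
by rewrite !mxE eq_sym (negbTE lj) andbF mulr0.
Qed.

Let measurable_dot x (y : 'I_d -> T -> R) : (forall j, measurable_fun setT (y j)) ->
  measurable_fun setT (fun t => (`|dot x (y ^~ t)| `^ p)%:E).
Proof.
move=> my; apply/measurable_EFinP.
apply: (measurableT_comp (measurable_powR p)); apply: measurableT_comp => //.
by apply: measurable_sum => j; exact: measurable_funM.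
Qed.

(** The exponential of minus the p-th power of an L_p norm.  For simple functions
    the integral is a finite sum of terms |<x_i, u>|^p. *)
Lemma mixture_Lp (i : 'I_n) :
  mixture (fun x : 'M[R]_(n, d) =>
    expR (- fine (\int[mu]_t (`|\sum_j (row i x) 0 j * s j t| `^ p)%:E))).
Proof.
pose f (x u : 'rV[R]_d) : R := `|(x *m u^T) 0 0| `^ p.
have dotE x k t : `|dot x (sk k ^~ t)| `^ p = f x (skv k t).
  congr (`|_| `^ p); rewrite mxE; apply: eq_bigr => j _.
  by rewrite [X in _ = _ * X]mxE skvE.
have fv k : finite_set (range (skv k)).
  apply: finite_range_sum => j.
  have fsk : finite_set (range (sk k j)).
    apply: (@sub_finite_set _ _ [set z.1 - z.2 | z in range (sp j k) `*` range (sn j k)]).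
      by move=> _ [t _ <-]; exists (sp j k t, sn j k t) => //; split; exists t.
    by apply: finite_image; apply: finite_setX; exact: fimfunP.
  apply: (@sub_finite_set _ _ [set a *: (delta_mx 0 j : 'rV[R]_d) | a in range (sk k j)]).
    by move=> _ [t _ <-]; exists (sk k j t) => //; exists t.
  exact: finite_image.
have range_seq k : exists r : seq 'rV[R]_d, uniq r /\ forall t, skv k t \in r.
  have /finite_seqP[r rE] := fv k; exists (undup r); split; first exact: undup_uniq.
  move=> t; rewrite mem_undup; suff : [set` r] (skv k t) by [].
  by rewrite -rE; exists t.
have {range_seq}[r rP] := choice range_seq.
have mv k u : measurable (skv k @^-1` [set u]).
  rewrite (_ : _ @^-1` _ = \bigcap_(j in [set: 'I_d]) (sk k j @^-1` [set u 0 j])).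
    apply: fin_bigcap_measurable => // j _.
    by rewrite -[X in measurable X]setTI; exact: measurable_sk.
  apply/seteqP; split => t /=.
    by move=> <- j _ /=; rewrite skvE.
  by move=> H; apply/rowP => j; rewrite skvE; exact: H.
pose w k u := fine (mu (skv k @^-1` [set u])).
have w0 k u : 0 <= w k u by rewrite fine_ge0.
pose I k x := \sum_(u <- r k) f x u * w k u.
have IE k x : (\int[mu]_t (`|dot x (sk k ^~ t)| `^ p)%:E = (I k x)%:E)%E.
  under eq_integral do rewrite dotE.
  have [ur vr] := rP k.
  by apply: integral_finite_range => // u; exact: powR_ge0.
apply: (@mixture_lim _ _ _ (fun k x => expR (- I k (row i x)))) => [k|x].
  have mu1 u : mixture (fun x : 'M[R]_(n, d) => expR (- (f (row i x) u * w k u))).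
    apply: (mixture_ext (mixture_abs_power i (w k u `^ p^-1 *: u) p02)) => x.
    congr (expR (- _)); rewrite linearZ/= -scalemxAr mxE normrM powRM//.
    by rewrite ger0_norm ?powR_ge0// -powRrM mulVf ?gt_eqF// powRr1// mulrC.
  apply: (mixture_ext (mixture_prod (r k) mu1)) => x.
  by rewrite -expR_sum sumrN.
apply: (@continuous_cvg _ _ _ _ _ _ expR); first exact: continuous_expR.
apply: cvgN; set y := row i x.
pose g t := ((\sum_j `|y 0 j|) `^ p * \sum_j `|s j t| `^ p)%:E.
have gint : mu.-integrable setT g.
  rewrite (_ : g = fun t => (((\sum_j `|y 0 j|) `^ p)%:E * \sum_j (`|s j t| `^ p)%:E)%E); last first.
    by apply/funext => t; rewrite /g EFinM sumEFin.
  apply: integrableZl => //; apply: integrable_sum => // j _.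
  apply/integrableP; split.
    apply/measurable_EFinP; apply: (measurableT_comp (measurable_powR p)).
    exact: measurableT_comp.
  by under eq_integral do rewrite gee0_abs ?lee_fin ?powR_ge0//.
have lim := @dominated_cvg _ _ _ mu setT measurableT
  (fun k t => (`|dot y (sk k ^~ t)| `^ p)%:E) (fun t => (`|dot y (s ^~ t)| `^ p)%:E) g.
have {lim}lim : (\int[mu]_t (`|dot y (sk k ^~ t)| `^ p)%:E)%E @[k --> \oo] -->
    (\int[mu]_t (`|dot y (s ^~ t)| `^ p)%:E)%E.
  apply: lim => [k|t _|t _|//|k t _].
  - by apply: measurable_dot => j; exact: measurable_sk.
  - apply: cvg_EFin; first by apply: nearW.
    apply: cvg_powR => //; apply: cvg_norm.
    by apply: cvg_sumr => j; apply: cvgMl_tmp; exact: sk_cvg.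
  - by [].
  - by rewrite gee0_abs ?lee_fin ?powR_ge0// dot_le// => j; exact: sk_le.
have fin : (\int[mu]_t (`|dot y (s ^~ t)| `^ p)%:E)%E \is a fin_num.
  rewrite ge0_fin_numE; last by apply: integral_ge0 => t _; rewrite lee_fin powR_ge0.
  have /integrableP[_ gfin] := gint; apply: le_lt_trans gfin; apply: ge0_le_integral => //.
  - exact: measurable_dot.
  - by have /integrableP[mg _] := gint; exact: measurableT_comp.
  - move=> t _; rewrite /g gee0_abs; first by rewrite lee_fin dot_le.
    by rewrite lee_fin mulr_ge0 ?powR_ge0// sumr_ge0// => j _; exact: powR_ge0.
have IEy : (fun k => \int[mu]_t (`|dot y (sk k ^~ t)| `^ p)%:E)%E = fun k => (I k y)%:E.
  by apply/funext => k; rewrite IE.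
by move: lim; rewrite IEy -(fineK fin) => /fine_cvg.
Qed.

End LpMixture.

(** * Norms embedded in L_p *)

Section Embedding.
Context {R : realType} {d : nat} (p : R) (K : set 'rV[R]_d).
Hypothesis p02 : 0 < p <= 2.
Hypothesis K_Lp : embeds_isometrically_in_Lp p K.
Local Notation nK := (minkowski_functional K).

Let p0 : 0 < p. Proof. by have /andP[] := p02. Qed.

(** The embedding in terms of the images s_j of the standard basis, linearity
    holding only almost everywhere. *)
Lemma embedding_coordinates : exists s : 'I_d -> measurableTypeR R -> R,
  [/\ forall j, measurable_fun setT (s j),
      forall j, (\int[lebesgue01 R]_t (`|s j t| `^ p)%:E < +oo)%E &
      forall x, (nK x `^ p)%:E =
        (\int[lebesgue01 R]_t (`|\sum_j x 0 j * s j t| `^ p)%:E)%E].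
Proof.
have [S [SL Slin SN]] := K_Lp.
have mS x : measurable_fun setT (S x : measurableTypeR R -> R).
  have := SL x; rewrite inE => /andP[Sm _]; exact: (set_mem Sm).
have NE x : (nK x `^ p)%:E = (\int[lebesgue01 R]_t (`|S x t| `^ p)%:E)%E.
  by rewrite -poweR_EFin -SN poweR_Lnorm// gt_eqF.
have aeF : Filter (nbhs (almost_everywhere (lebesgue01 R))).
  exact: ae_filter_ringOfSetsType.
have S0 : {ae lebesgue01 R, forall t, S 0 t = 0}.
  have := Slin 1 0 0; apply: filterS => t; rewrite scaler0 addr0 mul1r.
  by move=> /(congr1 (fun z => z - S 0 t)); rewrite addrK subrr => <-.
have Ssum (x : 'rV[R]_d) (r : seq 'I_d) : {ae lebesgue01 R, forall t,
    S (\sum_(j <- r) x 0 j *: delta_mx 0 j) t = \sum_(j <- r) x 0 j * S (delta_mx 0 j) t}.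
  elim: r => [|j r IH].
    by rewrite big_nil; move: S0; apply: filterS => t ->; rewrite big_nil.
  rewrite big_cons; move: (Slin (x 0 j) (delta_mx 0 j) (\sum_(j <- r) x 0 j *: delta_mx 0 j)) IH.
  by apply: filterS2 => t -> ->; rewrite big_cons.
exists (fun j => S (delta_mx 0 j)); split=> [j|j|x].
- exact: mS.
- by rewrite -NE ltry.
- rewrite NE; apply: ge0_ae_eq_integral => //.
  + apply/measurable_EFinP; apply: (measurableT_comp (measurable_powR p)).
    exact: measurableT_comp.
  + apply/measurable_EFinP; apply: (measurableT_comp (measurable_powR p)).
    apply: measurableT_comp => //.
    by apply: measurable_sum => j; apply: measurable_funM.
  + have := Ssum x (index_enum 'I_d); apply: filterS => t <- _.
    by rewrite -row_sum_delta.
Qed.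

Lemma lebesgue01_lty : (lebesgue01 R setT < +oo)%E.
Proof.
rewrite (_ : lebesgue01 R setT = lebesgue_measure (setT `&` `[0 : R, 1]%classic))//.
rewrite setTI lebesgue_measure_itv/= lte_fin ltr01.
by rewrite oppr0 adde0 ltry.
Qed.

Lemma mixture_norm n (i : 'I_n) :
  mixture (fun x : 'M[R]_(n, d) => expR (- nK (row i x) `^ p)).
Proof.
have [s [ms sLp sE]] := embedding_coordinates.
apply: (mixture_ext (mixture_Lp p02 lebesgue01_lty ms sLp i)) => x.
by rewrite -sE.
Qed.

Lemma mixture_norms n :
  mixture (fun x : 'M[R]_(n, d) => expR (- \sum_i nK (row i x) `^ p)).
Proof.
apply: (mixture_ext (mixture_prod (index_enum 'I_n) (@mixture_norm n))) => x.
by rewrite -expR_sum sumrN.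
Qed.

Lemma norm_powR_scale (t : R) x : 0 < t -> nK (t *: x) `^ p = t `^ p * nK x `^ p.
Proof.
move=> t0; have [s [ms sLp sE]] := embedding_coordinates.
apply: EFin_inj; rewrite EFinM !sE -ge0_integralZl_EFin//.
- apply: eq_integral => u _; rewrite -EFinM -powRM ?(ltW t0)//.
  rewrite -[in RHS](gtr0_norm t0) -normrM mulr_sumr.
  by congr (`|_| `^ p)%:E; apply: eq_bigr => j _; rewrite mxE mulrA.
- apply/measurable_EFinP; apply: (measurableT_comp (measurable_powR p)).
  apply: measurableT_comp => //.
  by apply: measurable_sum => j; apply: measurable_funM.
- exact: powR_ge0.
Qed.

Lemma minkowski_ge0 (x : 'rV[R]_d) : 0 <= nK x.
Proof.
rewrite /minkowski_functional; set A := [set l | _].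
have [->|/set0P A0] := eqVneq A set0; first by rewrite inf0.
by apply: lb_le_inf => // l [/ltW].
Qed.

End Embedding.

Section Boundedness.
Context {R : realType} {d : nat} (K : set 'rV[R]_d).
Hypothesis K_star : star_body K.

(** The functional of a compact body dominates the coordinates. *)
Lemma minkowski_bound : exists2 M : R, 0 <= M &
  forall (x : 'rV[R]_d) j, `|x 0 j| <= M * minkowski_functional K x.
Proof.
have [Kc _ Kf _] := K_star.
have /compact_bounded := Kc. case=> M0 [_ HM].
pose M := Num.max 0 M0 + 1.
have M_ge0 : 0 <= M by rewrite addr_ge0// le_max lexx.
have KM (y : 'rV[R]_d) : K y -> `|y| <= M.
  by move=> Ky; apply: (HM M) => //; rewrite ltr_pwDr// le_max lexx orbT.
exists M => // x j; apply/ler_addgt0Pr => e e0.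
have e' : 0 < e / (M + 1) by rewrite divr_gt0// ltr_wpDl.
have [l0 l00 Kl0] := Kf x.
have hi : has_inf [set l : R | 0 < l /\ dilate l K x].
  by split; [exists l0|exists 0 => l [/ltW]].
have [l [l_gt0 [y Ky yx]] lt] := inf_adherent e' hi.
apply: (@le_trans _ _ (l * M)).
  rewrite -yx mxE normrM gtr0_norm// ler_pM2l//.
  apply: le_trans (KM _ Ky); rewrite [`|y|](_ : _ = mx_norm (y : 'rV[R]_d))// mx_normrE.
  exact: (le_bigmax 0 (fun ij : 'I_1 * 'I_d => `|y ij.1 ij.2|) (0, j)).
rewrite [leLHS]mulrC; apply: (@le_trans _ _ (M * (minkowski_functional K x + e / (M + 1)))).
  by apply: ler_wpM2l => //; exact: (ltW lt).
rewrite mulrDr lerD2l mulrCA ler_piMr ?(ltW e0)//.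
by rewrite ler_pdivrMr ?mul1r ?lerDl// ltr_wpDl.
Qed.

End Boundedness.

(** * Integrals of exponentials of homogeneous functions *)

Section LayerCake.
Context {R : realType} {m : nat}.
Local Notation mu := (@hmu R m).
Local Notation V := 'rV[R]_m.

Section Kappa.
Variables (p h : R).
Hypotheses (p0 : 0 < p) (h0 : 0 < h).

(** The weights of the step function sum_j layer_j 1_{N <= (j+1)h}, which equals
    e^{-kh} where kh < N <= (k+1)h, and 1 where N = 0. *)
Definition layer (j : nat) : R := expR (- (j%:R * h)) - expR (- (j.+1%:R * h)).

(** The integral of this step function relative to the measure of {N <= 1}. *)
Definition kappa : \bar R :=
  (\sum_(j <oo) (layer j * (j.+1%:R * h) `^ (m%:R / p))%:E)%E.

Lemma layer_gt0 j : 0 < layer j.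
Proof. by rewrite subr_gt0 ltr_expR ltrN2 ltr_pM2r// ltr_nat. Qed.

Let term_ge0 j : 0 <= layer j * (j.+1%:R * h) `^ (m%:R / p).
Proof. by rewrite mulr_ge0 ?powR_ge0// ltW// layer_gt0. Qed.

Lemma kappa_gt0 : (0 < kappa)%E.
Proof.
rewrite /kappa nneseries_recl//; last by move=> *; rewrite lee_fin.
apply: (@lt_le_trans _ _ (layer 0 * (1%:R * h) `^ (m%:R / p))%:E).
  by rewrite lte_fin mulr_gt0 ?layer_gt0// powR_gt0// mul1r.
by rewrite leeDl// nneseries_ge0// => *; rewrite lee_fin.
Qed.

Lemma powR_le_expR (s t : R) : 0 <= s -> 0 < t ->
  t `^ s <= (2 * (s + 1)) `^ s * expR (t / 2).
Proof.
move=> s0 t0; have a0 : 0 < 2 * (s + 1) by rewrite mulr_gt0// ltr_wpDl.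
apply: (@le_trans _ _ ((2 * (s + 1) * expR (t / (2 * (s + 1)))) `^ s)).
  apply: ge0_ler_powR; rewrite ?nnegrE ?(ltW t0) ?mulr_ge0 ?expR_ge0 ?addr_ge0//.
  rewrite -ler_pdivrMl// mulrC; apply: le_trans (expR_ge1Dx _).
  by rewrite lerDr.
rewrite powRM ?expR_ge0 ?(ltW a0)// -expRM; apply: ler_wpM2l; first exact: powR_ge0.
have s1 : 0 < s + 1 by rewrite ltr_wpDl.
rewrite ler_expR (_ : _ * s = t / 2 * (s / (s + 1))); last by field; rewrite gt_eqF.
rewrite ler_piMr ?divr_ge0 ?(ltW t0)//.
by rewrite ler_pdivrMr// mul1r lerDl.
Qed.

Lemma kappa_lty : (kappa < +oo)%E.
Proof.
pose s : R := m%:R / p; have s0 : 0 <= s by rewrite divr_ge0// ltW.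
pose C := (2 * (s + 1)) `^ s * expR (h / 2); pose r := expR (- (h / 2)).
have C0 : 0 <= C by rewrite mulr_ge0 ?powR_ge0 ?expR_ge0.
have r01 : 0 <= r < 1 by rewrite expR_ge0/= expR_lt1 oppr_lt0 divr_gt0.
apply: (@le_lt_trans _ _ (C * (1 - r)^-1)%:E); last exact: ltry.
apply: lime_le; first by apply: is_cvg_nneseries => *; rewrite lee_fin.
apply: nearW => N; rewrite sumEFin lee_fin big_mkord.
apply: (@le_trans _ _ (\sum_(j < N) C * r ^+ j)); last first.
  by rewrite -mulr_sumr ler_wpM2l// geometric_sum_le.
apply: ler_sum => j _.
apply: (@le_trans _ _ (expR (- (j%:R * h)) * ((2 * (s + 1)) `^ s * expR (j.+1%:R * h / 2)))).
  apply: ler_pM; rewrite ?powR_ge0// ?(ltW (layer_gt0 _))//.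
    by rewrite gerBl expR_ge0.
  by apply: powR_le_expR => //; rewrite mulr_gt0.
rewrite mulrCA /C -[leRHS]mulrA ler_wpM2l ?powR_ge0// -expRM_natr -!expRD ler_expR.
by rewrite -natr1; lra.
Qed.

End Kappa.

Variables (p : R) (N : V -> R).
Hypotheses (p0 : 0 < p) (N0 : forall y, 0 <= N y) (mN : measurable_fun setT N).
Hypothesis NZ : forall t y, 0 < t -> N (t *: y) = t `^ p * N y.

Let sub s := [set y | N y <= s].

Let measurable_sub s : measurable (sub s).
Proof.
have /(_ measurableT `]-oo, s]%classic (measurable_itv _)) := mN.
by rewrite setTI; congr measurable; apply/seteqP; split => x /=; rewrite in_itv.
Qed.

(** {N <= s} is the dilate of {N <= 1} by s^(1/p). *)
Lemma hmu_sublevel s : 0 < s -> mu (sub s) = ((s `^ (m%:R / p))%:E * mu (sub 1%R))%E.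
Proof.
move=> s0; pose t := s `^ p^-1; have t0 : 0 < t by rewrite powR_gt0.
have -> : s `^ (m%:R / p) = t ^+ m.
  by rewrite /t -powR_mulrn ?powR_ge0// -powRrM mulrC.
rewrite -[RHS](hausdorff_preZ m _ t0); congr (mu _); apply/seteqP; split.
- move=> y /= Ny; exists (t^-1 *: y); last by rewrite scalerA mulfV ?gt_eqF// scale1r.
  have tp : t `^ p = s by rewrite /t -powRrM mulVf ?gt_eqF// powRr1// ltW.
  have := NZ (t^-1 *: y) t0; rewrite scalerA mulfV ?gt_eqF// scale1r tp => Ey.
  have Hle : s * N (t^-1 *: y) <= N y.
    by rewrite le_eqVlt; apply/orP; left; apply/eqP; exact: esym Ey.
  suff : N (t^-1 *: y) <= 1 by [].
  by rewrite -(ler_pM2l s0) mulr1; exact: le_trans Hle Ny.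
- move=> _ [y Ny <-]; suff : N (t *: y) <= s by [].
  have {}Ny : N y <= 1 := Ny; rewrite NZ// /t -powRrM mulVf ?gt_eqF// powRr1 ?(ltW s0)//.
  by rewrite ler_piMr// ltW.
Qed.

Hypothesis mu_lty : (mu (sub 1%R) < +oo)%E.
Variable h : R.
Hypothesis h0 : 0 < h.

Let step (y : V) : \bar R :=
  (\sum_(j <oo) ((layer h j)%:E * (\1_(sub (j.+1%:R * h)) y)%:E))%E.

Let term_ge0 j y : (0 <= (layer h j)%:E * (\1_(sub (j.+1%:R * h)) y)%:E)%E.
Proof. by rewrite mule_ge0// lee_fin// ltW// layer_gt0. Qed.

Let measurable_term j :
  measurable_fun setT (fun y => ((layer h j)%:E * (\1_(sub (j.+1%:R * h)) y)%:E)%E).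
Proof.
apply: measurable_funeM; apply/measurable_EFinP; apply: measurable_indic.
exact: measurable_sub.
Qed.

Let integral_step : (\int[mu]_y step y = mu (sub 1%R) * kappa p h)%E.
Proof.
rewrite integral_nneseries//.
have mu_fin : mu (sub 1) \is a fin_num by rewrite ge0_fin_numE.
rewrite -(fineK mu_fin) -nneseriesZl; last first.
  by move=> j _; rewrite lee_fin mulr_ge0 ?powR_ge0// ltW// layer_gt0.
apply: eq_eseriesr => j _; rewrite ge0_integralZl_EFin//; last 2 first.
- by apply/measurable_EFinP; apply: measurable_indic.
- exact: ltW (layer_gt0 _ _).
rewrite integral_indic// setIT; have jh : 0 < j.+1%:R * h by rewrite mulr_gt0.
by rewrite [X in (_ * X)%E = _](hmu_sublevel jh) EFinM muleA [RHS]muleC fineK.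
Qed.

Let stepE y : exists k : nat, [/\ k%:R * h <= N y, N y <= k.+1%:R * h &
  step y = (expR (- (k%:R * h)))%:E].
Proof.
have ex : exists k : nat, N y <= k.+1%:R * h.
  exists (Num.truncn (N y / h)); rewrite -ler_pdivrMr//.
  exact/ltW/truncnS_gt.
have [k kN kmin] := find_ex_minn ex; exists k; split=> //.
  case: k kN kmin => [|k] kN kmin; first by rewrite mul0r.
  rewrite leNgt; apply/negP => /ltW /kmin; by rewrite ltnn.
have small j : (j < k)%N -> ((layer h j)%:E * (\1_(sub (j.+1%:R * h)) y)%:E = 0)%E.
  move=> jk; rewrite indicE memNset ?mule0//= => /kmin; by rewrite leqNgt jk.
have big j : (k <= j)%N -> ((layer h j)%:E * (\1_(sub (j.+1%:R * h)) y)%:E = (layer h j)%:E)%E.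
  move=> kj; rewrite indicE mem_set ?mule1//=; apply: le_trans kN _.
  by rewrite ler_pM2r// ler_nat.
rewrite /step; apply/cvg_lim => //.
rewrite -(cvg_shiftn k)/=.
have E n : (\sum_(0 <= j < n + k) ((layer h j)%:E * (\1_(sub (j.+1%:R * h)) y)%:E) =
    (expR (- (k%:R * h)) - expR (- ((n + k)%:R * h)))%:E)%E.
  rewrite (big_cat_nat _ (n := k)) ?leq_addl//= big1_seq ?add0e; last first.
    by move=> j; rewrite mem_index_iota => /andP[_ /andP[_ jk]]; exact: small.
  rewrite (eq_big_nat _ _ (F2 := fun j => (layer h j)%:E)); last first.
    by move=> j /andP[kj _]; exact: big.
  rewrite sumEFin -[in RHS]opprB -(telescope_sumr (fun j : nat => expR (- (j%:R * h)))) ?leq_addl//.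
  by rewrite -sumrN; congr EFin; apply: eq_bigr => j _; rewrite opprB.
under eq_fun do rewrite E.
apply: cvg_EFin; first exact: nearW.
rewrite -[X in _ --> X]subr0; apply: cvgB; first exact: cvg_cst.
rewrite (cvg_shiftn k (fun n => expR (- (n%:R * h)))).
have r01 : `|expR (- h)| < 1 by rewrite ger0_norm ?expR_ge0// expR_lt1 oppr_lt0.
rewrite (_ : (fun n : nat => _) = GRing.exp (expR (- h))); first exact: cvg_expr.
by apply/funext => n; rewrite -expRM_natr mulNr mulrC.
Qed.

Let measurable_expN : measurable_fun setT (fun y => (expR (- N y))%:E).
Proof.
apply/measurable_EFinP; apply: measurableT_comp; first exact: measurable_expR.
by apply: measurableT_comp mN; exact: oppr_measurable.
Qed.

Let measurable_step : measurable_fun setT step.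
Proof.
rewrite (_ : step = fun y => (\sum_(j <oo | j \in xpredT)
    ((layer h j)%:E * (\1_(sub (j.+1%:R * h)) y)%:E))%E).
  apply: ge0_emeasurable_sum => [j y _ _|j _]; first exact: term_ge0.
  exact: measurable_term.
by apply/funext => y; apply: eq_eseriesl.
Qed.

Let step_ge0 y : (0 <= step y)%E.
Proof. by apply: nneseries_ge0 => j _ _; exact: term_ge0. Qed.

Lemma layer_cake_upper : (\int[mu]_y (expR (- N y))%:E <= mu (sub 1%R) * kappa p h)%E.
Proof.
rewrite -integral_step; apply: ge0_le_integral => //.
- move=> y _; have [k [kN _ ->]] := stepE y.
  by rewrite lee_fin ler_expR lerN2.
Qed.

Lemma layer_cake_lower :
  ((expR (- h))%:E * (mu (sub 1%R) * kappa p h) <= \int[mu]_y (expR (- N y))%:E)%E.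
Proof.
rewrite -integral_step -ge0_integralZl_EFin ?expR_ge0//.
apply: ge0_le_integral => //.
- by move=> y _; rewrite mule_ge0 ?lee_fin ?expR_ge0// step_ge0.
- exact: measurable_funeM.
- move=> y _; have [k [_ kN ->]] := stepE y.
  rewrite -EFinM lee_fin -expRD ler_expR; move: kN; rewrite -natr1 mulrDl mul1r; lra.
Qed.

End LayerCake.

(** * Log-convexity of the integrals over the subspaces *)

Section Hoelder.
Context {R : realType}.

Lemma weighted_amgm (s t l : R) : 0 <= s -> 0 <= t -> 0 < l < 1 ->
  s `^ l * t `^ (1 - l) <= l * s + (1 - l) * t.
Proof.
move=> s0 t0 /andP[l0 l1]; have l1' : 0 < 1 - l by rewrite subr_gt0.
have := @conjugate_powR _ (s `^ l) (t `^ (1 - l)) l^-1 (1 - l)^-1.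
rewrite !powR_ge0 !invr_gt0 l0 l1' !invrK addrC subrK => /(_ isT isT isT isT erefl).
by rewrite -!powRrM !mulfV ?gt_eqF// !powRr1// (mulrC s) (mulrC t).
Qed.

(** Hoelder's inequality for two terms. *)
Lemma hoelder2 (p1 p2 q1 q2 l : R) : 0 <= p1 -> 0 <= p2 -> 0 <= q1 -> 0 <= q2 -> 0 < l < 1 ->
  p1 `^ l * q1 `^ (1 - l) + p2 `^ l * q2 `^ (1 - l) <=
  (p1 + p2) `^ l * (q1 + q2) `^ (1 - l).
Proof.
move=> p10 p20 q10 q20 l01; have /andP[l0 l1] := l01.
have l1' : 0 < 1 - l by rewrite subr_gt0.
have [P0|P0] := eqVneq (p1 + p2) 0.
  have p1E : p1 = 0 by lra.
  have p2E : p2 = 0 by lra.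
  by rewrite p1E p2E !powR0 ?gt_eqF// !mul0r addr0 powR0 ?gt_eqF// mul0r.
have [Q0|Q0] := eqVneq (q1 + q2) 0.
  have q1E : q1 = 0 by lra.
  have q2E : q2 = 0 by lra.
  by rewrite q1E q2E addr0 !powR0 ?gt_eqF// !mulr0 addr0.
have P_gt0 : 0 < p1 + p2 by rewrite lt_neqAle eq_sym P0 addr_ge0.
have Q_gt0 : 0 < q1 + q2 by rewrite lt_neqAle eq_sym Q0 addr_ge0.
have [P EP] : exists P, P = p1 + p2 by exists (p1 + p2).
have [Q EQ] : exists Q, Q = q1 + q2 by exists (q1 + q2).
rewrite -EP -EQ in P_gt0 Q_gt0 *.
have step a b : 0 <= a -> 0 <= b -> a `^ l * b `^ (1 - l) <=
    (P `^ l * Q `^ (1 - l)) * (l * (a / P) + (1 - l) * (b / Q)).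
  move=> a0 b0; have aP : 0 <= a / P by rewrite divr_ge0// ltW.
  have bQ : 0 <= b / Q by rewrite divr_ge0// ltW.
  apply: (@le_trans _ _ ((P `^ l * Q `^ (1 - l)) * ((a / P) `^ l * (b / Q) `^ (1 - l)))).
    rewrite mulrACA -!powRM ?(ltW P_gt0) ?(ltW Q_gt0)//.
    by rewrite (mulrC P) (mulrC Q) !divfK ?gt_eqF.
  by rewrite ler_wpM2l ?mulr_ge0 ?powR_ge0// weighted_amgm.
apply: le_trans (lerD (step _ _ p10 q10) (step _ _ p20 q20)) _.
rewrite -mulrDr -[leRHS]mulr1 ler_wpM2l ?mulr_ge0 ?powR_ge0//.
by rewrite addrACA -!mulrDr -!mulrDl -EP -EQ !divff ?gt_eqF//; lra.
Qed.

Lemma powR_mul_split (c s t l : R) : 0 <= c -> 0 <= s -> 0 <= t ->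
  (c * s) `^ l * (c * t) `^ (1 - l) = c * (s `^ l * t `^ (1 - l)).
Proof.
move=> c0 s0 t0; rewrite !powRM// mulrACA; congr (_ * _).
rewrite -powRD; last by rewrite addrC subrK oner_eq0.
by rewrite [l + _]addrC subrK powRr1.
Qed.

End Hoelder.

Section Slices.
Context {R : realType} {n k d : nat}.
Local Notation m := (k * d)%N.
Local Notation mu := (@hmu R m).
Implicit Types (V : 'M[R]_(n, k)) (F : 'M[R]_(n, d) -> R).

Lemma pd_psd_scalar p (A : 'M[R]_p) (e : R) : 0 < e -> psd A -> pd (A + e%:M).
Proof.
move=> e0 [AT A0]; split; first by rewrite linearD/= AT tr_scalar_mx.
move=> x x0; rewrite mulmxDr mulmxDl mxE ltr_wpDl//.
rewrite mul_mx_scalar -scalemxAl mxE mulr_gt0//.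
rewrite mxE lt_neqAle sumr_ge0 ?andbT => [|j _]; last by rewrite mxE -expr2 sqr_ge0.
rewrite eq_sym; apply: contra_neq x0 => /eqP; rewrite psumr_eq0 => [/allP H|j _].
  by apply/rowP => j; have := H j (mem_index_enum j); rewrite /= !mxE mulf_eq0 orbb => /eqP.
by rewrite mxE -expr2 sqr_ge0.
Qed.

Lemma measurable_form (M : 'M[R]_m) :
  measurable_fun setT (fun y : 'rV[R]_m => (y *m M *m y^T) 0 0).
Proof.
rewrite (_ : (fun _ => _) = fun y : 'rV[R]_m => \sum_j (y *m M) 0 j * y 0 j); last first.
  by apply/funext => y; rewrite mxE; apply: eq_bigr => j _; rewrite [X in _ * X = _]mxE.
apply: measurable_sum => j; apply: measurable_funM; last exact: measurable_coordinate.
exact: (measurableT_comp (measurable_coordinate j) (measurable_mulmxr M)).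
Qed.

Lemma measurable_mixture V F : mixture F ->
  measurable_fun setT (fun y : 'rV[R]_m => F (V *m vec_mx y)).
Proof.
elim=> [A pA|{}F G a b a0 b0 ab _ mF _ mG|f {}F _ mf fF].
- under eq_fun do rewrite -block_formE.
  apply: measurableT_comp; first exact: measurable_expR.
  by apply: measurableT_comp (measurable_form _); exact: oppr_measurable.
- by apply: measurable_funD; apply: measurable_funM.
- apply: (measurable_fun_cvg mf) => y _; exact: fF.
Qed.

Lemma sqnormE (y : 'rV[R]_m) : sqnorm y = (y *m y^T) 0 0.
Proof. by rewrite mxE; apply: eq_bigr => j _; rewrite [X in _ * X]mxE expr2. Qed.

(** The integral of F over the n x d matrices whose columns lie in the range of
    V, damped by a Gaussian. *)
Definition damped (e : R) V F : \bar R :=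
  (\int[mu]_y (F (V *m vec_mx y) * expR (- (e * sqnorm y)))%:E)%E.

Lemma block_form_scalar V (e : R) : V^T *m V = 1%:M ->
  block_form V (fun=> e%:M : 'M[R]_d) = e%:M.
Proof.
move=> VV; apply: mulmx_ext => u; rewrite mul_block_form.
rewrite (_ : rowmul _ _ = e *: (V *m vec_mx u)); last first.
  by apply/row_matrixP => i; rewrite row_rowmul mul_mx_scalar linearZ.
by rewrite -scalemxAr mulmxA VV mul1mx linearZ/= vec_mxK mul_mx_scalar.
Qed.

Lemma measurable_damped e V F : mixture F ->
  measurable_fun setT (fun y : 'rV[R]_m => (F (V *m vec_mx y) * expR (- (e * sqnorm y)))%:E).
Proof.
move=> mF; apply/measurable_EFinP; apply: measurable_funM; first exact: measurable_mixture.
apply: measurableT_comp; first exact: measurable_expR.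
apply: measurableT_comp; first exact: oppr_measurable.
by apply: measurable_funM => //; exact: measurable_sqnorm.
Qed.

Variable E : R.
Hypotheses (E0 : 0 < E) (gaussE : (\int[mu]_x gauss x = E%:E)%E).

Lemma damped_gauss_fin e : 0 < e ->
  (\int[mu]_y (expR (- (e * sqnorm y)))%:E < +oo)%E.
Proof.
move=> e0; have pde : pd (e%:M : 'M[R]_m) by rewrite -[e%:M]add0r; apply: pd_psd_scalar => //; exact: psd0.
have := integral_gauss_form E0 gaussE pde.
under eq_integral do rewrite mul_mx_scalar -scalemxAl mxE -sqnormE.
by move=> ->; rewrite ltry.
Qed.

Lemma damped_fin e V F : 0 < e -> mixture F ->
  (0 <= damped e V F < +oo)%E.
Proof.
move=> e0 mF; apply/andP; split.
  apply: integral_ge0 => y _; rewrite lee_fin mulr_ge0 ?expR_ge0//.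
  by have /andP[] := mixture_bounds (V *m vec_mx y) mF.
apply: le_lt_trans (damped_gauss_fin e0); apply: ge0_le_integral => //.
- move=> y _; rewrite lee_fin mulr_ge0 ?expR_ge0//.
  by have /andP[] := mixture_bounds (V *m vec_mx y) mF.
- exact: measurable_damped.
- have := measurable_damped e V (@mixture1 R n d).
  by congr measurable_fun; apply/funext => y; rewrite mul1r.
- move=> y _; rewrite lee_fin ler_piMl ?expR_ge0//.
  by have /andP[] := mixture_bounds (V *m vec_mx y) mF.
Qed.

(** An orthonormal basis, as columns of V, of the orthogonal complement of a
    unit vector b with squared entries a (when n = k + 1). *)
Definition frame (a : 'rV[R]_n) V : Prop :=
  exists b : 'cV[R]_n, [/\ V^T *m V = 1%:M, V^T *m b = 0, b^T *m b = 1%:M &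
    forall i, b i 0 ^+ 2 = a 0 i].

Lemma damped_gaussian e V a (A : 'I_n -> 'M[R]_d) : n = k.+1 -> 0 < e -> frame a V ->
  (forall i, psd (A i)) ->
  damped e V (fun x => expR (- \sum_i (row i x *m A i *m (row i x)^T) 0 0)) =
  (E / Num.sqrt (\det (block_form 1%:M (fun i => A i + e%:M)) *
    \det (\sum_i a 0 i *: invmx (A i + e%:M))))%:E.
Proof.
move=> nk e0 [b [VV Vb bb ba]] pA.
have pA' i : pd (A i + e%:M) by exact: pd_psd_scalar.
rewrite -(eq_bigr _ (fun i _ => congr1 (fun c => c *: invmx (A i + e%:M)) (ba i))).
rewrite -(det_block_form nk VV Vb bb pA').
rewrite -(integral_gauss_form E0 gaussE (pd_block_form VV pA')).
rewrite /damped; apply: eq_integral => y _; rewrite -expRD -opprD.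
congr (expR (- _))%:E; rewrite block_formE.
under [RHS]eq_bigr do rewrite mulmxDr mulmxDl mxE.
rewrite big_split/= -block_formE; congr (_ + _); rewrite -block_formE.
by rewrite block_form_scalar// mul_mx_scalar -scalemxAl mxE sqnormE.
Qed.

Lemma damped_lim e V (f : nat -> 'M[R]_(n, d) -> R) F : 0 < e ->
  (forall j, mixture (f j)) -> mixture F -> (forall x, f j x @[j --> \oo] --> F x) ->
  fine (damped e V (f j)) @[j --> \oo] --> fine (damped e V F).
Proof.
move=> e0 mf mF fF; apply: fine_cvg; rewrite fineK; last first.
  by rewrite fin_real//; have /andP[/(lt_le_trans _) ->] := damped_fin V e0 mF.
have lim := @dominated_cvg _ _ _ mu setT measurableT
  (fun j y => (f j (V *m vec_mx y) * expR (- (e * sqnorm y)))%:E)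
  (fun y => (F (V *m vec_mx y) * expR (- (e * sqnorm y)))%:E)
  (fun y => (expR (- (e * sqnorm y)))%:E).
apply: lim => [j|y _|y _||j y _].
- exact: measurable_damped.
- apply: cvg_EFin; first exact: nearW.
  by apply: cvgMr_tmp; exact: fF.
- by [].
- apply/integrableP; split.
    have := measurable_damped e V (@mixture1 R n d).
    by congr measurable_fun; apply/funext => y; rewrite mul1r.
  under eq_integral do rewrite gee0_abs ?lee_fin ?expR_ge0//.
  exact: damped_gauss_fin.
- have /andP[f0 f1] := mixture_bounds (V *m vec_mx y) (mf j).
  rewrite abse_EFin lee_fin ger0_norm ?mulr_ge0 ?expR_ge0//.
  by rewrite ler_piMl ?expR_ge0.
Qed.

Lemma damped_comb e V F G a b : 0 < e -> 0 <= a -> 0 <= b -> mixture F -> mixture G ->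
  fine (damped e V (fun x => a * F x + b * G x)) =
  a * fine (damped e V F) + b * fine (damped e V G).
Proof.
move=> e0 a0 b0 mF mG.
have I0 H y : mixture H -> (0 <= (H (V *m vec_mx y) * expR (- (e * sqnorm y)))%:E)%E.
  move=> mH; rewrite lee_fin mulr_ge0 ?expR_ge0//.
  by have /andP[] := mixture_bounds (V *m vec_mx y) mH.
have fin H : mixture H -> damped e V H \is a fin_num.
  by move=> mH; rewrite fin_real//; have /andP[/(lt_le_trans _) ->] := damped_fin V e0 mH.
have -> : damped e V (fun x => a * F x + b * G x) =
    (a%:E * damped e V F + b%:E * damped e V G)%E.
  rewrite /damped -!ge0_integralZl_EFin//; first last.
  - exact: measurable_damped.
  - by move=> y _; exact: I0.
  - exact: measurable_damped.
  - by move=> y _; exact: I0.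
  rewrite -ge0_integralD//.
  - by apply: eq_integral => y _; rewrite mulrDl EFinD !EFinM !muleA.
  - by move=> y _; rewrite mule_ge0// I0.
  - by apply: measurable_funeM; exact: measurable_damped.
  - by move=> y _; rewrite mule_ge0// I0.
  - by apply: measurable_funeM; exact: measurable_damped.
by rewrite fineD ?fin_numM ?fin// !fineM ?fin.
Qed.

Lemma damped_log_convex e (x y : 'rV[R]_n) (l : R) (Vx Vy Vz : 'M[R]_(n, k)) F :
  n = k.+1 -> 0 < e -> 0 < l < 1 -> std_simplex x -> std_simplex y ->
  frame x Vx -> frame y Vy -> frame (l *: x + (1 - l) *: y) Vz -> mixture F ->
  fine (damped e Vz F) <= fine (damped e Vx F) `^ l * fine (damped e Vy F) `^ (1 - l).
Proof.
move=> nk e0 l01 sx sy fx fy fz.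
have [l0 l1] : 0 < l /\ 0 < 1 - l by have /andP[? ?] := l01; rewrite subr_gt0.
have J0 V G : mixture G -> 0 <= fine (damped e V G).
  by move=> mG; rewrite fine_ge0//; have /andP[] := damped_fin V e0 mG.
elim=> [A pA|{}F G a b a0 b0 ab mF IF mG IG|f {}F mf IH fF].
- rewrite (damped_gaussian nk e0 fx pA) (damped_gaussian nk e0 fy pA) (damped_gaussian nk e0 fz pA)/=.
  pose B i := invmx (A i + e%:M).
  have pB i : pd (B i) by apply/pd_inv/pd_psd_scalar.
  have pI : pd (block_form 1%:M (fun i => A i + e%:M)).
    by apply: pd_block_form => [|i]; [rewrite trmx1 mulmx1|exact: pd_psd_scalar].
  have c0 := pd_det_gt0 pI.
  have -> : \sum_i (l *: x + (1 - l) *: y) 0 i *: invmx (A i + e%:M) =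
      l *: (\sum_i x 0 i *: B i) + (1 - l) *: (\sum_i y 0 i *: B i).
    rewrite !scaler_sumr -big_split/=; apply: eq_bigr => i _.
    by rewrite !scalerA -scalerDl; congr (_ *: _); rewrite !mxE.
  have H := inv_sqrt_det_log_convex c0 (pd_simplex_sum sx pB) (pd_simplex_sum sy pB) l01.
  rewrite powR_mul_split ?invr_ge0 ?sqrtr_ge0 ?(ltW E0)//.
  by rewrite ler_pM2l.
- rewrite !(damped_comb _ e0 a0 b0 mF mG).
  apply: (@le_trans _ _ (a * (fine (damped e Vx F) `^ l * fine (damped e Vy F) `^ (1 - l)) +
      b * (fine (damped e Vx G) `^ l * fine (damped e Vy G) `^ (1 - l)))).
    exact: (lerD (ler_wpM2l a0 IF) (ler_wpM2l b0 IG)).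
  rewrite -(powR_mul_split l a0 (J0 _ _ mF) (J0 _ _ mF)) -(powR_mul_split l b0 (J0 _ _ mG) (J0 _ _ mG)).
  exact: hoelder2 (mulr_ge0 a0 (J0 _ _ mF)) (mulr_ge0 b0 (J0 _ _ mG))
    (mulr_ge0 a0 (J0 _ _ mF)) (mulr_ge0 b0 (J0 _ _ mG)) l01.
- have mF : mixture F by exact: mixture_lim fF.
  have cz := damped_lim (V := Vz) e0 mf mF fF.
  have cx := damped_lim (V := Vx) e0 mf mF fF.
  have cy := damped_lim (V := Vy) e0 mf mF fF.
  have cxy := cvgM (cvg_powR l0 (fun j => J0 Vx _ (mf j)) cx)
                   (cvg_powR l1 (fun j => J0 Vy _ (mf j)) cy).
  apply: (ler_cvg_to cz (cxy _)).
  exact: nearW.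
Qed.

End Slices.

Section Undamped.
Context {R : realType} {n k d : nat}.
Local Notation m := (k * d)%N.
Local Notation mu := (@hmu R m).

Lemma damped_cvg (V : 'M[R]_(n, k)) (F : 'M[R]_(n, d) -> R) : mixture F ->
  (\int[mu]_y (F (V *m vec_mx y))%:E < +oo)%E ->
  fine (damped j.+1%:R^-1 V F) @[j --> \oo] --> fine (\int[mu]_y (F (V *m vec_mx y))%:E).
Proof.
move=> mF IF; have F01 := fun y => mixture_bounds (V *m vec_mx y) mF.
have F0 y : (0 <= (F (V *m vec_mx y))%:E)%E by rewrite lee_fin; have /andP[] := F01 y.
have mFV : measurable_fun setT (fun y : 'rV[R]_m => (F (V *m vec_mx y))%:E).
  by apply/measurable_EFinP; exact: measurable_mixture.
apply: fine_cvg; rewrite fineK; last first.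
  by rewrite ge0_fin_numE//; apply: integral_ge0.
have lim := @dominated_cvg _ _ _ mu setT measurableT
  (fun j y => (F (V *m vec_mx y) * expR (- (j.+1%:R^-1 * sqnorm y)))%:E)
  (fun y => (F (V *m vec_mx y))%:E) (fun y => (F (V *m vec_mx y))%:E).
apply: lim => [j|y _|y _||j y _].
- exact: measurable_damped.
- apply: cvg_EFin; first exact: nearW.
  have e_cvg : j.+1%:R^-1 * sqnorm y @[j --> \oo] --> (0 : R).
    by rewrite -[X in _ --> X](mul0r (sqnorm y)); apply: cvgMr_tmp; exact: cvg_harmonic.
  have : expR (- (j.+1%:R^-1 * sqnorm y)) @[j --> \oo] --> expR (- (0 : R)).
    by apply: continuous_cvg; [exact: continuous_expR|exact: cvgN].
  rewrite oppr0 expR0 => e1; rewrite -[X in _ --> X]mulr1.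
  exact: cvgMl_tmp.
- by [].
- apply/integrableP; split => //.
  by under eq_integral do rewrite gee0_abs//.
- have /andP[f0 f1] := F01 y.
  rewrite abse_EFin lee_fin ger0_norm ?mulr_ge0 ?expR_ge0// ler_piMr//.
  rewrite -expR0 ler_expR oppr_le0 mulr_ge0 ?invr_ge0// sumr_ge0// => i _.
  exact: sqr_ge0.
Qed.

Variable E : R.
Hypotheses (E0 : 0 < E) (gaussE : (\int[mu]_x gauss x = E%:E)%E).

Lemma slice_integral_log_convex (x y : 'rV[R]_n) (l : R) (Vx Vy Vz : 'M[R]_(n, k))
    (F : 'M[R]_(n, d) -> R) :
  let I V := (\int[mu]_w (F (V *m vec_mx w))%:E)%E in
  n = k.+1 -> 0 < l < 1 -> std_simplex x -> std_simplex y ->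
  frame x Vx -> frame y Vy -> frame (l *: x + (1 - l) *: y) Vz -> mixture F ->
  (forall V, V^T *m V = 1%:M -> I V < +oo)%E ->
  fine (I Vz) <= fine (I Vx) `^ l * fine (I Vy) `^ (1 - l).
Proof.
move=> I nk l01 sx sy fx fy fz mF IV.
have [l0 l1] : 0 < l /\ 0 < 1 - l by have /andP[? ?] := l01; rewrite subr_gt0.
have e0 j : 0 < j.+1%:R^-1 :> R by rewrite invr_gt0.
have J0 (V : 'M[R]_(n, k)) j : 0 <= fine (damped j.+1%:R^-1 V F).
  by rewrite fine_ge0//; have /andP[] := damped_fin E0 gaussE V (e0 j) mF.
have c a (V : 'M[R]_(n, k)) : frame a V ->
    fine (damped j.+1%:R^-1 V F) @[j --> \oo] --> fine (I V).
  by case=> b [VV _ _ _]; apply: damped_cvg => //; exact: IV.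
have cxy := cvgM (cvg_powR l0 (J0 Vx) (c _ _ fx)) (cvg_powR l1 (J0 Vy) (c _ _ fy)).
apply: (ler_cvg_to (c _ _ fz) (cxy _)); apply: nearW => j.
exact: (damped_log_convex E0 gaussE nk (e0 j) l01 sx sy fx fy fz mF).
Qed.

End Undamped.

(** * Measures of the slices *)

Section Frames.
Context {R : realType} {n k d : nat} (V : 'M[R]_(n, k)).
Hypothesis VV : V^T *m V = 1%:M.

Lemma euclidean_norm_frame (y : 'rV[R]_(k * d)) :
  euclidean_norm (V *m vec_mx y) = euclidean_norm y.
Proof.
rewrite /euclidean_norm; congr Num.sqrt.
have trE p q (x : 'M[R]_(p, q)) : \sum_i \sum_j x i j ^+ 2 = \tr (x *m x^T).
  rewrite -sum_row_dot; apply: eq_bigr => i _; rewrite mxE.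
  by apply: eq_bigr => j _; rewrite !mxE expr2.
rewrite trE trmx_mul mulmxA mxtrace_mulC mulmxA mulmxA VV mul1mx -sum_row_dot -mxvec_dot.
by rewrite vec_mxK trE -trace_mx11.
Qed.

Lemma euclidean_norm_frameB (x y : 'rV[R]_(k * d)) :
  euclidean_norm (V *m vec_mx x - V *m vec_mx y) = euclidean_norm (x - y).
Proof. by rewrite -mulmxBr -linearB/= euclidean_norm_frame. Qed.

End Frames.

Section GaussianMass.
Context {R : realType} {m : nat}.
Local Notation mu := (@hmu R m).

Lemma sqnorm_ge0 (y : 'rV[R]_m) : 0 <= sqnorm y.
Proof. by apply: sumr_ge0 => i _; exact: sqr_ge0. Qed.

Lemma sqnormZ t (y : 'rV[R]_m) : 0 < t -> sqnorm (t *: y) = t `^ 2 * sqnorm y.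
Proof.
move=> t0; rewrite powR_mulrn ?(ltW t0)// mulr_sumr.
by apply: eq_bigr => i _; rewrite mxE exprMn.
Qed.

Lemma unit_ball_lty : (mu [set y | (sqnorm y <= 1)%R] < +oo)%E.
Proof.
apply: (@hmu_bounded _ _ _ 1) => y /= y1 i.
rewrite -(@ler_pXn2r _ 2)// ?nnegrE// expr1n real_normK ?num_real//.
apply: le_trans y1; rewrite /sqnorm (bigD1 i)//= lerDl sumr_ge0// => j _.
exact: sqr_ge0.
Qed.

Let two0 : 0 < 2 :> R. Proof. by []. Qed.

Lemma gauss_lty : (\int[mu]_y gauss y < +oo)%E.
Proof.
have := layer_cake_upper two0 sqnorm_ge0 measurable_sqnorm sqnormZ unit_ball_lty ltr01.
move=> /le_lt_trans; apply.
have K0 := @kappa_gt0 R m 2 1 ltr01.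
have KE : kappa (m := m) (2 : R) 1 \is a fin_num by rewrite ge0_fin_numE ?kappa_lty// ltW.
have BE : mu [set y | (sqnorm y <= 1)%R] \is a fin_num by rewrite ge0_fin_numE ?unit_ball_lty.
by rewrite -(fineK KE) -(fineK BE) -EFinM ltry.
Qed.

(** If the Gaussian mass vanished, so would the measure of every bounded set. *)
Lemma gauss0_bounded (A : set 'rV[R]_m) (r : R) : (\int[mu]_y gauss y = 0)%E ->
  (forall y, A y -> forall i, `|y 0 i| <= r) -> mu A = 0%E.
Proof.
move=> g0 Ar; have K0 := @kappa_gt0 R m 2 1 ltr01.
have B0 : mu [set y | (sqnorm y <= 1)%R] = 0%E.
  have := layer_cake_lower two0 sqnorm_ge0 measurable_sqnorm sqnormZ unit_ball_lty ltr01.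
  rewrite g0; have : (0 <= mu [set y | (sqnorm y <= 1)%R])%E by [].
  move: (mu _) => b b0 H; apply/eqP; rewrite eq_le b0 andbT leNgt; apply/negP => b1.
  by move: H; rewrite leNgt !mule_gt0// lte_fin expR_gt0.
pose s := \sum_(i < m) r ^+ 2 + 1.
have s0 : 0 < s by rewrite ltr_wpDl// sumr_ge0// => i _; exact: sqr_ge0.
apply/eqP; rewrite eq_le measure_ge0 andbT.
apply: (@le_trans _ _ (mu [set y | sqnorm y <= s])).
  apply: le_hausdorff_pre => y Ay /=; apply: (@le_trans _ _ (\sum_(i < m) r ^+ 2)); last by rewrite lerDl.
  apply: ler_sum => i _; rewrite -real_normK ?num_real// ler_pXn2r ?nnegrE//.
    exact: Ar.
  exact: le_trans (Ar _ Ay i).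
by rewrite (hmu_sublevel two0 sqnormZ s0) B0 mule0.
Qed.

End GaussianMass.

Section SliceMeasure.
Context {R : realType} {k d : nat} (p : R) (K : set 'rV[R]_d).
Hypothesis p02 : 0 < p <= 2.
Hypothesis K_star : star_body K.
Hypothesis K_Lp : embeds_isometrically_in_Lp p K.
Local Notation nK := (minkowski_functional K).
Local Notation n := k.+1.
Local Notation m := (k * d)%N.
Local Notation mu := (@hmu R m).
Implicit Types (V : 'M[R]_(n, k)) (y : 'rV[R]_m).

Let p0 : 0 < p. Proof. by have /andP[] := p02. Qed.

(** The p-th power of the norm on the range of V, in coordinates. *)
Definition slice_norm V y : R := \sum_i nK (row i (V *m vec_mx y)) `^ p.

(** The slice of the ball in coordinates. *)
Definition slice V : set 'rV[R]_m := [set y | slice_norm V y <= 1].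

Lemma slice_norm_ge0 V y : 0 <= slice_norm V y.
Proof. by apply: sumr_ge0 => i _; exact: powR_ge0. Qed.

Lemma measurable_slice_norm V : measurable_fun setT (slice_norm V).
Proof.
have := measurable_mixture V (mixture_norms p02 K_Lp n).
move=> /(measurableT_comp (@measurable_ln R)) mlnF.
have -> : slice_norm V = (fun z => - z) \o (fun y => - slice_norm V y).
  by apply/funext => y; rewrite /= opprK.
apply: measurableT_comp; first exact: oppr_measurable.
by move: mlnF; congr measurable_fun; apply/funext => y; rewrite /= expRK.
Qed.

Lemma slice_normZ V t y : 0 < t -> slice_norm V (t *: y) = t `^ p * slice_norm V y.
Proof.
move=> t0; rewrite /slice_norm mulr_sumr; apply: eq_bigr => i _.
by rewrite -(norm_powR_scale p02 K_Lp _ t0) linearZ/= -scalemxAr linearZ.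
Qed.

Lemma slice_bounded V : V^T *m V = 1%:M ->
  exists r, forall y, slice V y -> forall j, `|y 0 j| <= r.
Proof.
move=> VV; have [M M0 HM] := minkowski_bound K_star.
exists (Num.sqrt (\sum_(i < n) \sum_(j < d) M ^+ 2)) => y Ny j.
apply: le_trans (entry_le_euclidean_norm y 0 j) _.
rewrite -(euclidean_norm_frame VV) /euclidean_norm; apply: ler_wsqrtr.
apply: ler_sum => i _; apply: ler_sum => c _.
have Ni : nK (row i (V *m vec_mx y)) `^ p <= 1.
  apply: le_trans Ny; rewrite /slice_norm (bigD1 i)//= lerDl sumr_ge0// => *.
  exact: powR_ge0.
have N1 : nK (row i (V *m vec_mx y)) <= 1.
  rewrite leNgt; apply/negP => N1; move: Ni; rewrite leNgt => /negP; apply.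
  rewrite (_ : 1 = 1 `^ p); last by rewrite powR1.
  by apply: gt0_ltr_powR; rewrite ?nnegrE ?minkowski_ge0.
rewrite -real_normK ?num_real// ler_pXn2r ?nnegrE//.
have := HM (row i (V *m vec_mx y)) c; rewrite mxE => /le_trans; apply.
by rewrite ler_piMr.
Qed.

Lemma slice_lty V : V^T *m V = 1%:M -> (mu (slice V) < +oo)%E.
Proof. by move=> /slice_bounded[r Hr]; exact: hmu_bounded Hr. Qed.

Let beta V := fine (mu (slice V)).

Lemma slice_log_convex (x y : 'rV[R]_n) (l : R) Vx Vy Vz :
  0 < l < 1 -> std_simplex x -> std_simplex y ->
  frame x Vx -> frame y Vy -> frame (l *: x + (1 - l) *: y) Vz ->
  beta Vz <= beta Vx `^ l * beta Vy `^ (1 - l).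
Proof.
move=> l01 sx sy fx fy fz.
have [l0 l1] : 0 < l /\ 0 < 1 - l by have /andP[? ?] := l01; rewrite subr_gt0.
have VVz : Vz^T *m Vz = 1%:M by have [b []] := fz.
have VVx : Vx^T *m Vx = 1%:M by have [b []] := fx.
have VVy : Vy^T *m Vy = 1%:M by have [b []] := fy.
have g0 : (0 <= \int[mu]_y gauss y)%E by apply: integral_ge0 => w _; exact: gauss_ge0.
have [E gaussE] : exists E, (\int[mu]_y gauss y = E%:E)%E.
  by exists (fine (\int[mu]_y gauss y)); rewrite fineK// ge0_fin_numE// gauss_lty.
(* if E = 0, the slices are null sets, being bounded *)
have [E0|E0] := eqVneq E 0.
  have [r Hr] := slice_bounded VVz.
  by rewrite {1}/beta (gauss0_bounded _ Hr) ?mulr_ge0 ?powR_ge0// gaussE E0.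
have {}E0 : 0 < E by rewrite lt_neqAle eq_sym E0 -lee_fin -gaussE.
pose F := fun x : 'M[R]_(n, d) => expR (- \sum_i nK (row i x) `^ p).
have mF : mixture F := mixture_norms p02 K_Lp n.
pose I V := (\int[mu]_w (F (V *m vec_mx w))%:E)%E.
have I0 V : (0 <= I V)%E by apply: integral_ge0 => w _; rewrite lee_fin expR_ge0.
have betaE V : V^T *m V = 1%:M -> mu (slice V) = (beta V)%:E.
  by move=> VV; rewrite /beta fineK// ge0_fin_numE ?slice_lty.
have beta0 V : 0 <= beta V by rewrite /beta fine_ge0.
(* the integrals are the measures of the slices, up to a common factor c and an
   error factor exp(-h) *)
have key h : 0 < h -> exists2 c : R, 0 < c & forall V, V^T *m V = 1%:M ->
    I V = (fine (I V))%:E /\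
    expR (- h) * (beta V * c) <= fine (I V) <= beta V * c.
  move=> h0; have K0 := @kappa_gt0 R m p h h0.
  have KE : kappa (m := m) p h \is a fin_num by rewrite ge0_fin_numE ?kappa_lty// ltW.
  exists (fine (kappa (m := m) p h)) => [|V VV]; first by rewrite -lte_fin fineK.
  have := layer_cake_lower p0 (slice_norm_ge0 V) (measurable_slice_norm V)
    (slice_normZ V) (slice_lty VV) h0.
  have := layer_cake_upper p0 (slice_norm_ge0 V) (measurable_slice_norm V)
    (slice_normZ V) (slice_lty VV) h0.
  rewrite -/(slice V) betaE// -(fineK KE) -/(I V) -!EFinM => up lo.
  have IE : I V = (fine (I V))%:E by rewrite fineK// ge0_fin_numE// (le_lt_trans up)// ltry.
  split => //; move: up lo; rewrite IE !lee_fin /= => -> ->.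
  by [].
have bound h : 0 < h -> expR (- h) * beta Vz <= beta Vx `^ l * beta Vy `^ (1 - l).
  move=> h0; have [c c0 Hc] := key h h0.
  have If V : V^T *m V = 1%:M -> (I V < +oo)%E by move=> /Hc[-> _]; rewrite ltry.
  have H : fine (I Vz) <= fine (I Vx) `^ l * fine (I Vy) `^ (1 - l).
    exact: (slice_integral_log_convex E0 gaussE (erefl n) l01 sx sy fx fy fz mF If).
  have [_ /andP[loz _]] := Hc _ VVz; have [_ /andP[_ upx]] := Hc _ VVx.
  have [_ /andP[_ upy]] := Hc _ VVy.
  rewrite -(ler_pM2r c0) -mulrA; apply: le_trans loz _.
  apply: le_trans H _.
  apply: (@le_trans _ _ ((beta Vx * c) `^ l * (beta Vy * c) `^ (1 - l))).
    have mono s u v : 0 < s -> 0 <= u -> u <= v -> u `^ s <= v `^ s.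
      by move=> s0 u0 uv; apply: ge0_ler_powR; rewrite ?nnegrE ?(ltW s0)// (le_trans u0).
    have fI0 V : 0 <= fine (I V) := fine_ge0 (I0 V).
    apply: ler_pM; [exact: powR_ge0|exact: powR_ge0| |].
      exact: mono l0 (fI0 _) upx.
    exact: mono l1 (fI0 _) upy.
  have := powR_mul_split l (ltW c0) (beta0 Vx) (beta0 Vy).
  by move: (beta Vx) (beta Vy) => u v; rewrite (mulrC u c) (mulrC v c) => ->; rewrite mulrC.
rewrite leNgt; apply/negP; set C := _ * _ => Cb.
have C0 : 0 <= C by rewrite mulr_ge0 ?powR_ge0.
have b0 : 0 < beta Vz := le_lt_trans C0 Cb.
(* if C < beta Vz, this h satisfies C < (1 - h) beta Vz <= exp(-h) beta Vz *)
pose h := (beta Vz - C) / (2 * beta Vz).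
have h0 : 0 < h by rewrite divr_gt0 ?subr_gt0 ?mulr_gt0.
have := bound h h0; rewrite leNgt => /negP; apply.
apply: (@lt_le_trans _ _ ((1 - h) * beta Vz)).
  rewrite -/C mulrBl mul1r /h invfM mulrA mulfVK ?gt_eqF//; lra.
rewrite ler_pM2r//; apply: le_trans (expR_ge1Dx _); exact: lexx.
Qed.

(** The slice is an isometric copy of B_p^n(K) cut by the subspace. *)
Lemma simplex_frame (a : 'rV[R]_n) : std_simplex a ->
  exists2 V, frame a V & hausdorff_pre m (Bpn p K `&` Hsqrt a) = mu (slice V).
Proof.
move=> [a01 a1]; pose b : 'cV[R]_n := \col_i Num.sqrt (a 0 i).
have b2 i : b i 0 ^+ 2 = a 0 i by rewrite mxE sqr_sqrtr//; have /andP[] := a01 i.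
have bb : b^T *m b = 1%:M.
  rewrite [LHS]mx11_scalar mxE -a1; congr (_%:M); apply: eq_bigr => i _.
  by rewrite [X in X * _]mxE -expr2 b2.
have HE (x : 'M[R]_(n, d)) : \sum_(i < n) Num.sqrt (a 0 i) *: row i x = b^T *m x.
  by rewrite mulmx_sum_row; apply: eq_bigr => i _; rewrite !mxE.
have [V [VV Vb VVbb]] := orthogonal_completion bb.
have bV : b^T *m V = 0 by rewrite -[LHS]trmxK trmx_mul trmxK Vb trmx0.
exists V; first by exists b.
rewrite -[RHS](hausdorff_pre_isometry m _ (euclidean_norm_frameB VV)).
congr (hausdorff_pre _ _); apply/seteqP; split => [x [Bx]|_ [y By <-]].
- rewrite /Hsqrt /= HE => bx; exists (mxvec (V^T *m x)); last first.
    by rewrite mxvecK mulmxA -[RHS]mul1mx -VVbb mulmxDl -(mulmxA b) bx mulmx0 addr0.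
  rewrite /slice /= /slice_norm mxvecK mulmxA.
  have -> : V *m V^T *m x = x.
    by rewrite -[RHS]mul1mx -VVbb mulmxDl -(mulmxA b) bx mulmx0 addr0.
  exact: Bx.
- split; first exact: By.
  by rewrite /Hsqrt /= HE mulmxA bV mul0mx.
Qed.

End SliceMeasure.

Lemma unit_ball_volume_ge0 (R : realType) m : 0 <= unit_ball_volume R m.
Proof.
suff : 0 <= unit_ball_volume R m /\ 0 <= unit_ball_volume R m.+1 by case.
elim: m => [|m [IH IH']] /=; first by [].
by split=> //; rewrite mulr_ge0// divr_ge0// mulr_ge0// pi_ge0.
Qed.

Unset Implicit Arguments.

Theorem theorem4p3 (R : realType) (n d : nat) (p : R) (K : set 'rV[R]_d)
    (p_range : 0 < p <= 2)
    (K_star : star_body K)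
    (K_sym : symmetric_set K)
    (K_Lp : embeds_isometrically_in_Lp p K) :
  log_convex_on (@std_simplex R n)
    (fun a => hausdorff_measure (n * d - d) (Bpn p K `&` Hsqrt a)).
Proof.
(* for n = 0 the simplex is empty *)
case: n => [|k].
  have none (a : 'rV[R]_0) : ~ std_simplex a.
    by move=> [_]; rewrite big_ord0 => /eqP; rewrite eq_sym oner_eq0.
  by split=> [a /none|x y l /none].
rewrite mulSn addKn.
have [c c0 cE] : exists2 c : R, 0 <= c & forall A : set 'M[R]_(k.+1, d),
    hausdorff_measure (k * d) A = (c%:E * hausdorff_pre (k * d) A)%E.
  exists (unit_ball_volume R (k * d) / 2 ^+ (k * d)) => //.
  by rewrite divr_ge0 ?exprn_ge0// unit_ball_volume_ge0.
have slices (a : 'rV[R]_k.+1) : std_simplex a -> exists2 V : 'M[R]_(k.+1, k), frame a V &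
    hausdorff_measure (k * d) (Bpn p K `&` Hsqrt a) =
    (c * fine (hmu (slice p K V)))%:E.
  move=> sa; have [V fV HV] := simplex_frame p K sa; exists V => //.
  have [b [VV _ _ _]] := fV.
  by rewrite cE HV EFinM fineK// ge0_fin_numE// (slice_lty p_range K_star VV).
split=> [a sa|x y l sx sy l01].
  have [V _ ->] := slices a sa.
  by rewrite ltry andbT lee_fin mulr_ge0// fine_ge0.
have sz : std_simplex (l *: x + (1 - l) *: y).
  have [l0 l1] : 0 <= l /\ 0 <= 1 - l by have /andP[? ?] := l01; rewrite subr_ge0 !ltW.
  have [[x01 x1] [y01 y1]] := (sx, sy); split=> [i|].
    have /andP[xi0 xi1] := x01 i; have /andP[yi0 yi1] := y01 i.
    rewrite !mxE addr_ge0 ?mulr_ge0//=.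
    apply: (@le_trans _ _ (l * 1 + (1 - l) * 1)); last lra.
    by apply: lerD; apply: ler_wpM2l.
  under eq_bigr do rewrite !mxE.
  by rewrite big_split/= -!mulr_sumr x1 y1; lra.
have [Vx fx ->] := slices x sx; have [Vy fy ->] := slices y sy.
have [Vz fz ->] := slices _ sz.
have H := slice_log_convex p_range K_star K_Lp l01 sx sy fx fy fz.
have scale u v w : 0 <= u -> 0 <= v -> w <= u `^ l * v `^ (1 - l) ->
    ((c * w)%:E <= (c * u)%:E `^ l * (c * v)%:E `^ (1 - l))%E.
  move=> u0 v0 wuv; rewrite !poweR_EFin -EFinM lee_fin (powR_mul_split l c0 u0 v0).
  exact: ler_wpM2l.
have f0 (V : 'M[R]_(k.+1, k)) : 0 <= fine (hmu (slice p K V)) by exact: fine_ge0.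
exact: scale (f0 Vx) (f0 Vy) H.
Qed.
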